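(* The Barnes $G$-function admits the Binet integral representation: for $\Re(z)>0$, $$\log G(z+1)=z\log\Gamma(z)+\frac{z^2}{4}-\frac{\log z}{2}\,B_2(z)-\log A-\int_0^\infty\frac{e^{-zx}}{x^2}\Big(\frac{1}{1-e^{-x}}-\frac1x-\frac12-\frac{x}{12}\Big)\,dx.$$
   Context: The Barnes $G$-function is the function characterized by $G(z+1)=\Gamma(z)G(z)$ for $z\in\mathbb{C}$ ($\Gamma$ the Euler gamma function), $G(1)=G(2)=G(3)=1$, and $\frac{d^3}{dz^3}\log G(z)\ge0$ for $z>0$; equivalently $$G(z+1)=(2\pi)^{z/2}\exp\Big(-\frac{z+z^2(1+\gamma)}{2}\Big)\prod_{k=1}^{\infty}\Big(1+\frac{z}{k}\Big)^k\exp\Big(\frac{z^2}{2k}-z\Big),$$ where $\gamma$ is the Euler–Mascheroni constant. $B_2(z)=z^2-z+\frac16$ is the second Bernoulli polynomial, and $A$ is the Glaisher–Kinkelin constant, given by $\log A=\frac1{12}-\zeta'(-1)$ with $\zeta$ the Riemann zeta function.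
   Formalization: The integral enters with a plus sign instead of the printed minus sign: at z = 1 the printed formula would force the integral to equal 1/4 − log A > 0, although its integrand is negative. *)

(* Defs.v *)
From Stdlib Require Export Reals ClassicalEpsilon.
From Coquelicot Require Export Coquelicot.

Open Scope R_scope.

Definition Cexp (z : C) : C :=
  (exp (Re z) * cos (Im z), exp (Re z) * sin (Im z)).

(* Principal logarithm.  By the half-angle formula, 2 atan (y / (|z| + x)) is
   the argument of z = x + iy in (-PI, PI) off the cut (-oo, 0]; the value on
   the cut is not meaningful. *)
Definition Clog (z : C) : C :=
  (ln (Cmod z), 2 * atan (Im z / (Cmod z + Re z))).

(* [Rcpow x s] is x ^ s = exp (s ln x), meant for a real base x > 0. *)
Definition Rcpow (x : R) (s : C) : C := Cexp (s * RtoC (ln x)).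

Definition Clim_seq (u : nat -> C) : C :=
  iota (fun l : C_CompleteNormedModule => filterlim u eventually (locally l)).

(* [Cprod f n] = f 1 * ... * f n: the index starts at 1. *)
Fixpoint Cprod (f : nat -> C) (n : nat) : C :=
  match n with
  | O => RtoC 1
  | S m => (Cprod f m * f (S m))%C
  end.

(* Euler's integral of the second kind; it is the gamma function only for
   0 < Re z. *)
Definition Gamma (z : C) : C :=
  RInt_gen (V := C_R_CompleteNormedModule)
    (fun t : R => (Rcpow t (z - 1) * RtoC (exp (- t)))%C)
    (at_right 0) (Rbar_locally p_infty).

Definition euler_gamma : R :=
  real (Lim_seq (fun n => sum_n_m (fun k => / INR k) 1 n - ln (INR n))).

Definition barnes_factor (z : C) (k : nat) : C :=
  ((1 + z / RtoC (INR k)) ^ k * Cexp (z ^ 2 / (2 * RtoC (INR k)) - z))%C.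

(* The product formula is written for G (z + 1), whence z = w - 1. *)
Definition BarnesG (w : C) : C :=
  let z := (w - 1)%C in
  (Rcpow (2 * PI) (z / 2)
   * Cexp (- ((z + z ^ 2 * (1 + RtoC euler_gamma)) / 2))
   * Clim_seq (Cprod (barnes_factor z)))%C.

(* [L] is the continuous logarithm of [f] on the half-plane 0 < Re z which is
   real on the positive real axis.  For f positive there and zero-free on the
   half-plane it is unique on the half-plane; in general it is not the
   principal logarithm of f z. *)
Definition is_log_branch (f L : C -> C) : Prop :=
  (forall z : C, 0 < Re z ->
     continuous (T := C_UniformSpace) (U := C_UniformSpace) L z) /\
  (forall z : C, 0 < Re z -> Cexp (L z) = f z) /\
  (forall x : R, 0 < x -> Im (L (RtoC x)) = 0).

Definition log_branch (f : C -> C) : C -> C :=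
  epsilon (inhabits (fun _ : C => RtoC 0)) (is_log_branch f).

Definition analytic_at (f : C -> C) (z0 : C) : Prop :=
  exists (a : nat -> C) (r : R), 0 < r /\
    forall z : C, Cmod (z - z0) < r ->
      is_pseries (K := C_AbsRing) (V := C_NormedModule) a (z - z0)%C (f z).

(* The analytic continuation of the Dirichlet series to C \ {1}; by the
   identity theorem this determines [zeta] except for its value at 1. *)
Definition is_riemann_zeta (zeta : C -> C) : Prop :=
  (forall s : C, 1 < Re s ->
     is_series (K := C_AbsRing) (V := C_NormedModule)
       (fun n => Rcpow (INR (S n)) (- s)) (zeta s)) /\
  (forall s : C, s <> RtoC 1 -> analytic_at zeta s).

(* Since zeta' (-1) is real, taking the real part only changes the type. *)
Definition glaisher (zeta : C -> C) : R :=
  exp (1 / 12 - Re (C_derive zeta (RtoC (-1)))).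

Definition bernoulli2 (z : C) : C := (z ^ 2 - z + 1 / 6)%C.

(* The integrand is negative for real z > 0.  Its integral enters log G (z + 1)
   with a plus sign: at z = 1, where log G 2 = log (Gamma 1) = log 1 = 0, the
   integral must equal log A - 1/4 < 0.  The formula is also found in print
   with a minus sign, which is a misprint. *)
Definition binet_integrand (z : C) (x : R) : C :=
  (Cexp (- (z * RtoC x)) / RtoC (x ^ 2)
   * RtoC (1 / (1 - exp (- x)) - 1 / x - 1 / 2 - x / 12))%C.

(* Main.v *)
(* Both sides are reduced to series of elementary steps on the right half-plane.
   With b(w) = (2w+1)/4 - (6w^2+6w+1)/12 (log(w+1) - log w), Euler-Maclaurin
   with the kernel q(u) = -u^2(1-u)^2/24 gives b(w) = int_0^1 2q(u)/(w+u)^3 du.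

   - Since (1-e^-x)K(x) = x^4 int_0^1 q(u) e^(-ux) du for the Binet kernel K,
     the Binet integral I(z) satisfies I(z) - I(z+1) = b(z), so it is
     sum_k b(z+k).
   - Euler's integral is lim n! n^z / (z(z+1)...(z+n)), and the logarithm of
     this product, like that of the Weierstrass product of G(z+1), telescopes
     against sum_k b(z+k) up to elementary terms, which are evaluated by
     Stirling's formula (Wallis product).  This proves the formula with the
     constant 1/4 + I(1) in place of log A.
   - Euler-Maclaurin with the same kernel continues zeta to Re s >= -1, as
     1/(s-1) + 1/2 + s/12 + s(s+1)(s+2)(s+3) W(s), where 2 W(-1) = I(1).  Any
     other analytic continuation agrees with it near -1 by the identity
     theorem along the segment from 2+3i to -1, which avoids the pole.  Hence
     zeta'(-1) = -1/6 - I(1), that is, log A = 1/4 + I(1). *)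

Require Import Defs.
From Stdlib Require Import Lra Lia Psatz Factorial Wf_nat.

(** Both logarithms in the statement are picked by [epsilon], so they are reached only through
    uniqueness: [LGamma] and [LBarnes] are explicit continuous candidates, real on the positive
    axis, whose exponentials are computed as limits of finite products.

    The polynomial q is -(B_4(u) - B_4)/24. It vanishes to second order at 0 and 1 and its fourth
    derivative is -1, so four integrations by parts against the fourth derivative of f leave the
    integral of f, the mean of its end values and a twelfth of the change of f'. The proof uses f =
    v log v (the function b), f = e^(-ux) (the Binet kernel) and f = v^(-s) (zeta). Since v log v is
    minus the s-derivative of v^(-s) at s = -1, the same series is bound to appear in the constant
    of G and in zeta'(-1).

    That constant enters through the sum of k ln k in the Weierstrass product, which is telescoped
    from the base point 1. At s = -1 the factor s(s+1)(s+2)(s+3) has a simple zero, so only the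
    value W(-1) is needed and W is never differentiated. *)

(** * Real and imaginary parts, and the modulus *)

Lemma C_eq (x y : C) : Re x = Re y -> Im x = Im y -> x = y.
Proof. destruct x, y; simpl; intros; subst; reflexivity. Qed.

Lemma Re_plus (x y : C) : Re (x + y)%C = Re x + Re y. Proof. reflexivity. Qed.
Lemma Im_plus (x y : C) : Im (x + y)%C = Im x + Im y. Proof. reflexivity. Qed.
Lemma Re_opp (x : C) : Re (- x)%C = - Re x. Proof. reflexivity. Qed.
Lemma Im_opp (x : C) : Im (- x)%C = - Im x. Proof. reflexivity. Qed.
Lemma Re_minus (x y : C) : Re (x - y)%C = Re x - Re y. Proof. reflexivity. Qed.
Lemma Im_minus (x y : C) : Im (x - y)%C = Im x - Im y. Proof. reflexivity. Qed.
Lemma Re_mult (x y : C) : Re (x * y)%C = Re x * Re y - Im x * Im y.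
Proof. reflexivity. Qed.
Lemma Im_mult (x y : C) : Im (x * y)%C = Re x * Im y + Im x * Re y.
Proof. reflexivity. Qed.
Lemma Re_RtoC (x : R) : Re (RtoC x) = x. Proof. reflexivity. Qed.
Lemma Im_RtoC (x : R) : Im (RtoC x) = 0. Proof. reflexivity. Qed.

Ltac reim := rewrite ?Re_plus, ?Im_plus, ?Re_minus, ?Im_minus, ?Re_opp, ?Im_opp,
  ?Re_mult, ?Im_mult, ?Re_RtoC, ?Im_RtoC.

Lemma Cmod_sqr (z : C) : Cmod z * Cmod z = Re z * Re z + Im z * Im z.
Proof.
  unfold Cmod. rewrite sqrt_sqrt; [unfold Re, Im; ring|].
  generalize (pow2_ge_0 (fst z)) (pow2_ge_0 (snd z)); lra.
Qed.

Lemma im_le_Cmod (z : C) : Rabs (Im z) <= Cmod z.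
Proof.
  apply Rsqr_incr_0_var; [|apply Cmod_ge_0].
  rewrite <- Rsqr_abs. unfold Rsqr. rewrite Cmod_sqr. nra.
Qed.

Lemma Cmod_le_abs (z : C) : Cmod z <= Rabs (Re z) + Rabs (Im z).
Proof.
  apply Rsqr_incr_0_var.
  2: generalize (Rabs_pos (Re z)) (Rabs_pos (Im z)); lra.
  unfold Rsqr. rewrite Cmod_sqr.
  generalize (Rsqr_abs (Re z)) (Rsqr_abs (Im z)); unfold Rsqr.
  generalize (Rabs_pos (Re z)) (Rabs_pos (Im z)); nra.
Qed.

Lemma Re_le_Cmod (z : C) : Re z <= Cmod z.
Proof. eapply Rle_trans; [apply Rle_abs | apply re_le_Cmod]. Qed.

Lemma Re_pos_neq_0 (z : C) : 0 < Re z -> z <> 0%C.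
Proof. intros H E; subst; simpl in H; lra. Qed.

Lemma RtoC_neq_0 (x : R) : x <> 0 -> RtoC x <> 0%C.
Proof. intros H E. apply H. now injection E. Qed.

Lemma Cmod_triangle_sub (x y : C) : Cmod (x - y)%C <= Cmod x + Cmod y.
Proof. rewrite <- (Cmod_opp y). apply Cmod_triangle. Qed.

Lemma Cmod_sub_sym (x y : C) : Cmod (x - y)%C = Cmod (y - x)%C.
Proof. rewrite <- Cmod_opp. f_equal. ring. Qed.

(** As a product of two copies of [R], [C] carries the Euclidean norm, so general bounds on
    integrals become bounds on [Cmod] with no extra factor. *)
Lemma norm_C_R (z : C) : norm (V := C_R_NormedModule) z = Cmod z.
Proof.
  unfold norm; simpl; unfold prod_norm, Cmod; simpl.
  unfold norm; simpl; unfold abs; simpl. f_equal.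
  generalize (Rsqr_abs (fst z)) (Rsqr_abs (snd z)); unfold Rsqr; nra.
Qed.

(** * Limits of complex sequences *)

(** Componentwise, so that every rule reduces to the one for real sequences; [Clim_locally] links it
    to the filter limits of the definitions. *)
Definition Clim (u : nat -> C) (l : C) : Prop :=
  is_lim_seq (fun n => Re (u n)) (Re l) /\ is_lim_seq (fun n => Im (u n)) (Im l).

Lemma Clim_Cmod (u : nat -> C) (l : C) :
  Clim u l <-> is_lim_seq (fun n => Cmod (u n - l)%C) 0.
Proof.
  split.
  - intros [H1 H2].
    apply (is_lim_seq_le_le (fun _ => 0) _
             (fun n => Rabs (Re (u n) - Re l) + Rabs (Im (u n) - Im l))).
    + intros n; split; [apply Cmod_ge_0|].
      eapply Rle_trans; [apply Cmod_le_abs|]. now reim.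
    + apply is_lim_seq_const.
    + replace (Finite 0) with (Finite (Rabs (Re l - Re l) + Rabs (Im l - Im l))).
      2: f_equal; rewrite !Rminus_diag, Rabs_R0; ring.
      apply is_lim_seq_plus'.
      * refine (is_lim_seq_abs _ (Finite _) _).
        apply is_lim_seq_minus'; [exact H1 | apply is_lim_seq_const].
      * refine (is_lim_seq_abs _ (Finite _) _).
        apply is_lim_seq_minus'; [exact H2 | apply is_lim_seq_const].
  - intros H.
    assert (G : forall f : C -> R, (forall z, Rabs (f z) <= Cmod z) ->
              (forall z w, f (z - w)%C = f z - f w) ->
              is_lim_seq (fun n => f (u n)) (f l)).
    { intros f Hf Hm.
      apply is_lim_seq_ext with (fun n => f (u n - l)%C + f l).
      { intros n; rewrite Hm; ring. }
      replace (Finite (f l)) with (Finite (0 + f l)) by (f_equal; ring).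
      apply is_lim_seq_plus'; [|apply is_lim_seq_const].
      apply is_lim_seq_abs_0.
      apply (is_lim_seq_le_le (fun _ => 0) _ (fun n => Cmod (u n - l)%C)).
      - intros n; split; [apply Rabs_pos | apply Hf].
      - apply is_lim_seq_const.
      - exact H. }
    split; apply G; try reflexivity; [apply re_le_Cmod | apply im_le_Cmod].
Qed.

Lemma Clim_eps (u : nat -> C) (l : C) :
  Clim u l <->
  forall eps, 0 < eps -> exists N, forall n, (N <= n)%nat -> Cmod (u n - l)%C < eps.
Proof.
  rewrite Clim_Cmod. rewrite <- is_lim_seq_spec. unfold is_lim_seq'. split.
  - intros H eps He. destruct (H (mkposreal eps He)) as [N HN].
    exists N; intros n Hn. specialize (HN n Hn). simpl in HN.
    rewrite Rminus_0_r, Rabs_pos_eq in HN; [exact HN | apply Cmod_ge_0].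
  - intros H eps. destruct (H eps (cond_pos eps)) as [N HN].
    exists N; intros n Hn. rewrite Rminus_0_r, Rabs_pos_eq; [auto | apply Cmod_ge_0].
Qed.

Lemma Clim_ext (u v : nat -> C) (l : C) :
  (forall n, u n = v n) -> Clim u l -> Clim v l.
Proof.
  intros E [H1 H2]; split; eapply is_lim_seq_ext; try eassumption;
  intros n; simpl; now rewrite E.
Qed.

Lemma Clim_ext_from (N : nat) (u v : nat -> C) (l : C) :
  (forall n, (N <= n)%nat -> u n = v n) -> Clim u l -> Clim v l.
Proof.
  intros E [H1 H2]; split; (eapply is_lim_seq_ext_loc; [|eassumption]);
  exists N; intros n Hn; now rewrite E.
Qed.

Lemma Clim_const (l : C) : Clim (fun _ => l) l.
Proof. split; apply is_lim_seq_const. Qed.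

Lemma Clim_plus (u v : nat -> C) (l m : C) :
  Clim u l -> Clim v m -> Clim (fun n => u n + v n)%C (l + m)%C.
Proof.
  intros [H1 H2] [H3 H4]; split; reim;
  (eapply is_lim_seq_ext; [|apply is_lim_seq_plus'; eassumption]); reflexivity.
Qed.

Lemma Clim_opp (u : nat -> C) (l : C) : Clim u l -> Clim (fun n => - u n)%C (- l)%C.
Proof.
  intros [H1 H2]; split; reim;
  [apply (is_lim_seq_opp _ (Finite (Re l))) | apply (is_lim_seq_opp _ (Finite (Im l)))];
  assumption.
Qed.

Lemma Clim_minus (u v : nat -> C) (l m : C) :
  Clim u l -> Clim v m -> Clim (fun n => u n - v n)%C (l - m)%C.
Proof. intros; apply Clim_plus; [|apply Clim_opp]; assumption. Qed.

Lemma Clim_mult (u v : nat -> C) (l m : C) :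
  Clim u l -> Clim v m -> Clim (fun n => u n * v n)%C (l * m)%C.
Proof.
  intros [H1 H2] [H3 H4]; split; reim.
  - eapply is_lim_seq_ext;
      [|apply is_lim_seq_minus'; [apply (is_lim_seq_mult' _ _ _ _ H1 H3)
                                 |apply (is_lim_seq_mult' _ _ _ _ H2 H4)]]; reflexivity.
  - eapply is_lim_seq_ext;
      [|apply is_lim_seq_plus'; [apply (is_lim_seq_mult' _ _ _ _ H1 H4)
                                 |apply (is_lim_seq_mult' _ _ _ _ H2 H3)]]; reflexivity.
Qed.

Lemma Clim_RtoC (u : nat -> R) (l : R) :
  is_lim_seq u l -> Clim (fun n => RtoC (u n)) (RtoC l).
Proof. intros H; split; simpl; [exact H | apply is_lim_seq_const]. Qed.

Lemma Clim_unique (u : nat -> C) (l m : C) : Clim u l -> Clim u m -> l = m.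
Proof.
  intros [H1 H2] [H3 H4]; apply C_eq.
  - apply is_lim_seq_unique in H1. apply is_lim_seq_unique in H3. congruence.
  - apply is_lim_seq_unique in H2. apply is_lim_seq_unique in H4. congruence.
Qed.

Lemma Clim_incr_1 (u : nat -> C) (l : C) : Clim (fun n => u (S n)) l <-> Clim u l.
Proof.
  unfold Clim.
  rewrite (is_lim_seq_incr_1 (fun n => Re (u n))).
  rewrite (is_lim_seq_incr_1 (fun n => Im (u n))). reflexivity.
Qed.

Lemma Clim_Cmod_le (u : nat -> C) (l : C) (M : R) :
  Clim u l -> (forall n, Cmod (u n) <= M) -> Cmod l <= M.
Proof.
  intros H HM. rewrite Clim_eps in H. apply le_epsilon. intros eps He.
  destruct (H eps He) as [N HN]. specialize (HN N (Nat.le_refl N)).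
  replace l with (u N - (u N - l))%C by ring.
  eapply Rle_trans; [apply Cmod_triangle_sub|].
  specialize (HM N). lra.
Qed.

(** The balls of the product structure on [C] are squares, so the filter limit splits into two real
    limits. *)
Lemma Clim_locally (u : nat -> C) (l : C) :
  Clim u l <-> filterlim u eventually (locally (T := C_UniformSpace) l).
Proof.
  split.
  - intros [H1 H2] P [eps HP].
    apply is_lim_seq_spec in H1; apply is_lim_seq_spec in H2.
    destruct (H1 eps) as [N1 HN1], (H2 eps) as [N2 HN2].
    exists (max N1 N2). intros n Hn. apply HP. split; [apply HN1 | apply HN2]; lia.
  - intros H; split; apply is_lim_seq_spec; intros eps;
    destruct (H (fun z => ball (M := C_UniformSpace) l eps z)
                (locally_ball (T := C_UniformSpace) l eps)) as [N HN];
    exists N; intros n Hn; apply HN; assumption.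
Qed.

Lemma Clim_seq_eq (u : nat -> C) (l : C) : Clim u l -> Clim_seq u = l.
Proof.
  intros H. unfold Clim_seq.
  apply (iota_filterlim_locally (V := C_CompleteNormedModule)).
  now apply Clim_locally.
Qed.

(** * The complex exponential and logarithm *)

Lemma Cexp_0 : Cexp 0 = 1%C.
Proof. unfold Cexp; simpl. rewrite exp_0, cos_0, sin_0. apply C_eq; simpl; ring. Qed.

Lemma Cexp_plus (x y : C) : Cexp (x + y) = (Cexp x * Cexp y)%C.
Proof.
  unfold Cexp. reim. rewrite exp_plus, cos_plus, sin_plus. apply C_eq; simpl; ring.
Qed.

Lemma Cmod_Cexp (z : C) : Cmod (Cexp z) = exp (Re z).
Proof.
  apply Rsqr_inj; [apply Cmod_ge_0 | left; apply exp_pos |].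
  unfold Rsqr. rewrite Cmod_sqr. unfold Cexp; simpl.
  generalize (sin2_cos2 (Im z)); unfold Rsqr; nra.
Qed.

Lemma Cexp_neq_0 (z : C) : Cexp z <> 0%C.
Proof. apply Cmod_gt_0. rewrite Cmod_Cexp. apply exp_pos. Qed.

Lemma Cexp_opp (z : C) : Cexp (- z) = (/ Cexp z)%C.
Proof.
  assert (E : (Cexp z * Cexp (- z) = 1)%C).
  { rewrite <- Cexp_plus. replace (z + - z)%C with (RtoC 0) by ring. apply Cexp_0. }
  rewrite <- (Cmult_1_r (/ Cexp z)), <- E. field. apply Cexp_neq_0.
Qed.

Lemma Cexp_minus (x y : C) : Cexp (x - y) = (Cexp x / Cexp y)%C.
Proof. unfold Cminus. now rewrite Cexp_plus, Cexp_opp. Qed.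

Lemma Cexp_RtoC (x : R) : Cexp (RtoC x) = RtoC (exp x).
Proof. unfold Cexp; simpl. rewrite cos_0, sin_0. apply C_eq; simpl; ring. Qed.

Lemma Cexp_mult_INR (n : nat) (z : C) : Cexp (RtoC (INR n) * z) = (Cexp z ^ n)%C.
Proof.
  induction n.
  - simpl. replace (RtoC 0 * z)%C with (RtoC 0) by ring. apply Cexp_0.
  - rewrite S_INR, RtoC_plus.
    replace ((INR n + 1) * z)%C with (z + INR n * z)%C by ring.
    rewrite Cexp_plus, IHn. reflexivity.
Qed.

Lemma Clim_Cexp (u : nat -> C) (l : C) :
  Clim u l -> Clim (fun n => Cexp (u n)) (Cexp l).
Proof.
  intros [H1 H2].
  assert (E : is_lim_seq (fun n => exp (Re (u n))) (exp (Re l))).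
  { apply is_lim_seq_continuous; [|exact H1]. apply derivable_continuous_pt, derivable_pt_exp. }
  split; unfold Cexp; simpl; apply is_lim_seq_mult'; try exact E;
  (apply is_lim_seq_continuous; [|exact H2]).
  - apply continuity_cos.
  - apply continuity_sin.
Qed.

Lemma Cmod_plus_Re_pos (z : C) : 0 < Re z -> 0 < Cmod z + Re z.
Proof. intros; generalize (Cmod_ge_0 z); lra. Qed.

(** With t = y / (|z| + x), the tangent of half the argument, the double-angle formulas need only 1
    + t^2 = 2|z| / (|z| + x), which restates x^2 + y^2 = |z|^2. *)
Lemma Cexp_Clog (z : C) : 0 < Re z -> Cexp (Clog z) = z.
Proof.
  intros Hz. unfold Cexp, Clog; simpl.
  pose proof (Cmod_plus_Re_pos z Hz) as Hp.
  assert (Hr : 0 < Cmod z) by (apply Cmod_gt_0, Re_pos_neq_0, Hz).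
  pose proof (Cmod_sqr z) as Hs.
  rewrite exp_ln by exact Hr.
  set (t := Im z / (Cmod z + Re z)).
  assert (Ht : 0 < 1 + t * t) by nra.
  assert (E1 : 1 + t * t = 2 * Cmod z / (Cmod z + Re z)).
  { unfold t. field_simplify_eq; [|lra]. nra. }
  rewrite cos_2a, sin_2a, cos_atan, sin_atan.
  pose proof (sqrt_sqrt (1 + t²) (Rlt_le _ _ Ht)) as Hq.
  assert (Hq0 : 0 < sqrt (1 + t²)) by (apply sqrt_lt_R0; exact Ht).
  set (s := sqrt (1 + t²)) in *.
  assert (Hs2 : s * s = 2 * Cmod z / (Cmod z + Re z)) by (rewrite Hq; exact E1).
  assert (A1 : 1 / s * (1 / s) = (Cmod z + Re z) / (2 * Cmod z)).
  { replace (1 / s * (1 / s)) with (/ (s * s)) by (field; lra). rewrite Hs2. field. lra. }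
  apply C_eq; simpl.
  - replace (1 / s * (1 / s) - t / s * (t / s)) with ((1 / s * (1 / s)) * (1 - t * t))
      by (field; lra).
    rewrite A1. replace (1 - t * t) with (2 - (1 + t * t)) by ring. rewrite E1.
    field. lra.
  - replace (2 * (t / s) * (1 / s)) with ((1 / s * (1 / s)) * (2 * t)) by (field; lra).
    rewrite A1. unfold t. field. lra.
Qed.

Lemma Clog_RtoC (x : R) : 0 < x -> Clog (RtoC x) = RtoC (ln x).
Proof.
  intros Hx. unfold Clog. rewrite Cmod_R, Rabs_pos_eq by lra. simpl.
  unfold Rdiv. rewrite Rmult_0_l, atan_0, Rmult_0_r. reflexivity.
Qed.

Lemma Clog_scal (k : R) (z : C) : 0 < k -> 0 < Re z ->
  Clog (RtoC k * z) = (RtoC (ln k) + Clog z)%C.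
Proof.
  intros Hk Hz. unfold Clog.
  pose proof (Cmod_plus_Re_pos z Hz) as Hp.
  assert (Hr : 0 < Cmod z) by (apply Cmod_gt_0, Re_pos_neq_0, Hz).
  rewrite Cmod_mult, Cmod_R, Rabs_pos_eq by lra. reim.
  apply C_eq; simpl.
  - now apply ln_mult.
  - rewrite Rplus_0_l. do 2 f_equal. unfold Re, Im in *. field. split; nra.
Qed.

(** * Absolutely convergent complex series *)

(** Exactly [n] terms, of index below [n]: the empty sum is available and telescoping identities
    start by induction from 0. *)
Fixpoint Cpsum (f : nat -> C) (n : nat) : C :=
  match n with
  | O => 0%C
  | S m => (Cpsum f m + f m)%C
  end.

Definition Csum (f : nat -> C) : C :=
  (Series (fun n => Re (f n)), Series (fun n => Im (f n))).

Lemma Re_Cpsum (f : nat -> C) (n : nat) : Re (Cpsum f (S n)) = sum_n (fun k => Re (f k)) n.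
Proof.
  induction n.
  - rewrite sum_O. simpl. unfold Re; simpl; ring.
  - rewrite sum_Sn, <- IHn. reflexivity.
Qed.

Lemma Im_Cpsum (f : nat -> C) (n : nat) : Im (Cpsum f (S n)) = sum_n (fun k => Im (f k)) n.
Proof.
  induction n.
  - rewrite sum_O. simpl. unfold Im; simpl; ring.
  - rewrite sum_Sn, <- IHn. reflexivity.
Qed.

(** (k + 1/2)(k + 3/2) = (k + 1)^2 - 1/4 lies just below (k + 1)^2. *)
Lemma inv_sqr_telescope (k : nat) :
  / (INR k + 1) ^ 2 <= / (INR k + / 2) - / (INR (S k) + / 2).
Proof.
  rewrite S_INR. pose proof (pos_INR k).
  replace (/ (INR k + / 2) - / (INR k + 1 + / 2))
    with (/ ((INR k + / 2) * (INR k + 1 + / 2))) by (field; lra).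
  apply Rinv_le_contravar; nra.
Qed.

Lemma ex_series_inv_sqr : ex_series (fun k => / (INR k + 1) ^ 2).
Proof.
  (* The bound 2 is 1 / (0 + 1/2), where the telescoping majorant starts. *)
  apply ex_finite_lim_seq_incr with 2.
  - intros n. rewrite sum_Sn. unfold plus; simpl. pose proof (pos_INR (S n)).
    assert (0 < / (INR (S n) + 1) ^ 2) by (apply Rinv_0_lt_compat; nra).
    simpl in *; lra.
  - intros n.
    apply Rle_trans with (2 - / (INR (S n) + / 2)).
    + induction n.
      * rewrite sum_O. simpl. field_simplify; lra.
      * rewrite sum_Sn. change plus with Rplus.
        generalize (inv_sqr_telescope (S n)). set (x := sum_n _ n) in *. lra.
    + pose proof (pos_INR (S n)).
      assert (0 < / (INR (S n) + / 2)) by (apply Rinv_0_lt_compat; lra). lra.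
Qed.

Lemma inv_sqr_bound_nonneg (f : nat -> C) (K : R) :
  (forall k, Cmod (f k) <= K / (INR k + 1) ^ 2) -> 0 <= K.
Proof.
  intros Hf. replace K with (K / (INR 0 + 1) ^ 2) by (simpl; field).
  eapply Rle_trans; [apply Cmod_ge_0 | apply Hf].
Qed.

Lemma Cpsum_diff_le (f : nat -> C) (K : R) (n m : nat) :
  (forall k, Cmod (f k) <= K / (INR k + 1) ^ 2) ->
  Cmod (Cpsum f (n + m) - Cpsum f n)%C <= K * (/ (INR n + / 2) - / (INR (n + m) + / 2)).
Proof.
  intros Hf.
  assert (HK : 0 <= K).
  { apply (inv_sqr_bound_nonneg f), Hf. }
  induction m.
  - rewrite Nat.add_0_r. replace (Cpsum f n - Cpsum f n)%C with (RtoC 0) by ring.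
    rewrite Cmod_0. lra.
  - rewrite Nat.add_succ_r. cbn [Cpsum].
    replace (Cpsum f (n + m) + f (n + m)%nat - Cpsum f n)%C
      with (Cpsum f (n + m) - Cpsum f n + f (n + m)%nat)%C by ring.
    eapply Rle_trans; [apply Cmod_triangle|].
    generalize (Hf (n + m)%nat) (inv_sqr_telescope (n + m)). unfold Rdiv. intros H1 H2.
    nra.
Qed.

(** The one convergence criterion of the proof. Its explicit rate depends on [f] only through [K],
    so it is uniform in any parameter on which [K] does not depend; continuity of sums and the
    expansion of the zeta remainder rest on this. *)
Lemma Csum_inv_sqr (f : nat -> C) (K : R) :
  (forall k, Cmod (f k) <= K / (INR k + 1) ^ 2) ->
  Clim (Cpsum f) (Csum f) /\
  forall n, Cmod (Csum f - Cpsum f n)%C <= 2 * K / (INR n + 1).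
Proof.
  intros Hf.
  assert (HK : 0 <= K).
  { apply (inv_sqr_bound_nonneg f), Hf. }
  assert (E : ex_series (fun k => K / (INR k + 1) ^ 2)).
  { apply (ex_series_scal (V := R_NormedModule) K (fun k => / (INR k + 1) ^ 2)).
    apply ex_series_inv_sqr. }
  assert (L : Clim (Cpsum f) (Csum f)).
  { apply Clim_incr_1. split.
    - apply is_lim_seq_ext with (sum_n (fun k => Re (f k))).
      { intros n; now rewrite Re_Cpsum. }
      apply Series_correct. apply (ex_series_le (V := R_CompleteNormedModule)) with (2 := E).
      intros n. eapply Rle_trans; [apply re_le_Cmod | apply Hf].
    - apply is_lim_seq_ext with (sum_n (fun k => Im (f k))).
      { intros n; now rewrite Im_Cpsum. }
      apply Series_correct. apply (ex_series_le (V := R_CompleteNormedModule)) with (2 := E).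
      intros n. eapply Rle_trans; [apply im_le_Cmod | apply Hf]. }
  split; [exact L|]. intros n.
  apply Clim_Cmod_le with (u := fun m => (Cpsum f (m + n) - Cpsum f n)%C).
  - apply Clim_minus; [|apply Clim_const]. destruct L as [L1 L2].
    split; [apply (is_lim_seq_incr_n (fun m => Re (Cpsum f m)))
           |apply (is_lim_seq_incr_n (fun m => Im (Cpsum f m)))]; assumption.
  - intros m. rewrite Nat.add_comm.
    eapply Rle_trans; [apply Cpsum_diff_le; exact Hf|].
    pose proof (pos_INR n). pose proof (pos_INR (n + m)).
    assert (0 < / (INR (n + m) + / 2)) by (apply Rinv_0_lt_compat; lra).
    assert (/ (INR n + / 2) <= 2 / (INR n + 1)).
    { apply Rmult_le_reg_r with ((INR n + / 2) * (INR n + 1)); [nra|].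
      replace (/ (INR n + / 2) * ((INR n + / 2) * (INR n + 1))) with (INR n + 1) by (field; lra).
      replace (2 / (INR n + 1) * ((INR n + / 2) * (INR n + 1))) with (2 * (INR n + / 2)) by (field; lra).
      lra. }
    unfold Rdiv in *. nra.
Qed.

Lemma Cpsum_ext (f g : nat -> C) (n : nat) :
  (forall k, f k = g k) -> Cpsum f n = Cpsum g n.
Proof. intros E; induction n; simpl; [reflexivity | now rewrite IHn, E]. Qed.

Lemma Cpsum_mult_l (c : C) (f : nat -> C) (n : nat) :
  Cpsum (fun k => c * f k)%C n = (c * Cpsum f n)%C.
Proof. induction n; simpl; [ring | rewrite IHn; ring]. Qed.

Lemma Cpsum_plus (f g : nat -> C) (n : nat) :
  Cpsum (fun k => f k + g k)%C n = (Cpsum f n + Cpsum g n)%C.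
Proof. induction n; simpl; [ring | rewrite IHn; ring]. Qed.

Lemma is_lim_seq_inv_INR (K : R) : is_lim_seq (fun n => K / (INR n + 1)) 0.
Proof.
  apply is_lim_seq_ext with (fun n => K * / (INR (S n))).
  { intros n; now rewrite S_INR. }
  replace (Finite 0) with (Finite (K * 0)) by (f_equal; ring).
  apply is_lim_seq_mult'; [apply is_lim_seq_const|].
  apply (is_lim_seq_incr_1 (fun n => / INR n)).
  apply (is_lim_seq_inv _ p_infty); [apply is_lim_seq_INR | discriminate].
Qed.

(** * Continuity on the complex plane *)

Definition Ccont (f : C -> C) (z : C) : Prop :=
  continuous (T := C_UniformSpace) (U := C_UniformSpace) f z.

Lemma Ccont_pair (f : C -> C) (z : C) :
  Ccont f z <->
  continuous (T := C_UniformSpace) (U := R_UniformSpace) (fun w => Re (f w)) z /\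
  continuous (T := C_UniformSpace) (U := R_UniformSpace) (fun w => Im (f w)) z.
Proof.
  split.
  - intros H. split.
    + apply (continuous_comp (U := C_UniformSpace) (V := C_UniformSpace) (W := R_UniformSpace)
               f Re z H). apply continuous_fst.
    + apply (continuous_comp (U := C_UniformSpace) (V := C_UniformSpace) (W := R_UniformSpace)
               f Im z H). apply continuous_snd.
  - intros [H1 H2] P [eps HP].
    pose proof (H1 _ (locally_ball (T := R_UniformSpace) _ eps)) as A1.
    pose proof (H2 _ (locally_ball (T := R_UniformSpace) _ eps)) as A2.
    unfold filtermap in *. generalize (filter_and _ _ A1 A2). apply filter_imp. intros w [B1 B2].
    apply HP. split; assumption.
Qed.

Lemma Ccont_eps (f : C -> C) (z : C) :
  (forall eps, 0 < eps -> exists d, 0 < d /\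
     forall w, Cmod (w - z)%C < d -> Cmod (f w - f z)%C < eps) -> Ccont f z.
Proof.
  intros H P [eps HP].
  destruct (H eps (cond_pos eps)) as (d & Hd & H').
  (* The square of half-side d / 2, a ball of the product structure, lies in the disc of radius
     d. *)
  assert (Hd2 : 0 < d / 2) by lra.
  exists (mkposreal _ Hd2). intros w [B1 B2]. apply HP.
  assert (A : Cmod (f w - f z)%C < eps).
  { apply H'. eapply Rle_lt_trans; [apply Cmod_le_abs|]. reim.
    unfold ball in B1, B2; simpl in B1, B2; unfold AbsRing_ball, abs, minus, plus, opp in B1, B2;
    simpl in B1, B2. unfold Re, Im, Rminus. lra. }
  split; (eapply Rle_lt_trans; [|exact A]).
  - apply (re_le_Cmod (f w - f z)%C).
  - apply (im_le_Cmod (f w - f z)%C).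
Qed.

Lemma Ccont_eps_inv (f : C -> C) (z : C) :
  Ccont f z -> forall eps, 0 < eps -> exists d, 0 < d /\
     forall w, Cmod (w - z)%C < d -> Cmod (f w - f z)%C < eps.
Proof.
  intros H eps He.
  assert (He2 : 0 < eps / 2) by lra.
  destruct (H _ (locally_ball (T := C_UniformSpace) (f z) (mkposreal _ He2))) as [d Hd].
  exists d; split; [apply cond_pos|]. intros w Hw.
  assert (B : ball (M := C_UniformSpace) z d w).
  { split; (eapply Rle_lt_trans; [|exact Hw]).
    - apply (re_le_Cmod (w - z)%C).
    - apply (im_le_Cmod (w - z)%C). }
  destruct (Hd w B) as [B1 B2].
  eapply Rle_lt_trans; [apply Cmod_le_abs|]. reim.
  unfold ball in B1, B2; simpl in B1, B2; unfold AbsRing_ball, abs, minus, plus, opp in B1, B2;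
    simpl in B1, B2. unfold Re, Im, Rminus. lra.
Qed.

Lemma Ccont_const (c z : C) : Ccont (fun _ => c) z.
Proof. apply continuous_const. Qed.

Lemma Ccont_id (z : C) : Ccont (fun w => w) z.
Proof. apply continuous_id. Qed.

Lemma Ccont_plus (f g : C -> C) (z : C) :
  Ccont f z -> Ccont g z -> Ccont (fun w => f w + g w)%C z.
Proof.
  rewrite !Ccont_pair. intros [H1 H2] [H3 H4]. split.
  - apply (continuous_plus (V := R_NormedModule) (fun w => Re (f w)) (fun w => Re (g w))); assumption.
  - apply (continuous_plus (V := R_NormedModule) (fun w => Im (f w)) (fun w => Im (g w))); assumption.
Qed.

Lemma Ccont_opp (f : C -> C) (z : C) : Ccont f z -> Ccont (fun w => - f w)%C z.
Proof.
  rewrite !Ccont_pair. intros [H1 H2]. split.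
  - apply (continuous_opp (V := R_NormedModule) (fun w => Re (f w))); assumption.
  - apply (continuous_opp (V := R_NormedModule) (fun w => Im (f w))); assumption.
Qed.

Lemma Ccont_minus (f g : C -> C) (z : C) :
  Ccont f z -> Ccont g z -> Ccont (fun w => f w - g w)%C z.
Proof. intros; apply Ccont_plus; [|apply Ccont_opp]; assumption. Qed.

Lemma Ccont_mult (f g : C -> C) (z : C) :
  Ccont f z -> Ccont g z -> Ccont (fun w => f w * g w)%C z.
Proof.
  rewrite !Ccont_pair. intros [H1 H2] [H3 H4].
  assert (M : forall a b : C -> R,
    continuous (T := C_UniformSpace) (U := R_UniformSpace) a z ->
    continuous (T := C_UniformSpace) (U := R_UniformSpace) b z ->
    continuous (T := C_UniformSpace) (U := R_UniformSpace) (fun w => a w * b w) z).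
  { intros a b Ha Hb. apply (continuous_mult (K := R_AbsRing) a b); assumption. }
  split.
  - apply (continuous_minus (V := R_NormedModule)
      (fun w => Re (f w) * Re (g w)) (fun w => Im (f w) * Im (g w))); apply M; assumption.
  - apply (continuous_plus (V := R_NormedModule)
      (fun w => Re (f w) * Im (g w)) (fun w => Im (f w) * Re (g w))); apply M; assumption.
Qed.

Lemma Ccont_ext (f g : C -> C) (z : C) : (forall w, f w = g w) -> Ccont f z -> Ccont g z.
Proof. intros; eapply continuous_ext; eassumption. Qed.

Lemma Ccont_Clog (z : C) : 0 < Re z -> Ccont Clog z.
Proof.
  intros Hz. apply Ccont_pair.
  assert (CM : continuous (T := C_UniformSpace) (U := R_UniformSpace) Cmod z).
  { apply (filterlim_ext (fun w : C_UniformSpace => norm (V := C_R_NormedModule) w)).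
    { apply norm_C_R. }
    rewrite <- norm_C_R. apply (filterlim_norm (V := C_R_NormedModule)). }
  assert (CR : continuous (T := C_UniformSpace) (U := R_UniformSpace) Re z)
    by apply continuous_fst.
  assert (CI : continuous (T := C_UniformSpace) (U := R_UniformSpace) Im z)
    by apply continuous_snd.
  assert (Hr : 0 < Cmod z) by (apply Cmod_gt_0, Re_pos_neq_0, Hz).
  split; simpl.
  - apply (continuous_comp (U := C_UniformSpace) Cmod ln); [exact CM|].
    apply continuity_pt_filterlim, derivable_continuous_pt.
    exists (/ Cmod z). now apply derivable_pt_lim_ln.
  - apply (continuous_mult (K := R_AbsRing) (fun _ => 2)); [apply continuous_const|].
    apply (continuous_comp (U := C_UniformSpace) (V := R_UniformSpace)
       (fun w => Im w / (Cmod w + Re w)) atan).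
    + apply (continuous_mult (K := R_AbsRing) Im); [exact CI|].
      apply (continuous_comp (U := C_UniformSpace) (V := R_UniformSpace)
         (fun w => Cmod w + Re w) Rinv).
      * apply (continuous_plus (V := R_NormedModule) Cmod Re); assumption.
      * apply continuous_Rinv. generalize (Cmod_plus_Re_pos z Hz). lra.
    + apply continuity_pt_filterlim, derivable_continuous_pt, derivable_pt_atan.
Qed.

Lemma Ccont_Clog_plus (c z : C) : 0 < Re (z + c)%C -> Ccont (fun w => Clog (w + c)%C) z.
Proof.
  intros H. apply (continuous_comp (U := C_UniformSpace) (V := C_UniformSpace)
    (fun w => w + c)%C Clog).
  - apply Ccont_plus; [apply Ccont_id | apply Ccont_const].
  - now apply Ccont_Clog.
Qed.

Lemma Ccont_uniform_limit (F : C -> C) (Fn : nat -> C -> C) (e : nat -> R) (z : C) (r : R) :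
  0 < r -> is_lim_seq e 0 -> (forall n, Ccont (Fn n) z) ->
  (forall n w, Cmod (w - z)%C < r -> Cmod (F w - Fn n w)%C <= e n) -> Ccont F z.
Proof.
  intros Hr He Hc Hb. apply Ccont_eps. intros eps Heps.
  apply is_lim_seq_spec in He.
  assert (H4 : 0 < eps / 4) by lra.
  destruct (He (mkposreal _ H4)) as [N HN]. specialize (HN N (Nat.le_refl N)). simpl in HN.
  rewrite Rminus_0_r in HN. apply Rabs_lt_between in HN.
  destruct (Ccont_eps_inv _ _ (Hc N) (eps / 4) H4) as (d & Hd & H').
  exists (Rmin d r). split; [now apply Rmin_pos|]. intros w Hw.
  pose proof (Rmin_l d r). pose proof (Rmin_r d r).
  pose proof (H' w ltac:(lra)) as A1.
  pose proof (Hb N w ltac:(lra)) as A2.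
  assert (A3 : Cmod (F z - Fn N z)%C <= e N).
  { apply Hb. replace (z - z)%C with (RtoC 0) by ring. rewrite Cmod_0. lra. }
  replace (F w - F z)%C with ((F w - Fn N w) + ((Fn N w - Fn N z) - (F z - Fn N z)))%C by ring.
  eapply Rle_lt_trans; [apply Cmod_triangle|].
  generalize (Cmod_triangle_sub (Fn N w - Fn N z)%C (F z - Fn N z)%C). lra.
Qed.

Lemma Ccont_Cpsum (f : nat -> C -> C) (n : nat) (z : C) :
  (forall k, Ccont (f k) z) -> Ccont (fun w => Cpsum (fun k => f k w) n) z.
Proof.
  intros H; induction n; simpl; [apply Ccont_const | now apply Ccont_plus].
Qed.

(** * Differentiation and integration of complex functions of a real variable *)

(** The derivative along a real parameter. It is componentwise, so the fundamental theorem of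
    calculus is the real one. *)
Definition CD (f : R -> C) (t : R) (l : C) : Prop :=
  is_derive (fun s => Re (f s)) t (Re l) /\ is_derive (fun s => Im (f s)) t (Im l).

Lemma CD_eq (f : R -> C) (t : R) (l l' : C) : l = l' -> CD f t l -> CD f t l'.
Proof. intros <-; trivial. Qed.

Lemma CD_ext (f g : R -> C) (t : R) (l : C) : (forall s, f s = g s) -> CD f t l -> CD g t l.
Proof.
  intros E [H1 H2]; split; (eapply is_derive_ext; [|eassumption]); intros s; simpl; now rewrite E.
Qed.

Lemma CD_const (c : C) (t : R) : CD (fun _ => c) t 0%C.
Proof. split; apply (is_derive_const (K := R_AbsRing) (V := R_NormedModule)). Qed.

Lemma CD_RtoC (f : R -> R) (t l : R) : is_derive f t l -> CD (fun s => RtoC (f s)) t (RtoC l).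
Proof. intros H; split; simpl; [exact H | apply (is_derive_const (K := R_AbsRing) (V := R_NormedModule))]. Qed.

Lemma CD_plus (f g : R -> C) (t : R) (l m : C) :
  CD f t l -> CD g t m -> CD (fun s => f s + g s)%C t (l + m)%C.
Proof.
  intros [H1 H2] [H3 H4]; split; reim;
  apply (is_derive_plus (K := R_AbsRing) (V := R_NormedModule)); assumption.
Qed.

Lemma CD_opp (f : R -> C) (t : R) (l : C) : CD f t l -> CD (fun s => - f s)%C t (- l)%C.
Proof.
  intros [H1 H2]; split; reim;
  apply (is_derive_opp (K := R_AbsRing) (V := R_NormedModule)); assumption.
Qed.

Lemma CD_minus (f g : R -> C) (t : R) (l m : C) :
  CD f t l -> CD g t m -> CD (fun s => f s - g s)%C t (l - m)%C.
Proof. intros; apply CD_plus; [|apply CD_opp]; assumption. Qed.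

Lemma is_derive_Rmult (f g : R -> R) (t l m : R) :
  is_derive f t l -> is_derive g t m -> is_derive (fun s => f s * g s) t (l * g t + f t * m).
Proof. intros; apply (is_derive_mult f g t l m); auto. intros; apply Rmult_comm. Qed.

Lemma CD_mult (f g : R -> C) (t : R) (l m : C) :
  CD f t l -> CD g t m -> CD (fun s => f s * g s)%C t (l * g t + f t * m)%C.
Proof.
  intros [H1 H2] [H3 H4]; split.
  - replace (Re (l * g t + f t * m)%C) with
      ((Re l * Re (g t) + Re (f t) * Re m) - (Im l * Im (g t) + Im (f t) * Im m))
      by (reim; ring).
    apply (is_derive_minus (K := R_AbsRing) (V := R_NormedModule)
      (fun s => Re (f s) * Re (g s)) (fun s => Im (f s) * Im (g s)));
    apply is_derive_Rmult; assumption.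
  - replace (Im (l * g t + f t * m)%C) with
      ((Re l * Im (g t) + Re (f t) * Im m) + (Im l * Re (g t) + Im (f t) * Re m))
      by (reim; ring).
    apply (is_derive_plus (K := R_AbsRing) (V := R_NormedModule)
      (fun s => Re (f s) * Im (g s)) (fun s => Im (f s) * Re (g s)));
    apply is_derive_Rmult; assumption.
Qed.

Lemma CD_pair (f : R -> C) (X Y : R -> R) (t : R) (l : C) :
  (forall s, f s = (X s, Y s)) -> is_derive X t (Re l) -> is_derive Y t (Im l) -> CD f t l.
Proof.
  intros E H1 H2. split.
  - apply is_derive_ext with X; [intros s; now rewrite E | exact H1].
  - apply is_derive_ext with Y; [intros s; now rewrite E | exact H2].
Qed.

(** Names the components as plain real functions, which [auto_derive] then treats as unknowns with
    given derivatives. *)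
Lemma CD_pair_inv (f : R -> C) (t : R) (l : C) :
  CD f t l -> exists X Y : R -> R,
    (forall s, f s = (X s, Y s)) /\ is_derive X t (Re l) /\ is_derive Y t (Im l).
Proof.
  intros [H1 H2]. exists (fun s => Re (f s)), (fun s => Im (f s)).
  split; [intros s; now destruct (f s) | now split].
Qed.

Ltac eta_rewrite X Y H1 H2 :=
  change (fun s : R => X s) with X; change (fun s : R => Y s) with Y; rewrite H1, H2.

Lemma is_derive_split (X : R -> R) (t a : R) :
  is_derive X t a -> ex_derive X t /\ Derive X t = a.
Proof. intros H. split; [now exists a | now apply is_derive_unique]. Qed.

Lemma CD_Cexp (f : R -> C) (t : R) (l : C) :
  CD f t l -> CD (fun s => Cexp (f s)) t (l * Cexp (f t))%C.
Proof.
  intros (X & Y & E & [E1 H1]%is_derive_split & [E2 H2]%is_derive_split)%CD_pair_inv.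
  apply CD_pair with (fun s => exp (X s) * cos (Y s)) (fun s => exp (X s) * sin (Y s)).
  - intros s. now rewrite E.
  - auto_derive; [now repeat split|]. eta_rewrite X Y H1 H2. rewrite E. reim. simpl. ring.
  - auto_derive; [now repeat split|]. eta_rewrite X Y H1 H2. rewrite E. reim. simpl. ring.
Qed.

Lemma CD_Clog (f : R -> C) (t : R) (l : C) :
  0 < Re (f t) -> CD f t l -> CD (fun s => Clog (f s)) t (l / f t)%C.
Proof.
  intros Hp (X & Y & E & H1 & H2)%CD_pair_inv.
  assert (E1 : ex_derive X t) by (eexists; exact H1).
  assert (E2 : ex_derive Y t) by (eexists; exact H2).
  apply is_derive_unique in H1; apply is_derive_unique in H2.
  assert (Em : forall s, Cmod (f s) = sqrt (X s * X s + Y s * Y s)).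
  { intros s. rewrite E. unfold Cmod; simpl. now rewrite !Rmult_1_r. }
  rewrite E in Hp |- *. simpl in Hp.
  set (x := X t) in *. set (y := Y t) in *.
  assert (Hsq : 0 < x * x + y * y) by nra.
  set (r := sqrt (x * x + y * y)).
  assert (Hr : 0 < r) by now apply sqrt_lt_R0.
  assert (Hs : r * r = x * x + y * y) by (apply sqrt_sqrt; lra).
  apply CD_pair with (fun s => ln (sqrt (X s * X s + Y s * Y s)))
    (fun s => 2 * atan (Y s / (sqrt (X s * X s + Y s * Y s) + X s))).
  - intros s. unfold Clog. rewrite Em, E. reflexivity.
  - auto_derive; fold x y r.
    { repeat split; assumption. }
    eta_rewrite X Y H1 H2. unfold Cdiv, Cinv. reim. unfold Re, Im; simpl. rewrite !Rmult_1_r.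
    rewrite <- Hs. field. lra.
  - auto_derive; fold x y r.
    { repeat split; try assumption. lra. }
    eta_rewrite X Y H1 H2. unfold Cdiv, Cinv. reim. unfold Re, Im; simpl. rewrite !Rmult_1_r.
    rewrite <- Hs.
    (* Powers of y are reduced with this relation, after which the identity holds in r, x and y as
       free variables. *)
    assert (Hy : y * y = r * r - x * x) by lra.
    assert (D : (r + x) * (r + x) + y * y = 2 * r * (r + x)) by (rewrite Hy; ring).
    assert (Hrx : 0 < r + x) by lra.
    field_simplify_eq.
    2:{ repeat split; try lra. replace ((r+x)^2 + y^2) with (2 * r * (r+x)) by (rewrite <- D; ring). nra. }
    replace (y ^ 4) with ((r * r - x * x) * (r * r - x * x)) by (rewrite <- Hy; ring).
    replace (y ^ 3) with (y * (r * r - x * x)) by (rewrite <- Hy; ring).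
    replace (y ^ 2) with (r * r - x * x) by (rewrite <- Hy; ring). ring.
Qed.

Lemma CD_Cinv (f : R -> C) (t : R) (l : C) :
  f t <> 0%C -> CD f t l -> CD (fun s => / f s)%C t (- (l / (f t * f t)))%C.
Proof.
  intros Hp (X & Y & E & H1 & H2)%CD_pair_inv.
  assert (E1 : ex_derive X t) by (eexists; exact H1).
  assert (E2 : ex_derive Y t) by (eexists; exact H2).
  apply is_derive_unique in H1; apply is_derive_unique in H2.
  apply Cmod_gt_0 in Hp. pose proof (Cmod_sqr (f t)) as Hs.
  rewrite E in Hp, Hs |- *. unfold Re, Im in Hs. simpl in Hs.
  assert (Hsq : 0 < X t * X t + Y t * Y t) by nra.
  apply CD_pair with (fun s => X s / (X s * X s + Y s * Y s))
    (fun s => - Y s / (X s * X s + Y s * Y s)).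
  - intros s. rewrite E. unfold Cinv; simpl. now rewrite !Rmult_1_r.
  - auto_derive.
    { repeat split; try assumption. lra. }
    eta_rewrite X Y H1 H2. unfold Cdiv, Cinv. reim. unfold Re, Im; simpl.
    field. split; nra.
  - auto_derive.
    { repeat split; try assumption. lra. }
    eta_rewrite X Y H1 H2. unfold Cdiv, Cinv. reim. unfold Re, Im; simpl.
    field. split; nra.
Qed.

Lemma CD_continuous (f : R -> C) (t : R) (l : C) :
  CD f t l -> continuous (U := C_UniformSpace) f t.
Proof.
  intros [H1 H2].
  assert (C1 : continuous (U := R_UniformSpace) (fun s => Re (f s)) t)
    by (apply (ex_derive_continuous (V := R_NormedModule) (fun s => Re (f s))); eexists; exact H1).
  assert (C2 : continuous (U := R_UniformSpace) (fun s => Im (f s)) t)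
    by (apply (ex_derive_continuous (V := R_NormedModule) (fun s => Im (f s))); eexists; exact H2).
  intros P [eps HP].
  pose proof (C1 _ (locally_ball (T := R_UniformSpace) _ eps)) as A1.
  pose proof (C2 _ (locally_ball (T := R_UniformSpace) _ eps)) as A2.
  unfold filtermap in *. generalize (filter_and _ _ A1 A2). apply filter_imp.
  intros w [B1 B2]. apply HP. split; assumption.
Qed.

Notation is_CInt := (is_RInt (V := C_R_NormedModule)).
Notation CInt := (RInt (V := C_R_CompleteNormedModule)).

Lemma is_CInt_pair (f : R -> C) (a b : R) (l : C) :
  is_CInt f a b l <->
  is_RInt (fun t => Re (f t)) a b (Re l) /\ is_RInt (fun t => Im (f t)) a b (Im l).
Proof.
  split.
  - intros H; split.
    + apply (is_RInt_fct_extend_fst (U := R_NormedModule) (V := R_NormedModule) f a b l H).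
    + apply (is_RInt_fct_extend_snd (U := R_NormedModule) (V := R_NormedModule) f a b l H).
  - intros [H1 H2]. destruct l as [l1 l2].
    apply (is_RInt_fct_extend_pair (U := R_NormedModule) (V := R_NormedModule) f a b l1 l2 H1 H2).
Qed.

Lemma CInt_correct (f : R -> C) (a b : R) :
  a <= b -> (forall t, a <= t <= b -> continuous (U := C_UniformSpace) f t) ->
  is_CInt f a b (CInt f a b).
Proof.
  intros Hab H. apply (RInt_correct (V := C_R_CompleteNormedModule)).
  apply (ex_RInt_continuous (V := C_R_CompleteNormedModule)).
  rewrite Rmin_left, Rmax_right by lra. exact H.
Qed.

Lemma CInt_unique (f : R -> C) (a b : R) (l : C) : is_CInt f a b l -> CInt f a b = l.
Proof. apply (is_RInt_unique (V := C_R_CompleteNormedModule)). Qed.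

Lemma is_CInt_derive (f df : R -> C) (a b : R) :
  a <= b -> (forall t, a <= t <= b -> CD f t (df t)) ->
  (forall t, a <= t <= b -> continuous (U := C_UniformSpace) df t) ->
  is_CInt df a b (f b - f a)%C.
Proof.
  intros Hab Hd Hc. apply is_CInt_pair. split; reim.
  - apply (is_RInt_derive (V := R_CompleteNormedModule) (fun t => Re (f t)) (fun t => Re (df t)));
    rewrite Rmin_left, Rmax_right by lra; intros t Ht.
    + now apply Hd.
    + apply (continuous_comp (V := C_UniformSpace) (W := R_UniformSpace) df Re); [now apply Hc|].
      apply continuous_fst.
  - apply (is_RInt_derive (V := R_CompleteNormedModule) (fun t => Im (f t)) (fun t => Im (df t)));
    rewrite Rmin_left, Rmax_right by lra; intros t Ht.
    + now apply Hd.
    + apply (continuous_comp (V := C_UniformSpace) (W := R_UniformSpace) df Im); [now apply Hc|].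
      apply continuous_snd.
Qed.

Lemma Cmod_CInt_le (f : R -> C) (g : R -> R) (a b : R) (l : C) (m : R) :
  a <= b -> (forall t, a <= t <= b -> Cmod (f t) <= g t) ->
  is_CInt f a b l -> is_RInt g a b m -> Cmod l <= m.
Proof.
  intros Hab H H1 H2. rewrite <- norm_C_R.
  eapply norm_RInt_le; [exact Hab| |exact H1|exact H2].
  intros t Ht. rewrite norm_C_R. now apply H.
Qed.

Lemma Cmod_CInt_le_const (f : R -> C) (a b M : R) (l : C) :
  a <= b -> (forall t, a <= t <= b -> Cmod (f t) <= M) ->
  is_CInt f a b l -> Cmod l <= (b - a) * M.
Proof.
  intros Hab H H1. rewrite <- norm_C_R.
  eapply norm_RInt_le_const; [exact Hab| |exact H1].
  intros t Ht. rewrite norm_C_R. now apply H.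
Qed.

Lemma CD_pow (f : R -> C) (t : R) (l : C) (n : nat) :
  CD f t l -> CD (fun s => f s ^ n)%C t (RtoC (INR n) * l * f t ^ pred n)%C.
Proof.
  intros H. induction n.
  - apply CD_eq with (RtoC 0); [simpl; ring|].
    apply CD_ext with (fun _ => RtoC 1); [reflexivity | apply CD_const].
  - eapply CD_eq; [|apply (CD_mult _ _ _ _ _ H IHn)].
    rewrite S_INR, RtoC_plus. destruct n; simpl; ring.
Qed.

Lemma CD_id (t : R) : CD RtoC t 1%C.
Proof.
  split; simpl; [apply (is_derive_id (K := R_AbsRing))
                |apply (is_derive_const (K := R_AbsRing) (V := R_NormedModule))].
Qed.

(** Builds a derivative from the syntax of the function; [CD_eq] then compares it with the intended
    form. Nonzero denominators and arguments of [Clog] in the right half-plane remain as goals. *)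
Ltac cd_step :=
  match goal with
  | |- CD RtoC _ _ => apply CD_id
  | |- CD (fun s => RtoC s) _ _ => apply CD_id
  | |- CD (fun _ => ?c) _ _ => apply CD_const
  | |- CD (fun s => RtoC (@?f s)) _ _ =>
      apply CD_RtoC; solve [auto_derive; [now auto | reflexivity]]
  | |- CD (fun s => Cplus _ _) _ _ => apply CD_plus
  | |- CD (fun s => Cminus _ _) _ _ => apply CD_minus
  | |- CD (fun s => Copp _) _ _ => apply CD_opp
  | |- CD (fun s => Cmult _ _) _ _ => apply CD_mult
  | |- CD (fun s => Cdiv _ _) _ _ => apply CD_mult
  | |- CD (fun s => Cinv _) _ _ => apply CD_Cinv
  | |- CD (fun s => Cpow _ _) _ _ => apply CD_pow
  | |- CD (fun s => Cexp _) _ _ => apply CD_Cexp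
  | |- CD (fun s => Clog _) _ _ => apply CD_Clog
  end.

Ltac cd_rules := repeat cd_step.

Ltac rtoc := repeat
  (rewrite RtoC_plus || rewrite RtoC_minus || rewrite RtoC_opp || rewrite RtoC_mult
   || rewrite RtoC_pow || (rewrite RtoC_div by lra) || (rewrite RtoC_inv by lra)).

(** * Euler-Maclaurin kernels *)

(** Bernoulli polynomials without their constant terms: -(B_2(u) - B_2)/2 here and -(B_4(u) -
    B_4)/24 for [em_kernel]. Their derivatives of order 2 and 4 respectively equal -1. *)
Definition rho_kernel (u : R) : R := u * (1 - u) / 2.
Definition em_kernel (u : R) : R := - (u ^ 2 * (1 - u) ^ 2 / 24).

(** The error of the trapezoidal rule for log on [w, w + 1]: the integral minus the mean of the end
    values. *)
Definition rho (w : C) : C := ((w + 1 / 2) * (Clog (w + 1) - Clog w) - 1)%C.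
(** The Euler-Maclaurin remainder of v log v on [w, w + 1] after the B_2 term. The fourth derivative
    of v log v is 2/v^3, whence the integrand in [bstep_integral]. *)
Definition bstep (w : C) : C :=
  ((2 * w + 1) / 4 - (6 * w ^ 2 + 6 * w + 1) / 12 * (Clog (w + 1) - Clog w))%C.

Lemma Re_plus_R_pos (w : C) (u : R) : 0 < Re w -> 0 <= u -> 0 < Re (w + RtoC u)%C.
Proof. intros; reim; lra. Qed.

Lemma rho_integral (w : C) : 0 < Re w ->
  is_CInt (fun u => RtoC (rho_kernel u) / (w + RtoC u) ^ 2)%C 0 1 (rho w).
Proof.
  intros Hw.
  (* One integration by parts; with v = w + u the derivative 1/2 - u of the kernel is (1/2 + w) - v,
     and its quotient by v integrates directly. *)
  set (G := fun u => (- (RtoC (u * (1 - u) / 2) / (w + RtoC u))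
     + (1 / 2 + w) * Clog (w + RtoC u) - RtoC u)%C).
  replace (rho w) with (G 1 - G 0)%C.
  - unfold rho_kernel. apply is_CInt_derive; [lra| |]; intros t Ht;
      assert (Hp : 0 < Re (w + RtoC t)%C) by (apply Re_plus_R_pos; lra);
      pose proof (Re_pos_neq_0 _ Hp) as Hn.
    + unfold G. eapply CD_eq; [|cd_rules; assumption].
      cbn beta. rtoc. field. exact Hn.
    + eapply CD_continuous. cd_rules. now apply Cpow_nz.
  - unfold G, rho. pose proof (Re_pos_neq_0 _ Hw).
    assert (w + 1 <> 0)%C.
    { apply Re_pos_neq_0. apply Re_plus_R_pos; lra. }
    rtoc. rewrite Cplus_0_r. field. now split.
Qed.

Lemma bstep_integral (w : C) : 0 < Re w ->
  is_CInt (fun u => RtoC (2 * em_kernel u) / (w + RtoC u) ^ 3)%C 0 1 (bstep w).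
Proof.
  intros Hw.
  (* Three integrations by parts, 2/v^3 being integrated to -1/v^2, 1/v and log v with v = w + u.
     The third derivative 1/2 - u of the kernel is (1/2 + w) - v, and its product with log v
     integrates directly. *)
  set (G := fun u => (- (RtoC (- (u ^ 2 * (1 - u) ^ 2 / 24)) / (w + RtoC u) ^ 2)
     - RtoC (- (2 * u - 6 * u ^ 2 + 4 * u ^ 3) / 24) / (w + RtoC u)
     + RtoC (- (1 - 6 * u + 6 * u ^ 2) / 12) * Clog (w + RtoC u)
     - (1 / 2 + w) * ((w + RtoC u) * Clog (w + RtoC u) - (w + RtoC u))
     + (w + RtoC u) ^ 2 / 2 * Clog (w + RtoC u) - (w + RtoC u) ^ 2 / 4)%C).
  replace (bstep w) with (G 1 - G 0)%C.
  - unfold em_kernel. apply is_CInt_derive; [lra| |]; intros t Ht;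
      assert (Hp : 0 < Re (w + RtoC t)%C) by (apply Re_plus_R_pos; lra);
      pose proof (Re_pos_neq_0 _ Hp) as Hn.
    + unfold G. eapply CD_eq; [|cd_rules; try assumption; now apply Cpow_nz].
      cbn beta. simpl INR. rtoc. simpl pred. field. exact Hn.
    + eapply CD_continuous. cd_rules. now apply Cpow_nz.
  - unfold G, bstep. pose proof (Re_pos_neq_0 _ Hw).
    assert (w + 1 <> 0)%C.
    { apply Re_pos_neq_0. apply Re_plus_R_pos; lra. }
    rtoc. rewrite Cplus_0_r. field. now split.
Qed.

Lemma Re_le_Cmod_plus (w : C) (u : R) : 0 <= u -> Re w <= Cmod (w + RtoC u)%C.
Proof.
  intros Hu. eapply Rle_trans; [|apply Re_le_Cmod]. reim. lra.
Qed.

Lemma Cmod_div_pow_le (x : R) (w : C) (u : R) (n : nat) : 0 < Re w -> 0 <= u -> Rabs x <= 1 ->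
  Cmod (RtoC x / (w + RtoC u) ^ n)%C <= / Re w ^ n.
Proof.
  intros Hw Hu Hx.
  assert (Hn : (w + RtoC u <> 0)%C) by (apply Re_pos_neq_0, Re_plus_R_pos; assumption).
  rewrite Cmod_div by now apply Cpow_nz.
  rewrite Cmod_R, Cmod_pow. unfold Rdiv.
  pose proof (Re_le_Cmod_plus w u Hu).
  assert (0 < Re w ^ n) by now apply pow_lt.
  assert (Re w ^ n <= Cmod (w + RtoC u) ^ n) by (apply pow_incr; lra).
  rewrite <- (Rmult_1_l (/ Re w ^ n)).
  apply Rmult_le_compat; [apply Rabs_pos| |exact Hx|].
  - left. apply Rinv_0_lt_compat. lra.
  - apply Rinv_le_contravar; lra.
Qed.

Lemma rho_le (w : C) : 0 < Re w -> Cmod (rho w) <= / Re w ^ 2.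
Proof.
  intros Hw. replace (/ Re w ^ 2) with ((1 - 0) * / Re w ^ 2) by ring.
  eapply Cmod_CInt_le_const; [lra| |now apply rho_integral].
  intros u Hu. apply Cmod_div_pow_le; [exact Hw | lra |].
  unfold rho_kernel. apply Rabs_le. nra.
Qed.

Lemma em_kernel_bound (u : R) : 0 <= u <= 1 -> Rabs (em_kernel u) <= / 24.
Proof.
  intros Hu. unfold em_kernel. rewrite Rabs_Ropp.
  assert (0 <= u * (1 - u) <= 1) by nra.
  replace (u ^ 2 * (1 - u) ^ 2) with ((u * (1 - u)) * (u * (1 - u))) by ring.
  rewrite Rabs_pos_eq; nra.
Qed.

Lemma bstep_le (w : C) : 0 < Re w -> Cmod (bstep w) <= / Re w ^ 3.
Proof.
  intros Hw. replace (/ Re w ^ 3) with ((1 - 0) * / Re w ^ 3) by ring.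
  eapply Cmod_CInt_le_const; [lra| |now apply bstep_integral].
  intros u Hu. apply Cmod_div_pow_le; [exact Hw | lra |].
  generalize (em_kernel_bound u Hu). rewrite Rabs_mult, (Rabs_pos_eq 2); lra.
Qed.

(** * Sums over the translates z + k *)

(** Since a <= 1, x + k >= a (k + 1). This gives one majorant of the translated terms for the whole
    half-plane Re z >= a. *)
Lemma shift_inv_le (a x : R) (k n : nat) : 0 < a <= 1 -> a <= x -> (2 <= n)%nat ->
  / (x + INR k) ^ n <= (/ a ^ n) / (INR k + 1) ^ 2.
Proof.
  intros Ha Hx Hn. pose proof (pos_INR k).
  assert (H1 : a * (INR k + 1) <= x + INR k) by nra.
  assert (0 < a ^ n) by (apply pow_lt; lra).
  assert (0 < (INR k + 1) ^ 2) by (apply pow_lt; lra).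
  unfold Rdiv. rewrite <- Rinv_mult.
  apply Rinv_le_contravar; [now apply Rmult_lt_0_compat|].
  apply Rle_trans with ((a * (INR k + 1)) ^ n); [|apply pow_incr; nra].
  rewrite Rpow_mult_distr. apply Rmult_le_compat_l; [lra|].
  apply Rle_pow; [lra | lia].
Qed.

Definition Rho (z : C) : C := Csum (fun k => rho (z + RtoC (INR k))%C).
Definition Bsum (z : C) : C := Csum (fun k => bstep (z + RtoC (INR k))%C).

Lemma shifted_sum (g : C -> C) (n : nat) (a : R) :
  0 < a <= 1 -> (2 <= n)%nat -> (forall w, 0 < Re w -> Cmod (g w) <= / Re w ^ n) ->
  forall z, a <= Re z -> forall k,
  Cmod (g (z + RtoC (INR k))%C) <= (/ a ^ n) / (INR k + 1) ^ 2.
Proof.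
  intros Ha Hn Hg z Hz k. pose proof (pos_INR k).
  eapply Rle_trans; [apply Hg; reim; lra|]. reim. now apply shift_inv_le.
Qed.

Lemma shifted_sum_spec (g : C -> C) (n : nat) :
  (2 <= n)%nat -> (forall w, 0 < Re w -> Cmod (g w) <= / Re w ^ n) ->
  forall z, 0 < Re z ->
  Clim (Cpsum (fun k => g (z + RtoC (INR k))%C)) (Csum (fun k => g (z + RtoC (INR k))%C)).
Proof.
  intros Hn Hg z Hz.
  assert (Ha : 0 < Rmin 1 (Re z) <= 1).
  { split; [apply Rmin_pos; lra | apply Rmin_l]. }
  eapply Csum_inv_sqr. apply (shifted_sum g n (Rmin 1 (Re z))); trivial. apply Rmin_r.
Qed.

Lemma shifted_sum_Ccont (g : C -> C) (n : nat) :
  (2 <= n)%nat -> (forall w, 0 < Re w -> Cmod (g w) <= / Re w ^ n) ->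
  (forall w, 0 < Re w -> Ccont g w) ->
  forall z, 0 < Re z -> Ccont (fun w => Csum (fun k => g (w + RtoC (INR k))%C)) z.
Proof.
  intros Hn Hg Hc z Hz.
  (* On the disc of radius Re z / 2 about z the real part stays at least Re z / 2, so one majorant
     serves the whole disc. *)
  assert (Ha : 0 < Rmin 1 (Re z / 2) <= 1).
  { split; [apply Rmin_pos; lra | apply Rmin_l]. }
  set (a := Rmin 1 (Re z / 2)) in *.
  assert (Hr : 0 < Re z / 2) by lra.
  apply Ccont_uniform_limit with
    (Fn := fun m w => Cpsum (fun k => g (w + RtoC (INR k))%C) m)
    (e := fun m => 2 * (/ a ^ n) / (INR m + 1)) (r := Re z / 2).
  - exact Hr.
  - apply is_lim_seq_inv_INR.
  - intros m. apply (Ccont_Cpsum (fun k w => g (w + RtoC (INR k))%C)). intros k.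
    apply (continuous_comp (U := C_UniformSpace) (V := C_UniformSpace) (W := C_UniformSpace)
      (fun w => w + RtoC (INR k))%C g).
    + apply Ccont_plus; [apply Ccont_id | apply Ccont_const].
    + apply Hc. apply Re_plus_R_pos; [exact Hz | apply pos_INR].
  - intros m w Hw. apply Csum_inv_sqr. apply (shifted_sum g n a Ha Hn Hg w).
    unfold a. eapply Rle_trans; [apply Rmin_r|].
    generalize (re_le_Cmod (w - z)%C). reim. intros H1.
    apply Rabs_le_between in H1. lra.
Qed.

Lemma Ccont_Clog_diff (w : C) : 0 < Re w -> Ccont (fun v => Clog (v + 1) - Clog v)%C w.
Proof.
  intros Hw. apply Ccont_minus.
  - apply Ccont_Clog_plus. reim. simpl. lra.
  - now apply Ccont_Clog.
Qed.

Lemma Ccont_pow (f : C -> C) (z : C) (n : nat) : Ccont f z -> Ccont (fun w => f w ^ n)%C z.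
Proof.
  intros H. induction n.
  - apply Ccont_ext with (fun _ => RtoC 1); [reflexivity | apply Ccont_const].
  - apply Ccont_ext with (fun w => f w * f w ^ n)%C; [reflexivity | now apply Ccont_mult].
Qed.

Ltac ccont := repeat
  match goal with
  | |- Ccont (fun _ => ?c) _ => apply Ccont_const
  | |- Ccont (fun w => w) _ => apply Ccont_id
  | H : Ccont ?f _ |- Ccont ?f _ => exact H
  | |- Ccont (fun w => Cplus _ _) _ => apply Ccont_plus
  | |- Ccont (fun w => Cminus _ _) _ => apply Ccont_minus
  | |- Ccont (fun w => Copp _) _ => apply Ccont_opp
  | |- Ccont (fun w => Cmult _ _) _ => apply Ccont_mult
  | |- Ccont (fun w => Cdiv _ _) _ => apply Ccont_mult
  | |- Ccont (fun w => Cpow _ _) _ => apply Ccont_pow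
  | |- Ccont (Cmult ?c) _ => apply (Ccont_mult (fun _ => c) (fun w => w))
  | |- Ccont (Cplus ?c) _ => apply (Ccont_plus (fun _ => c) (fun w => w))
  end.

Lemma Ccont_rho (w : C) : 0 < Re w -> Ccont rho w.
Proof.
  intros Hw. pose proof (Ccont_Clog_diff w Hw). unfold rho. ccont.
Qed.

Lemma Ccont_bstep (w : C) : 0 < Re w -> Ccont bstep w.
Proof.
  intros Hw. pose proof (Ccont_Clog_diff w Hw). unfold bstep. ccont.
Qed.

Lemma Rho_lim (z : C) : 0 < Re z ->
  Clim (Cpsum (fun k => rho (z + RtoC (INR k))%C)) (Rho z).
Proof. apply shifted_sum_spec with 2%nat; [lia | exact rho_le]. Qed.

Lemma Bsum_lim (z : C) : 0 < Re z ->
  Clim (Cpsum (fun k => bstep (z + RtoC (INR k))%C)) (Bsum z).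
Proof. apply shifted_sum_spec with 3%nat; [lia | exact bstep_le]. Qed.

Lemma Ccont_Rho (z : C) : 0 < Re z -> Ccont Rho z.
Proof. apply shifted_sum_Ccont with 2%nat; [lia | exact rho_le | exact Ccont_rho]. Qed.

Lemma Ccont_Bsum (z : C) : 0 < Re z -> Ccont Bsum z.
Proof. apply shifted_sum_Ccont with 3%nat; [lia | exact bstep_le | exact Ccont_bstep]. Qed.

(** * Asymptotics of the logarithm *)

(** Taylor's formula along the segment from 1 to 1 + w, with remainder the integral of t^2 w^3 / (1
    + t w); the factor 2 bounds 1 / |1 + t w|. *)
Lemma Clog_1_plus_bound (w : C) : Cmod w <= / 2 ->
  Cmod (Clog (1 + w) - w + w ^ 2 / 2)%C <= 2 * Cmod w ^ 3.
Proof.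
  intros Hw.
  set (G := fun t => (Clog (1 + RtoC t * w) - RtoC t * w + (RtoC t * w) ^ 2 / 2)%C).
  assert (Hp : forall t, 0 <= t <= 1 -> / 2 <= Re (1 + RtoC t * w)%C).
  { intros t Ht. generalize (re_le_Cmod (RtoC t * w)%C). rewrite Cmod_mult, Cmod_R, (Rabs_pos_eq t) by lra.
    intros H. apply Rabs_le_between in H. pose proof (Cmod_ge_0 w).
    rewrite Re_plus. change (Re (RtoC 1)) with 1.
    assert (t * Cmod w <= 1 * / 2) by (apply Rmult_le_compat; lra). lra. }
  assert (HI : is_CInt (fun t => RtoC (t ^ 2) * w ^ 3 / (1 + RtoC t * w))%C 0 1 (G 1 - G 0)%C).
  { apply is_CInt_derive; [lra| |]; intros t Ht; specialize (Hp t Ht);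
      assert (Hn : (1 + RtoC t * w <> 0)%C) by (apply Re_pos_neq_0; lra).
    - unfold G. eapply CD_eq; [|cd_rules; lra]. cbn beta. simpl INR. rtoc. simpl pred. field. exact Hn.
    - eapply CD_continuous. cd_rules. exact Hn. }
  replace (Clog (1 + w) - w + w ^ 2 / 2)%C with (G 1 - G 0)%C.
  2:{ unfold G. rewrite Cmult_1_l, Cmult_0_l, Cplus_0_r, Clog_RtoC, ln_1 by lra. field. }
  replace (2 * Cmod w ^ 3) with ((1 - 0) * (2 * Cmod w ^ 3)) by ring.
  eapply Cmod_CInt_le_const; [lra| |exact HI].
  intros t Ht. specialize (Hp t Ht).
  assert (Hn : (1 + RtoC t * w <> 0)%C) by (apply Re_pos_neq_0; lra).
  cbn beta. rewrite Cmod_div by exact Hn. rewrite Cmod_mult, Cmod_R, Cmod_pow, Rabs_pos_eq by nra.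
  pose proof (Re_le_Cmod (1 + RtoC t * w)%C).
  assert (0 <= Cmod w ^ 3) by (apply pow_le, Cmod_ge_0).
  apply Rmult_le_reg_r with (Cmod (1 + RtoC t * w)%C); [lra|].
  unfold Rdiv. rewrite Rmult_assoc, Rinv_l, Rmult_1_r by lra.
  assert (t ^ 2 <= 1) by nra. nra.
Qed.

Definition dlog (z : C) (n : nat) : C := (Clog (z + RtoC (INR n)) - RtoC (ln (INR n)))%C.

Lemma dlog_bound (z : C) (n : nat) : (1 <= n)%nat -> 2 * Cmod z <= INR n ->
  Cmod (RtoC (INR n) ^ 2 * dlog z n - RtoC (INR n) * z + z ^ 2 / 2)%C <= 2 * Cmod z ^ 3 * / INR n.
Proof.
  intros H1 H2.
  assert (Hn : 0 < INR n) by (apply lt_0_INR; lia).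
  assert (Hc : RtoC (INR n) <> 0%C) by (apply RtoC_neq_0; lra).
  set (w := (z / RtoC (INR n))%C).
  assert (Em : Cmod w = Cmod z / INR n).
  { unfold w. rewrite Cmod_div by exact Hc. now rewrite Cmod_R, Rabs_pos_eq by lra. }
  assert (Hw : Cmod w <= / 2).
  { rewrite Em. apply Rmult_le_reg_r with (INR n); [exact Hn|].
    unfold Rdiv. rewrite Rmult_assoc, Rinv_l by lra. lra. }
  assert (El : dlog z n = Clog (1 + w)).
  { unfold dlog. replace (z + RtoC (INR n))%C with (RtoC (INR n) * (1 + w))%C.
    2:{ unfold w. field. exact Hc. }
    rewrite Clog_scal; [ring | exact Hn|].
    rewrite Re_plus. change (Re (RtoC 1)) with 1.
    generalize (re_le_Cmod w). intros H. apply Rabs_le_between in H. lra. }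
  rewrite El.
  replace (RtoC (INR n) ^ 2 * Clog (1 + w) - RtoC (INR n) * z + z ^ 2 / 2)%C
    with (RtoC (INR n) ^ 2 * (Clog (1 + w) - w + w ^ 2 / 2))%C.
  2:{ unfold w. field. exact Hc. }
  rewrite Cmod_mult, Cmod_pow, Cmod_R, Rabs_pos_eq by lra.
  replace (2 * Cmod z ^ 3 * / INR n) with (INR n ^ 2 * (2 * (Cmod z / INR n) ^ 3)) by (field; lra).
  rewrite <- Em. apply Rmult_le_compat_l; [apply pow_le; lra|].
  now apply Clog_1_plus_bound.
Qed.

Lemma is_lim_seq_inv_INR0 (K : R) : is_lim_seq (fun n => K * / INR n) 0.
Proof.
  replace (Finite 0) with (Finite (K * 0)) by (f_equal; ring).
  apply is_lim_seq_mult'; [apply is_lim_seq_const|].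
  apply (is_lim_seq_inv _ p_infty); [apply is_lim_seq_INR | discriminate].
Qed.

Lemma Clim_inv_INR : Clim (fun n => / RtoC (INR n))%C 0%C.
Proof.
  apply Clim_ext_from with 1%nat (fun n => RtoC (/ INR n)).
  { intros n Hn. apply RtoC_inv. apply not_0_INR. lia. }
  apply Clim_RtoC. apply is_lim_seq_ext with (fun n => 1 * / INR n); [intros; ring|].
  apply is_lim_seq_inv_INR0.
Qed.

(** This order is needed because the telescoped logarithm of G multiplies log (1 + z/n) by n^2. The
    coarser limits below follow by dividing by n. *)
Lemma dlog_lim2 (z : C) :
  Clim (fun n => RtoC (INR n) ^ 2 * dlog z n - RtoC (INR n) * z + z ^ 2 / 2)%C 0%C.
Proof.
  apply Clim_Cmod.
  destruct (INR_unbounded (2 * Cmod z)) as [N HN].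
  apply is_lim_seq_le_le_loc with (fun _ => 0) (fun n => 2 * Cmod z ^ 3 * / INR n).
  - exists (S N). intros n Hn. split; [apply Cmod_ge_0|].
    unfold Cminus at 1. rewrite Copp_0, Cplus_0_r. apply dlog_bound; [lia|].
    apply le_INR in Hn. rewrite S_INR in Hn. lra.
  - apply is_lim_seq_const.
  - apply is_lim_seq_inv_INR0.
Qed.

Lemma dlog_lim1 (z : C) : Clim (fun n => RtoC (INR n) * dlog z n - z)%C 0%C.
Proof.
  apply Clim_ext_from with 1%nat
    (fun n => (RtoC (INR n) ^ 2 * dlog z n - RtoC (INR n) * z + z ^ 2 / 2 - z ^ 2 / 2) * / RtoC (INR n))%C.
  { intros n Hn. field. apply RtoC_neq_0. apply not_0_INR. lia. }
  replace (RtoC 0) with ((0 - z ^ 2 / 2) * 0)%C by ring.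
  apply Clim_mult; [|apply Clim_inv_INR].
  apply Clim_minus; [apply dlog_lim2 | apply Clim_const].
Qed.

Lemma dlog_lim0 (z : C) : Clim (dlog z) 0%C.
Proof.
  apply Clim_ext_from with 1%nat (fun n => (RtoC (INR n) * dlog z n - z + z) * / RtoC (INR n))%C.
  { intros n Hn. field. apply RtoC_neq_0. apply not_0_INR. lia. }
  replace (RtoC 0) with ((0 + z) * 0)%C by ring.
  apply Clim_mult; [|apply Clim_inv_INR].
  apply Clim_plus; [apply dlog_lim1 | apply Clim_const].
Qed.

(** * The Wallis product and Stirling's formula *)

Definition wallis_int (n : nat) : R := RInt (fun t => sin t ^ n) 0 (PI / 2).

Lemma wallis_int_correct (n : nat) : is_RInt (fun t => sin t ^ n) 0 (PI / 2) (wallis_int n).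
Proof.
  apply (RInt_correct (V := R_CompleteNormedModule)).
  apply (ex_RInt_continuous (V := R_CompleteNormedModule)). intros t _.
  apply (ex_derive_continuous (V := R_NormedModule)). auto_derive. trivial.
Qed.

(** The integrand of the difference is the derivative of -cos t sin^(n+1) t, which vanishes at both
    ends. *)
Lemma wallis_int_rec (n : nat) :
  INR (S (S n)) * wallis_int (S (S n)) = INR (S n) * wallis_int n.
Proof.
  assert (H : is_RInt (fun t => INR (S (S n)) * sin t ^ S (S n) - INR (S n) * sin t ^ n)
                0 (PI / 2) (- cos (PI / 2) * sin (PI / 2) ^ S n - - cos 0 * sin 0 ^ S n)).
  { apply (is_RInt_derive (V := R_CompleteNormedModule) (fun t => - cos t * sin t ^ S n)).
    - intros t _. auto_derive; [trivial|].
      rewrite !S_INR.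
      assert (E : cos t * cos t = 1 - sin t * sin t).
      { generalize (sin2_cos2 t). unfold Rsqr. lra. }
      simpl pred. simpl pow. simpl INR.
      replace (match n with 0%nat => 1 | S _ => INR n + 1 end) with (INR n + 1)
        by (destruct n; simpl; ring).
      transitivity (sin t * (sin t * sin t ^ n) - (cos t * cos t) * (INR n + 1) * sin t ^ n); [ring|].
      rewrite E. ring.
    - intros t _. apply (ex_derive_continuous (V := R_NormedModule)). auto_derive. trivial. }
  rewrite cos_PI2, sin_0, pow_i in H by lia.
  assert (H' := is_RInt_minus (V := R_NormedModule) _ _ _ _ _ _
    (is_RInt_scal (V := R_NormedModule) _ _ _ (INR (S (S n))) _ (wallis_int_correct (S (S n))))
    (is_RInt_scal (V := R_NormedModule) _ _ _ (INR (S n)) _ (wallis_int_correct n))).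
  apply (is_RInt_unique (V := R_CompleteNormedModule)) in H.
  apply (is_RInt_unique (V := R_CompleteNormedModule)) in H'.
  change (RInt (fun t => INR (S (S n)) * sin t ^ S (S n) - INR (S n) * sin t ^ n) 0 (PI / 2)
    = INR (S (S n)) * wallis_int (S (S n)) - INR (S n) * wallis_int n) in H'.
  rewrite H in H'. lra.
Qed.

Lemma wallis_int_decr (n : nat) : wallis_int (S n) <= wallis_int n.
Proof.
  pose proof PI_RGT_0.
  apply (is_RInt_le (fun t => sin t ^ S n) (fun t => sin t ^ n) 0 (PI / 2));
    [lra | apply wallis_int_correct | apply wallis_int_correct |].
  intros t Ht. simpl.
  assert (0 <= sin t) by (apply sin_ge_0; lra).
  generalize (SIN_bound t) (pow_le _ n H0). nra.
Qed.

Lemma wallis_int_0 : wallis_int 0 = PI / 2.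
Proof.
  unfold wallis_int. simpl. rewrite RInt_const. unfold scal; simpl; unfold mult; simpl. ring.
Qed.

Lemma wallis_int_1 : wallis_int 1 = 1.
Proof.
  unfold wallis_int. apply (is_RInt_unique (V := R_CompleteNormedModule)).
  replace 1 with (- cos (PI / 2) - - cos 0) by (rewrite cos_PI2, cos_0; ring).
  apply (is_RInt_derive (V := R_CompleteNormedModule) (fun t => - cos t)).
  - intros t _. auto_derive; [trivial|]. ring.
  - intros t _. apply (ex_derive_continuous (V := R_NormedModule)). auto_derive. trivial.
Qed.

Fixpoint wallis (n : nat) : R :=
  match n with
  | O => 1
  | S m => wallis m * (INR (2 * m + 2) / INR (2 * m + 1))
  end.

Lemma wallis_S (n : nat) : wallis (S n) = wallis n * (INR (2 * n + 2) / INR (2 * n + 1)).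
Proof. reflexivity. Qed.

Lemma wallis_pos (n : nat) : 0 < wallis n.
Proof.
  induction n; [simpl; lra|]. rewrite wallis_S.
  apply Rmult_lt_0_compat; [exact IHn|].
  apply Rdiv_lt_0_compat; apply lt_0_INR; lia.
Qed.

Lemma wallis_int_even_odd (n : nat) :
  wallis_int (2 * n) = PI / 2 / wallis n /\ wallis_int (2 * n + 1) = wallis n / INR (2 * n + 1).
Proof.
  induction n as [|n [IH1 IH2]].
  - simpl Nat.mul. simpl Nat.add. simpl wallis. rewrite wallis_int_0, wallis_int_1. simpl. split; field.
  - pose proof (wallis_pos n).
    replace (2 * S n)%nat with (S (S (2 * n))) by lia.
    replace (S (S (2 * n)) + 1)%nat with (S (S (2 * n + 1))) by lia.
    pose proof (wallis_int_rec (2 * n)) as R1.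
    pose proof (wallis_int_rec (2 * n + 1)) as R2.
    rewrite IH1 in R1. rewrite IH2 in R2.
    rewrite wallis_S.
    replace (2 * n + 2)%nat with (S (S (2 * n))) by lia.
    replace (2 * n + 1)%nat with (S (2 * n)) in * by lia.
    assert (P1 : 0 < INR (S (2 * n))) by (apply lt_0_INR; lia).
    assert (P2 : 0 < INR (S (S (2 * n)))) by (apply lt_0_INR; lia).
    assert (P3 : 0 < INR (S (S (S (2 * n))))) by (apply lt_0_INR; lia).
    split.
    + apply Rmult_eq_reg_l with (INR (S (S (2 * n)))); [|lra]. rewrite R1.
      field. repeat split; lra.
    + apply Rmult_eq_reg_l with (INR (S (S (S (2 * n))))); [|lra]. rewrite R2.
      field. repeat split; lra.
Qed.

(** The integrals decrease, so the even one of order 2n lies between its odd neighbours. It is PI/2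
    divided by [wallis n], they are multiples of [wallis n], and this confines wallis(n)^2 / n to
    the interval from PI to PI + PI/(2n). *)
Lemma wallis_lim : is_lim_seq (fun n => wallis n * wallis n / INR n) PI.
Proof.
  apply is_lim_seq_le_le_loc with (fun _ => PI) (fun n => PI + PI / 2 * / INR n).
  - exists 1%nat. intros n Hn.
    destruct (wallis_int_even_odd n) as [E1 E2].
    pose proof (wallis_pos n) as Hw.
    assert (Hn0 : 0 < INR n) by (apply lt_0_INR; lia).
    assert (P1 : 0 < INR (2 * n + 1)) by (apply lt_0_INR; lia).
    assert (P2 : 0 < INR (2 * n)) by (apply lt_0_INR; lia).
    assert (N1 : INR (2 * n + 1) = 2 * INR n + 1) by (rewrite plus_INR, mult_INR; simpl; ring).
    assert (N2 : INR (2 * n) = 2 * INR n) by (rewrite mult_INR; simpl; ring).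
    split.
    + assert (W : wallis_int (2 * n) <= wallis n / INR (2 * n)).
      { destruct n as [|m]; [lia|].
        replace (2 * S m)%nat with (S (2 * m + 1)) at 1 by lia.
        eapply Rle_trans; [apply wallis_int_decr|].
        destruct (wallis_int_even_odd m) as [_ E3]. rewrite E3.
        right. rewrite wallis_S. replace (2 * S m)%nat with (2 * m + 2)%nat by lia.
        assert (0 < INR (2 * m + 1)) by (apply lt_0_INR; lia).
        assert (0 < INR (2 * m + 2)) by (apply lt_0_INR; lia).
        field. lra. }
      rewrite E1, N2 in W.
      apply Rmult_le_compat_r with (r := 2 * wallis n) in W; [|lra].
      replace (PI / 2 / wallis n * (2 * wallis n)) with PI in W by (field; lra).
      replace (wallis n * wallis n / INR n) with (wallis n / (2 * INR n) * (2 * wallis n)) by (field; lra).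
      exact W.
    + pose proof (wallis_int_decr (2 * n)) as W.
      replace (S (2 * n)) with (2 * n + 1)%nat in W by lia.
      rewrite E1, E2, N1 in W.
      assert (0 < (2 * INR n + 1) / INR n * wallis n).
      { apply Rmult_lt_0_compat; [|lra]. apply Rdiv_lt_0_compat; lra. }
      apply Rmult_le_compat_r with (r := (2 * INR n + 1) / INR n * wallis n) in W; [|lra].
      replace (wallis n / (2 * INR n + 1) * ((2 * INR n + 1) / INR n * wallis n))
        with (wallis n * wallis n / INR n) in W by (field; lra).
      replace (PI / 2 / wallis n * ((2 * INR n + 1) / INR n * wallis n))
        with (PI + PI / 2 * / INR n) in W by (field; lra).
      exact W.
  - apply is_lim_seq_const.
  - replace (Finite PI) with (Finite (PI + 0)) by (f_equal; ring).
    apply is_lim_seq_plus'; [apply is_lim_seq_const | apply is_lim_seq_inv_INR0].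
Qed.

Lemma wallis_fact (n : nat) :
  wallis n * INR (fact (2 * n)) = 2 ^ (2 * n) * INR (fact n) * INR (fact n).
Proof.
  induction n.
  - simpl. ring.
  - replace (2 * S n)%nat with (S (S (2 * n))) by lia.
    rewrite !fact_simpl, !mult_INR, wallis_S.
    replace (2 * n + 2)%nat with (S (S (2 * n))) by lia.
    replace (2 * n + 1)%nat with (S (2 * n)) by lia.
    assert (P1 : INR (S (2 * n)) <> 0) by (apply not_0_INR; lia).
    transitivity (wallis n * INR (fact (2 * n)) * INR (S (S (2 * n))) * INR (S (S (2 * n)))).
    { field. exact P1. }
    rewrite IHn. rewrite !S_INR, mult_INR. simpl. ring.
Qed.

Definition stirling_seq (n : nat) : R :=
  ln (INR (fact n)) - (INR n + / 2) * ln (INR n) + INR n.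

Lemma ln_fact_S (n : nat) : ln (INR (fact (S n))) = ln (INR (fact n)) + ln (INR (S n)).
Proof.
  rewrite fact_simpl, mult_INR, ln_mult; [ring | apply lt_0_INR; lia | apply INR_fact_lt_0].
Qed.

Lemma Cpsum_rho (z : C) (n : nat) :
  Cpsum (fun k => rho (z + RtoC (INR k))%C) n =
  ((z + RtoC (INR n) - 1 / 2) * Clog (z + RtoC (INR n)) - (z - 1 / 2) * Clog z
   - Cpsum (fun k => Clog (z + RtoC (INR k))%C) n - RtoC (INR n))%C.
Proof.
  induction n.
  - simpl. rewrite !Cplus_0_r. ring.
  - cbn [Cpsum]. rewrite IHn. unfold rho. rewrite S_INR, RtoC_plus, Cplus_assoc.
    field.
Qed.

Lemma Cpsum_ln_fact (n : nat) :
  Cpsum (fun k => Clog (1 + RtoC (INR k))%C) n = RtoC (ln (INR (fact n))).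
Proof.
  induction n.
  - simpl. now rewrite ln_1.
  - cbn [Cpsum]. rewrite IHn, ln_fact_S, RtoC_plus. f_equal.
    rewrite S_INR, Rplus_comm, <- RtoC_plus. apply Clog_RtoC. generalize (pos_INR n). lra.
Qed.

(** Trapezoidal errors of log, summed from 1, converge; this gives Stirling's formula with an
    unidentified constant. *)
Lemma stirling_ex : exists c : R, is_lim_seq stirling_seq c.
Proof.
  exists (Re (1 - Rho 1)%C).
  assert (H : Clim (fun n => RtoC (stirling_seq n)) (1 - Rho 1)%C); [|apply H].
  apply Clim_ext with (fun n => (RtoC (INR n) * dlog 1 n - 1 + 1) + (1 / 2) * dlog 1 n
    - Cpsum (fun k => rho (1 + RtoC (INR k))%C) n)%C.
  { intros n. rewrite Cpsum_rho, Cpsum_ln_fact. unfold stirling_seq, dlog. rtoc.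
    rewrite Clog_RtoC, ln_1 by lra. field. }
  replace (1 - Rho 1)%C with (0 + 1 + 1 / 2 * 0 - Rho 1)%C by ring.
  apply Clim_minus; [|apply Rho_lim; simpl; lra].
  apply Clim_plus.
  - apply Clim_plus; [apply dlog_lim1 | apply Clim_const].
  - apply Clim_mult; [apply Clim_const | apply dlog_lim0].
Qed.

(** If s_n tends to c, so does 2 s_n - s_(2n). In this combination all terms cancel except the
    logarithm of the Wallis product, which identifies c. *)
Lemma stirling : is_lim_seq stirling_seq (ln (2 * PI) / 2).
Proof.
  destruct stirling_ex as [c Hc].
  pose proof PI_RGT_0 as Hpi.
  assert (H2 : is_lim_seq (fun n => 2 * stirling_seq n - stirling_seq (2 * n)) (2 * c - c)).
  { apply is_lim_seq_minus'.
    - apply is_lim_seq_mult'; [apply is_lim_seq_const | exact Hc].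
    - apply (is_lim_seq_subseq _ _ (fun n => (2 * n)%nat)); [|exact Hc].
      apply eventually_subseq. intros n; lia. }
  assert (H3 : is_lim_seq (fun n => 2 * stirling_seq n - stirling_seq (2 * n)) (ln (2 * PI) / 2)).
  { apply is_lim_seq_ext_loc with (fun n => / 2 * (ln 2 + ln (wallis n * wallis n / INR n))).
    - exists 1%nat. intros n Hn.
      pose proof (wallis_pos n) as Hw.
      assert (Hn0 : 0 < INR n) by (apply lt_0_INR; lia).
      pose proof (f_equal ln (wallis_fact n)) as E.
      rewrite !ln_mult, ln_pow in E; try apply INR_fact_lt_0; try lra; try (apply pow_lt; lra).
      2:{ apply Rmult_lt_0_compat; [apply pow_lt; lra | apply INR_fact_lt_0]. }
      unfold Rdiv. rewrite !ln_mult, ln_Rinv; try lra; try nra.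
      2:{ now apply Rinv_0_lt_compat. }
      unfold stirling_seq. rewrite mult_INR in *. change (INR 2) with 2 in *.
      rewrite ln_mult by lra. lra.
    - replace (ln (2 * PI) / 2) with (/ 2 * (ln 2 + ln PI)).
      2:{ rewrite ln_mult; lra. }
      apply is_lim_seq_mult'; [apply is_lim_seq_const|].
      apply is_lim_seq_plus'; [apply is_lim_seq_const|].
      apply is_lim_seq_continuous; [|apply wallis_lim].
      apply derivable_continuous_pt. exists (/ PI). now apply derivable_pt_lim_ln. }
  apply is_lim_seq_unique in H2. apply is_lim_seq_unique in H3.
  rewrite H2 in H3. injection H3 as H3. replace c with (2 * c - c) in Hc by ring.
  now rewrite H3 in Hc.
Qed.

(** * Euler's constant *)

(** With x = k + 1, ln (x + 1) - ln x lies between 1/(x + 1) and 1/x, and these differ by at most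
    1/x^2. *)
Lemma harmonic_le (k : nat) :
  Rabs (/ (INR k + 1) - (ln (INR k + 2) - ln (INR k + 1))) <= 1 / (INR k + 1) ^ 2.
Proof.
  pose proof (pos_INR k).
  set (x := INR k + 1). replace (INR k + 2) with (x + 1) by (unfold x; ring).
  assert (Hx : 1 <= x) by (unfold x; lra).
  assert (L1 : ln (x + 1) - ln x <= / x).
  { rewrite <- ln_div by lra. replace ((x + 1) / x) with (1 + / x) by (field; lra).
    rewrite <- (ln_exp (/ x)) at 2. apply ln_le.
    - assert (0 < / x) by (apply Rinv_0_lt_compat; lra). lra.
    - apply exp_ineq1_le. }
  assert (L2 : ln x - ln (x + 1) <= - / (x + 1)).
  { rewrite <- ln_div by lra. replace (x / (x + 1)) with (1 + - / (x + 1)) by (field; lra).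
    rewrite <- (ln_exp (- / (x + 1))) at 2. apply ln_le.
    - replace (1 + - / (x + 1)) with (x / (x + 1)) by (field; lra). apply Rdiv_lt_0_compat; lra.
    - apply exp_ineq1_le. }
  assert (L3 : / x - / (x + 1) <= 1 / x ^ 2).
  { replace (/ x - / (x + 1)) with (/ (x * (x + 1))) by (field; lra).
    unfold Rdiv. rewrite Rmult_1_l. apply Rinv_le_contravar; nra. }
  rewrite Rabs_pos_eq; lra.
Qed.

Definition harmonic (n : nat) : R := sum_n_m (fun k => / INR k) 1 n.

Lemma harmonic_S (n : nat) : harmonic (S n) = harmonic n + / INR (S n).
Proof. unfold harmonic. rewrite sum_n_Sm by lia. reflexivity. Qed.

(** [Lim_seq] is total, so [euler_gamma] is a limit only once convergence is proved. The series
    telescopes to ln (n + 1); [dlog 1] corrects this to ln n. *)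
Lemma harmonic_lim : is_lim_seq (fun n => harmonic n - ln (INR n)) euler_gamma.
Proof.
  set (f := fun k => RtoC (/ (INR k + 1) - (ln (INR k + 2) - ln (INR k + 1)))).
  assert (Hf : forall n, Cpsum f n = RtoC (harmonic n - ln (INR n + 1))).
  { induction n.
    - simpl. unfold harmonic. rewrite sum_n_m_zero by lia. change zero with 0.
      rewrite Rplus_0_l, ln_1. f_equal. ring.
    - cbn [Cpsum]. rewrite IHn, harmonic_S. unfold f. rewrite <- RtoC_plus. f_equal. rewrite S_INR.
      replace (INR n + 1 + 1) with (INR n + 2) by ring. ring. }
  destruct (Csum_inv_sqr f 1) as [L _].
  { intros k. unfold f. rewrite Cmod_R. apply harmonic_le. }
  assert (E : Clim (fun n => RtoC (harmonic n - ln (INR n))) (Csum f + 0)%C).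
  { apply Clim_ext with (fun n => Cpsum f n + dlog 1 n)%C.
    - intros n. rewrite Hf. unfold dlog. rewrite <- RtoC_plus, Clog_RtoC.
      + rewrite <- RtoC_minus, <- RtoC_plus. f_equal. rewrite (Rplus_comm 1). ring.
      + generalize (pos_INR n); lra.
    - apply Clim_plus; [exact L | apply dlog_lim0]. }
  destruct E as [E _]. simpl in E.
  unfold euler_gamma. unfold harmonic in *.
  change (is_lim_seq (fun n => sum_n_m (fun k => / INR k) 1 n - ln (INR n))
    (real (Lim_seq (fun n => sum_n_m (fun k => / INR k) 1 n - ln (INR n))))).
  rewrite (is_lim_seq_unique _ _ E). exact E.
Qed.

(** * Logarithms of the gamma function and of the Barnes function *)

(** Gudermann's series for log Gamma: Stirling's formula plus the summed trapezoidal errors of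
    log. *)
Definition LGamma (z : C) : C :=
  ((z - 1 / 2) * Clog z - z + RtoC (ln (2 * PI) / 2) + Rho z)%C.

Definition gamma_partial (z : C) (n : nat) : C :=
  (z * RtoC (ln (INR n)) + RtoC (ln (INR (fact n)))
   - Cpsum (fun k => Clog (z + RtoC (INR k))%C) (S n))%C.

Lemma gamma_partial_lim (z : C) : 0 < Re z -> Clim (gamma_partial z) (LGamma z).
Proof.
  intros Hz. unfold LGamma.
  (* An identity for every n: partial sums of the limit, minus terms that tend to 0. *)
  apply Clim_ext with (fun n =>
    ((z - 1 / 2) * Clog z - z + RtoC (stirling_seq n)
      + Cpsum (fun k => rho (z + RtoC (INR k))%C) n)
    - (RtoC (INR n) * dlog z n - z) - (z + 1 / 2) * dlog z n)%C.
  { intros n. rewrite Cpsum_rho. unfold gamma_partial, stirling_seq, dlog. cbn [Cpsum].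
    rtoc.  field. }
  replace ((z - 1 / 2) * Clog z - z + RtoC (ln (2 * PI) / 2) + Rho z)%C
    with ((z - 1 / 2) * Clog z - z + RtoC (ln (2 * PI) / 2) + Rho z - 0 - (z + 1 / 2) * 0)%C by ring.
  apply Clim_minus; [apply Clim_minus|].
  - apply Clim_plus; [apply Clim_plus; [apply Clim_const|]|now apply Rho_lim].
    apply Clim_RtoC, stirling.
  - apply dlog_lim1.
  - apply Clim_mult; [apply Clim_const | apply dlog_lim0].
Qed.

Definition LBarnes (z : C) : C :=
  (z * LGamma z + z ^ 2 / 4 - Clog z / 2 * bernoulli2 z - (1 / 4 + Bsum 1) + Bsum z)%C.

Definition barnes_partial (z : C) (n : nat) : C :=
  Cpsum (fun k => RtoC (INR (S k)) * (Clog (z + RtoC (INR (S k))) - RtoC (ln (INR (S k))))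
    + z ^ 2 / (2 * RtoC (INR (S k))) - z)%C n.

(** The logarithm of the hyperfactorial 1^1 2^2 ... n^n. *)
Definition klnk (n : nat) : R := sum_n_m (fun k => INR k * ln (INR k)) 1 n.

(** Write k log (z + k) as (z + k) log (z + k) - z log (z + k). Both sums may then start at k = 0,
    where the two terms cancel, and become those of [Cpsum_bstep] and [gamma_partial]. *)
Lemma barnes_partial_eq (z : C) (n : nat) :
  barnes_partial z n =
  (Cpsum (fun k => (z + RtoC (INR k)) * Clog (z + RtoC (INR k))) (S n)
   - z * Cpsum (fun k => Clog (z + RtoC (INR k))) (S n)
   - RtoC (klnk n) + z ^ 2 / 2 * RtoC (harmonic n) - RtoC (INR n) * z)%C.
Proof.
  induction n.
  - unfold barnes_partial, klnk, harmonic. rewrite !sum_n_m_zero by lia.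
    change zero with 0. simpl. ring.
  - unfold barnes_partial in *. cbn [Cpsum]. rewrite IHn. cbn [Cpsum].
    unfold klnk. rewrite sum_n_Sm by lia. fold (klnk n). change plus with Rplus.
    rewrite harmonic_S. assert (INR (S n) <> 0) by (apply not_0_INR; lia).
    rewrite !RtoC_plus, !RtoC_mult, RtoC_inv by assumption.
    replace (RtoC (INR n)) with (RtoC (INR (S n)) - 1)%C.
    2:{ rewrite S_INR. rtoc. ring. }
    field. now apply RtoC_neq_0.
Qed.

(** Minus the Euler-Maclaurin primitive of w log w: w^2/2 log w - w^2/4 - (w log w)/2 + (log w)/12,
    up to sign. One step of it, plus w log w, is [bstep w]. *)
Definition bpot (w : C) : C := (w ^ 2 / 4 - Clog w / 2 * bernoulli2 w)%C.

Lemma Cpsum_bstep (z : C) (n : nat) :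
  Cpsum (fun k => bstep (z + RtoC (INR k))%C) n =
  (bpot (z + RtoC (INR n)) - bpot z
   + Cpsum (fun k => (z + RtoC (INR k)) * Clog (z + RtoC (INR k))) n)%C.
Proof.
  induction n.
  - simpl. rewrite !Cplus_0_r. ring.
  - cbn [Cpsum]. rewrite IHn. unfold bstep, bpot, bernoulli2.
    rewrite S_INR, RtoC_plus.
    replace (z + (RtoC (INR n) + 1))%C with (z + RtoC (INR n) + 1)%C by ring. field.
Qed.

(** At z = 1 the logarithmic sum is that of k ln k, so [Bsum 1] governs the hyperfactorial. The 1/4
    is [bpot 1], and it becomes the 1/4 in 1/4 + I(1). *)
Lemma Cpsum_bstep_1 (n : nat) :
  Cpsum (fun k => bstep (1 + RtoC (INR k))%C) n =
  (bpot (1 + RtoC (INR n)) - 1 / 4 + RtoC (klnk n))%C.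
Proof.
  rewrite Cpsum_bstep. f_equal; [f_equal|].
  - unfold bpot. rewrite Clog_RtoC, ln_1 by lra. field.
  - induction n.
    + unfold klnk. rewrite sum_n_m_zero by lia. reflexivity.
    + cbn [Cpsum]. rewrite IHn. unfold klnk. rewrite sum_n_Sm by lia. change plus with Rplus.
      rewrite (RtoC_plus (sum_n_m _ _ _)). f_equal.
      rewrite <- RtoC_plus, Rplus_comm, <- S_INR, Clog_RtoC by (apply lt_0_INR; lia).
      now rewrite RtoC_mult.
Qed.

Lemma barnes_partial_lim (z : C) : 0 < Re z ->
  Clim (fun n => z / 2 * RtoC (ln (2 * PI)) - (z + z ^ 2 * (1 + RtoC euler_gamma)) / 2
                 + barnes_partial z n)%C (LBarnes z).
Proof.
  intros Hz.
  (* The first bracket tends to [LBarnes z]; the next two terms vanish in the limit by Stirling's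
     formula and by Euler's constant. In the last bracket the coefficients 1/2, (2z + 1)/2, (z^2 + z
     + 1/6)/2 are those of B_2(n + z + 1)/2 in powers of n, and 1/2, 1/2, 1/12 those of B_2(n +
     1)/2: it compensates the logarithms left in [bpot]. The sum at z has n + 1 terms because
     [gamma_partial] has factors up to z + n. *)
  apply Clim_ext with (fun n =>
    ((z * gamma_partial z n + z ^ 2 / 4 - Clog z / 2 * bernoulli2 z
     - (1 / 4 + Cpsum (fun k => bstep (1 + RtoC (INR k))%C) n)
     + Cpsum (fun k => bstep (z + RtoC (INR k))%C) (S n))
    + z * (RtoC (ln (2 * PI) / 2) - RtoC (stirling_seq n))
    + z ^ 2 / 2 * (RtoC (harmonic n - ln (INR n)) - RtoC euler_gamma)
    + (- (1 / 2) * (RtoC (INR n) ^ 2 * dlog 1 n - RtoC (INR n) * 1 + 1 ^ 2 / 2)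
       - 1 / 2 * (RtoC (INR n) * dlog 1 n - 1) - 1 / 12 * dlog 1 n
       + 1 / 2 * (RtoC (INR n) ^ 2 * dlog (z + 1) n - RtoC (INR n) * (z + 1) + (z + 1) ^ 2 / 2)
       + (2 * z + 1) / 2 * (RtoC (INR n) * dlog (z + 1) n - (z + 1))
       + (z ^ 2 + z + 1 / 6) / 2 * dlog (z + 1) n))%C).
  { intros n. rewrite Cpsum_bstep_1, Cpsum_bstep, barnes_partial_eq.
    unfold gamma_partial, stirling_seq, dlog, bpot, bernoulli2.
    rewrite S_INR. rtoc.
    replace (z + (RtoC (INR n) + 1))%C with (z + 1 + RtoC (INR n))%C by ring.
    field. }
  replace (LBarnes z) with
    (LBarnes z + z * (RtoC (ln (2 * PI) / 2) - RtoC (ln (2 * PI) / 2))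
     + z ^ 2 / 2 * (RtoC euler_gamma - RtoC euler_gamma)
     + (- (1 / 2) * 0 - 1 / 2 * 0 - 1 / 12 * 0 + 1 / 2 * 0
        + (2 * z + 1) / 2 * 0 + (z ^ 2 + z + 1 / 6) / 2 * 0))%C by ring.
  apply Clim_plus; [apply Clim_plus; [apply Clim_plus|]|].
  - apply Clim_plus; [apply Clim_minus|].
    + apply Clim_minus; [|apply Clim_const]. apply Clim_plus; [|apply Clim_const].
      apply Clim_mult; [apply Clim_const | now apply gamma_partial_lim].
    + apply Clim_plus; [apply Clim_const|]. apply Bsum_lim. simpl; lra.
    + apply (Clim_incr_1 (Cpsum _)). now apply Bsum_lim.
  - apply Clim_mult; [apply Clim_const|]. apply Clim_minus; [apply Clim_const|].
    apply Clim_RtoC, stirling.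
  - apply Clim_mult; [apply Clim_const|]. apply Clim_minus; [|apply Clim_const].
    apply Clim_RtoC, harmonic_lim.
  - repeat (apply Clim_minus || apply Clim_plus || (apply Clim_mult; [apply Clim_const|]));
    (apply dlog_lim2 || apply dlog_lim1 || apply dlog_lim0).
Qed.

(** * Uniqueness of the logarithm branch *)

Lemma Cexp_eq_1 (v : C) : Cexp v = 1%C -> Re v = 0 /\ cos (Im v) = 1.
Proof.
  intros H.
  assert (E : Re v = 0).
  { pose proof (Cmod_Cexp v) as Hm. rewrite H, Cmod_1 in Hm.
    rewrite <- (ln_exp (Re v)), <- Hm. apply ln_1. }
  split; [exact E|].
  apply (f_equal Re) in H. unfold Cexp in H. simpl in H. rewrite E, exp_0 in H. lra.
Qed.

Lemma cos_eq_1_small (x : R) : cos x = 1 -> Rabs x <= PI -> x = 0.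
Proof.
  intros Hc Hx. destruct (Req_dec x 0) as [|Hn]; [assumption|exfalso].
  assert (Hp : 0 < Rabs x) by now apply Rabs_pos_lt.
  assert (Hl : cos (Rabs x) < cos 0) by (apply cos_decreasing_1; lra).
  rewrite cos_0 in Hl. unfold Rabs in Hl. destruct (Rcase_abs x); rewrite ?cos_neg in Hl; lra.
Qed.

(** Two branches differ by D with Re D = 0 and cos (Im D) = 1. On the vertical segment from Re z,
    where both are real, to z, Im D starts at 0; if it ended beyond PI in modulus it would pass
    through PI or -PI, where the cosine is -1. So it ends within [-PI, PI], and there cos = 1 forces
    0. *)
Lemma log_branch_eq (f L : C -> C) (z : C) :
  is_log_branch f L -> 0 < Re z -> log_branch f z = L z.
Proof.
  intros HL Hz.
  assert (HL' : is_log_branch f (log_branch f)).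
  { unfold log_branch. apply epsilon_spec. now exists L. }
  set (L' := log_branch f) in *.
  destruct HL as (C1 & E1 & R1), HL' as (C2 & E2 & R2).
  set (D := fun w => (L' w - L w)%C).
  assert (HD : forall w, 0 < Re w -> Re (D w) = 0 /\ cos (Im (D w)) = 1).
  { intros w Hw. apply Cexp_eq_1. unfold D. rewrite Cexp_minus, E1, E2 by assumption.
    apply Cinv_r. rewrite <- E1 by assumption. apply Cexp_neq_0. }
  assert (DC : forall w, 0 < Re w -> Ccont D w).
  { intros w Hw. apply Ccont_minus; [now apply C2 | now apply C1]. }
  set (p := fun t : R => (Re z, t * Im z) : C).
  set (g := fun t => Im (D (p t))).
  assert (Hg : Ranalysis1.continuity g).
  { intros t. apply continuity_pt_filterlim.
    assert (CP : Ccont D (p t)).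
    { apply DC. exact Hz. }
    assert (CQ : continuous (U := C_UniformSpace) p t).
    { apply (CD_continuous p t (0, Im z)).
      apply CD_pair with (fun _ => Re z) (fun s => s * Im z); [reflexivity| |].
      - auto_derive; [trivial | reflexivity].
      - auto_derive; [trivial | simpl; unfold Im; ring]. }
    apply (continuous_comp (V := C_UniformSpace) (W := R_UniformSpace) (fun s => D (p s)) Im).
    - exact (continuous_comp p D t CQ CP).
    - apply continuous_snd. }
  assert (G0 : g 0 = 0).
  { unfold g, D, p. rewrite Rmult_0_l. change (Re z, 0) with (RtoC (Re z)).
    reim. rewrite R1, R2 by exact Hz. ring. }
  assert (Hcos : forall t, cos (g t) = 1).
  { intros t. now apply HD. }
  assert (G1 : g 1 = 0).
  { apply cos_eq_1_small; [apply Hcos|]. apply Rnot_lt_le. intros Hgt.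
    pose proof PI_RGT_0 as Hpi.
    assert (Hy : exists y, Rmin (g 0) (g 1) <= y <= Rmax (g 0) (g 1) /\ cos y = -1).
    { rewrite G0. unfold Rabs in Hgt. destruct (Rcase_abs (g 1)).
      - exists (- PI). rewrite cos_neg, cos_PI. split; [|reflexivity].
        rewrite Rmin_right, Rmax_left by lra. lra.
      - exists PI. rewrite cos_PI. split; [|reflexivity].
        rewrite Rmin_left, Rmax_right by lra. lra. }
    destruct Hy as (y & Hy & Hc).
    destruct (IVT_gen g 0 1 y Hg Hy) as (t & _ & Ht).
    specialize (Hcos t). rewrite Ht in Hcos. lra. }
  assert (HDz : D z = 0%C).
  { apply C_eq; [now apply HD|].
    change (Im (D z) = 0). rewrite <- G1. unfold g, p. rewrite Rmult_1_l.
    f_equal. f_equal. now destruct z. }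
  unfold D in HDz. replace (L' z) with (L' z - L z + L z)%C by ring. rewrite HDz. ring.
Qed.

(** * The explicit branches *)

Lemma Im_mult_0 (x y : C) : Im x = 0 -> Im y = 0 -> Im (x * y)%C = 0.
Proof. intros H1 H2. rewrite Im_mult, H1, H2. ring. Qed.

Lemma Im_inv_0 (x : C) : Im x = 0 -> Im (/ x)%C = 0.
Proof. unfold Cinv, Im. simpl. intros ->. unfold Rdiv. ring. Qed.

Lemma Im_plus_0 (x y : C) : Im x = 0 -> Im y = 0 -> Im (x + y)%C = 0.
Proof. intros H1 H2. rewrite Im_plus, H1, H2. ring. Qed.

Lemma Im_opp_0 (x : C) : Im x = 0 -> Im (- x)%C = 0.
Proof. intros H1. rewrite Im_opp, H1. ring. Qed.

Lemma Im_pow_0 (x : C) (n : nat) : Im x = 0 -> Im (x ^ n)%C = 0.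
Proof. intros H. induction n; simpl; [reflexivity | now apply Im_mult_0]. Qed.

Lemma Im_Cpsum_0 (f : nat -> C) (n : nat) :
  (forall k, Im (f k) = 0) -> Im (Cpsum f n) = 0.
Proof. intros H. induction n; simpl; [reflexivity | now apply Im_plus_0]. Qed.

Lemma Im_Clog_0 (x : R) (k : nat) : 0 < x -> Im (Clog (RtoC x + RtoC (INR k))) = 0.
Proof.
  intros Hx. rewrite <- RtoC_plus, Clog_RtoC; [reflexivity|]. generalize (pos_INR k). lra.
Qed.

Ltac im0 := repeat
  match goal with
  | |- Im (RtoC _) = 0 => reflexivity
  | |- Im (Cplus _ _) = 0 => apply Im_plus_0
  | |- Im (Cminus _ _) = 0 => apply Im_plus_0; [|apply Im_opp_0]
  | |- Im (Cmult _ _) = 0 => apply Im_mult_0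
  | |- Im (Cdiv _ _) = 0 => apply Im_mult_0; [|apply Im_inv_0]
  | |- Im (Cpow _ _) = 0 => apply Im_pow_0
  | |- Im (Copp _) = 0 => apply Im_opp_0
  | |- Im (Cpsum _ _) = 0 => apply Im_Cpsum_0; intros
  | |- Im (Clog (Cplus (RtoC _) (RtoC (INR _)))) = 0 => apply Im_Clog_0
  end.

Lemma Clim_Im_0 (u : nat -> C) (l : C) : Clim u l -> (forall n, Im (u n) = 0) -> Im l = 0.
Proof.
  intros [_ H] H0. apply is_lim_seq_unique in H.
  rewrite (Lim_seq_ext _ (fun _ => 0)), Lim_seq_const in H by exact H0.
  now injection H.
Qed.

Lemma Cprod_eq (z : C) (n : nat) : 0 < Re z ->
  Cprod (barnes_factor z) n = Cexp (barnes_partial z n).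
Proof.
  intros Hz. unfold barnes_partial. induction n.
  - simpl. symmetry. apply Cexp_0.
  - cbn [Cprod Cpsum]. rewrite IHn, Cexp_plus. f_equal.
    assert (Hn : 0 < INR (S n)) by (apply lt_0_INR; lia).
    assert (Hc : RtoC (INR (S n)) <> 0%C) by (apply RtoC_neq_0; lra).
    unfold barnes_factor. unfold Cminus at 2. rewrite <- Cplus_assoc, Cexp_plus. f_equal.
    rewrite Cexp_mult_INR. f_equal.
    rewrite Cexp_minus, Cexp_Clog, Cexp_RtoC, exp_ln by (reim; lra).
    field. exact Hc.
Qed.

Lemma LBarnes_branch : is_log_branch (fun w => BarnesG (w + 1)) LBarnes.
Proof.
  split; [|split].
  - intros z Hz.
    assert (Ccont (fun w => w - 1 / 2)%C z) by ccont.
    pose proof (Ccont_Clog z Hz). pose proof (Ccont_Rho z Hz). pose proof (Ccont_Bsum z Hz).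
    unfold LBarnes, LGamma, bernoulli2. apply (Ccont_ext (fun w =>
      w * ((w - 1 / 2) * Clog w - w + RtoC (ln (2 * PI) / 2) + Rho w) + w ^ 2 / 4 -
      Clog w / 2 * (w ^ 2 - w + 1 / 6) - (1 / 4 + Bsum 1) + Bsum w)%C); [reflexivity|].
    ccont.
  - intros z Hz. unfold BarnesG. replace (z + 1 - 1)%C with z by ring. cbv zeta.
    assert (E : Clim (fun n => Cexp (z / 2 * RtoC (ln (2 * PI)) - (z + z ^ 2 * (1 + RtoC euler_gamma)) / 2
                 + barnes_partial z n)%C) (Cexp (LBarnes z))).
    { apply Clim_Cexp. now apply barnes_partial_lim. }
    set (c := (z / 2 * RtoC (ln (2 * PI)))%C) in *.
    set (d := ((z + z ^ 2 * (1 + RtoC euler_gamma)) / 2)%C) in *.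
    change (Rcpow (2 * PI) (z / 2)) with (Cexp c).
    (* [barnes_partial_lim] includes the logarithms of the prefactors, so the limit of the bare
       product is obtained by dividing them out again. *)
    rewrite (Clim_seq_eq _ (Cexp (- (c - d)) * Cexp (LBarnes z))%C).
    + rewrite (Cexp_opp (c - d)), Cexp_minus, (Cexp_opp d). field. split; apply Cexp_neq_0.
    + apply Clim_ext with (fun n => Cexp (- (c - d)) * Cexp (c - d + barnes_partial z n))%C.
      * intros n. rewrite Cprod_eq by exact Hz. rewrite <- Cexp_plus. f_equal. ring.
      * apply Clim_mult; [apply Clim_const | exact E].
  (* Reality passes to the limit from the finite sums, whose terms are visibly real at a real
     point. *)
  - intros x Hx. eapply Clim_Im_0; [apply barnes_partial_lim; exact Hx|].
    intros n. unfold barnes_partial. im0; exact Hx.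
Qed.

Lemma LGamma_continuous (z : C) : 0 < Re z -> Ccont LGamma z.
Proof.
  intros Hz. pose proof (Ccont_Clog z Hz). pose proof (Ccont_Rho z Hz).
  apply (Ccont_ext (fun w =>
    (w - 1 / 2) * Clog w - w + RtoC (ln (2 * PI) / 2) + Rho w)%C); [reflexivity|].
  ccont.
Qed.

Lemma LGamma_real (x : R) : 0 < x -> Im (LGamma (RtoC x)) = 0.
Proof.
  intros Hx. eapply Clim_Im_0; [apply gamma_partial_lim; exact Hx|].
  intros n. unfold gamma_partial. im0. exact Hx.
Qed.

(** * Improper integrals *)

Notation is_CInt_gen f l :=
  (is_RInt_gen (V := C_R_NormedModule) f (at_right 0) (Rbar_locally p_infty) l).

Lemma is_CInt_gen_eps (f : R -> C) (l : C) :
  (forall eps, 0 < eps -> exists d M, 0 < d /\ forall a b, 0 < a < d -> M < b ->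
     exists y, is_CInt f a b y /\ Cmod (y - l)%C < eps) -> is_CInt_gen f l.
Proof.
  intros H P [eps HP].
  destruct (H eps (cond_pos eps)) as (d & M & Hd & H').
  apply Filter_prod with (fun a => 0 < a < d) (fun b => M < b).
  - exists (mkposreal d Hd). intros a Ba Ha. split; [exact Ha|].
    unfold ball in Ba; simpl in Ba; unfold AbsRing_ball, abs, minus, plus, opp in Ba; simpl in Ba.
    apply Rabs_lt_between in Ba. lra.
  - exists M. trivial.
  - intros a b Ha Hb. destruct (H' a b Ha Hb) as (y & Hy & Hl).
    exists y. split; [exact Hy|]. apply HP.
    split; (eapply Rle_lt_trans; [|exact Hl]).
    + apply (re_le_Cmod (y - l)%C).
    + apply (im_le_Cmod (y - l)%C).
Qed.

Lemma is_CInt_gen_continuous (f : R -> C) (l : C) :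
  (forall t, 0 < t -> continuous (U := C_UniformSpace) f t) ->
  (forall eps, 0 < eps -> exists d M, 0 < d /\ forall a b y, 0 < a < d -> M < b -> a <= b ->
     is_CInt f a b y -> Cmod (y - l)%C < eps) -> is_CInt_gen f l.
Proof.
  intros Hc H. apply is_CInt_gen_eps. intros eps He.
  destruct (H eps He) as (d & M & Hd & H').
  exists d, (Rmax M d). split; [exact Hd|]. intros a b Ha Hb.
  pose proof (Rmax_l M d). pose proof (Rmax_r M d).
  exists (CInt f a b).
  assert (HI : is_CInt f a b (CInt f a b)).
  { apply CInt_correct; [lra|]. intros t Ht. apply Hc. lra. }
  split; [exact HI|]. apply (H' a b); trivial; lra.
Qed.

Lemma is_RInt_exp_half (K a b : R) : a <= b ->
  is_RInt (fun t => K * exp (- t / 2)) a b (2 * K * (exp (- a / 2) - exp (- b / 2))).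
Proof.
  intros Hab.
  replace (2 * K * (exp (- a / 2) - exp (- b / 2)))
    with (-2 * K * exp (- b / 2) - -2 * K * exp (- a / 2)) by ring.
  apply (is_RInt_derive (V := R_CompleteNormedModule) (fun t => -2 * K * exp (- t / 2))).
  - intros t _. auto_derive; [trivial|]. unfold Rdiv. field.
  - intros t _. apply (ex_derive_continuous (V := R_NormedModule)). auto_derive. trivial.
Qed.

(** * Euler's integral *)

Lemma Cmod_Rcpow (t : R) (s : C) : Cmod (Rcpow t s) = exp (Re s * ln t).
Proof. unfold Rcpow. rewrite Cmod_Cexp. f_equal. reim. ring. Qed.

Lemma Rcpow_plus (t : R) (s w : C) : Rcpow t (s + w) = (Rcpow t s * Rcpow t w)%C.
Proof. unfold Rcpow. rewrite <- Cexp_plus. f_equal. ring. Qed.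

Lemma Rcpow_1 (t : R) : 0 < t -> Rcpow t 1 = RtoC t.
Proof. intros Ht. unfold Rcpow. now rewrite Cmult_1_l, Cexp_RtoC, exp_ln. Qed.

Lemma CD_Rcpow (t : R) (s : C) : 0 < t -> CD (fun u => Rcpow u s) t (s * Rcpow t (s - 1))%C.
Proof.
  intros Ht.
  assert (E : Rcpow t s = (RtoC t * Rcpow t (s - 1))%C).
  { rewrite <- (Rcpow_1 t Ht). rewrite <- Rcpow_plus. f_equal. ring. }
  eapply CD_eq.
  2:{ unfold Rcpow. apply CD_Cexp. apply CD_mult; [apply CD_const|].
      apply CD_RtoC. auto_derive; [exact Ht | reflexivity]. }
  cbn beta. change (Cexp (s * RtoC (ln t))) with (Rcpow t s). rewrite E.
  rewrite RtoC_mult, RtoC_inv by lra. field. apply RtoC_neq_0; lra.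
Qed.

Lemma CD_comp (f : R -> C) (g : R -> R) (t m : R) (l : C) :
  CD f (g t) l -> is_derive g t m -> CD (fun s => f (g s)) t (RtoC m * l)%C.
Proof.
  intros [H1 H2] Hg. split; rewrite ?re_scal_l, ?im_scal_l.
  - apply (is_derive_comp (fun s => Re (f s)) g); assumption.
  - apply (is_derive_comp (fun s => Im (f s)) g); assumption.
Qed.

(** A primitive of s^(z-1) (1 - s)^n from n integrations by parts. It is O(s^(Re z)) at 0, and at 1
    only the innermost term survives, equal to n! / (z (z + 1) ... (z + n)). *)
Fixpoint beta_prim (n : nat) (z : C) (s : R) : C :=
  match n with
  | O => (Rcpow s z / z)%C
  | S m => (Rcpow s z * RtoC ((1 - s) ^ S m) / z
            + RtoC (INR (S m)) / z * beta_prim m (z + 1) s)%C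
  end.

Lemma beta_prim_CD (n : nat) (z : C) (s : R) : 0 < Re z -> 0 < s ->
  CD (beta_prim n z) s (Rcpow s (z - 1) * RtoC ((1 - s) ^ n))%C.
Proof.
  intros Hz Hs. revert z Hz. induction n; intros z Hz; pose proof (Re_pos_neq_0 _ Hz) as Hn.
  - cbn [beta_prim]. eapply CD_eq.
    2:{ apply CD_mult; [now apply CD_Rcpow | apply CD_const]. }
    cbn beta. simpl pow. field. exact Hn.
  - cbn [beta_prim]. eapply CD_eq.
    2:{ apply CD_plus.
        - apply CD_mult; [apply CD_mult; [now apply CD_Rcpow|]|apply CD_const].
          apply CD_RtoC. auto_derive; [trivial | reflexivity].
        - apply CD_mult; [apply CD_const | apply IHn]. reim. simpl. lra. }
    cbn beta. replace (z + 1 - 1)%C with z by ring.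
    change (pred (S n)) with n. rewrite <- !tech_pow_Rmult.
    change (match n with 0%nat => 1 | S _ => INR n + 1 end) with (INR (S n)).
    change (1 + - s) with (1 - s).
    rewrite !RtoC_mult, !RtoC_opp, RtoC_minus. field. exact Hn.
Qed.

Lemma Cpsum_shift (f : nat -> C) (n : nat) :
  Cpsum f (S n) = (f 0%nat + Cpsum (fun k => f (S k)) n)%C.
Proof.
  induction n; [simpl; ring|].
  change (Cpsum f (S (S n))) with (Cpsum f (S n) + f (S n))%C. rewrite IHn. cbn [Cpsum]. ring.
Qed.

Lemma beta_prim_1 (n : nat) (z : C) : 0 < Re z ->
  beta_prim n z 1 =
  Cexp (RtoC (ln (INR (fact n))) - Cpsum (fun k => Clog (z + RtoC (INR k))) (S n)).
Proof.
  revert z. induction n; intros z Hz; pose proof (Re_pos_neq_0 _ Hz) as Hn.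
  - simpl. rewrite ln_1, !Cplus_0_r, Cplus_0_l. unfold Rcpow. rewrite ln_1, Cmult_0_r, Cexp_0.
    rewrite Cexp_minus, Cexp_0, Cexp_Clog by exact Hz. reflexivity.
  - cbn [beta_prim]. rewrite IHn by (reim; simpl; lra).
    rewrite Rminus_diag, pow_i by lia. rewrite (Cpsum_shift (fun k => Clog (z + RtoC (INR k)))%C), ln_fact_S. cbn beta.
    change (RtoC (INR 0)) with (RtoC 0). rewrite Cplus_0_r.
    rewrite (Cpsum_ext (fun k => Clog (z + RtoC (INR (S k)))%C)
              (fun k => Clog (z + 1 + RtoC (INR k)))%C).
    2:{ intros k. rewrite S_INR, RtoC_plus. f_equal. ring. }
    set (A := Cpsum _ _).
    replace (RtoC (ln (INR (fact n)) + ln (INR (S n))) - (Clog z + A))%C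
      with ((RtoC (ln (INR (S n))) - Clog z) + (RtoC (ln (INR (fact n))) - A))%C
      by (rewrite RtoC_plus; ring).
    rewrite Cexp_plus, (Cexp_minus _ (Clog z)), Cexp_Clog, (Cexp_RtoC (ln (INR (S n)))), exp_ln
      by (try exact Hz; apply lt_0_INR; lia).
    field. exact Hn.
Qed.

Lemma beta_prim_small (n : nat) (z : C) : 0 < Re z ->
  exists K, 0 <= K /\
    forall s, 0 < s <= 1 -> Cmod (beta_prim n z s) <= K * exp (Re z * ln s).
Proof.
  revert z. induction n; intros z Hz; pose proof (Re_pos_neq_0 _ Hz) as Hn;
    assert (Hm : 0 < Cmod z) by (now apply Cmod_gt_0);
    assert (Hi : 0 < / Cmod z) by (now apply Rinv_0_lt_compat).
  - exists (/ Cmod z). split; [lra|]. intros s Hs. cbn [beta_prim].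
    rewrite Cmod_div, Cmod_Rcpow by exact Hn. right. unfold Rdiv. ring.
  - destruct (IHn (z + 1)%C) as (K & HK & H). { reim; simpl; lra. }
    exists (/ Cmod z + INR (S n) * / Cmod z * K).
    assert (HS := pos_INR (S n)).
    split. { assert (0 <= INR (S n) * / Cmod z) by nra. nra. }
    intros s Hs. cbn [beta_prim].
    eapply Rle_trans; [apply Cmod_triangle|].
    rewrite Cmod_mult, !Cmod_div, Cmod_mult, Cmod_Rcpow, !Cmod_R by exact Hn.
    rewrite (Rabs_pos_eq (INR (S n))) by exact HS.
    assert (P1 : Rabs ((1 - s) ^ S n) <= 1).
    { rewrite <- RPow_abs. apply Rle_trans with (1 ^ S n); [|rewrite pow1; lra].
      apply pow_incr. split; [apply Rabs_pos | apply Rabs_le; lra]. }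
    pose proof (H s Hs) as H2. rewrite Re_plus in H2. change (Re (RtoC 1)) with 1 in H2.
    assert (E : exp ((Re z + 1) * ln s) <= exp (Re z * ln s)).
    { rewrite Rmult_plus_distr_r, exp_plus, Rmult_1_l, exp_ln by lra.
      pose proof (exp_pos (Re z * ln s)). nra. }
    pose proof (exp_pos (Re z * ln s)) as Hp. set (X := exp (Re z * ln s)) in *.
    assert (H3 : Cmod (beta_prim n (z + 1) s) <= K * X) by nra.
    rewrite Rmult_plus_distr_r. apply Rplus_le_compat.
    + unfold Rdiv. replace (/ Cmod z * X) with (X * 1 * / Cmod z) by ring.
      apply Rmult_le_compat_r; [lra|]. apply Rmult_le_compat_l; lra.
    + unfold Rdiv. rewrite (Rmult_assoc (INR (S n) * / Cmod z) K X).
      apply Rmult_le_compat_l; [nra|exact H3].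
Qed.

Lemma exp_le (x y : R) : x <= y -> exp x <= exp y.
Proof. intros [H|<-]; [left; now apply exp_increasing | right; reflexivity]. Qed.

Lemma exp_pow (x : R) (n : nat) : exp x ^ n = exp (INR n * x).
Proof.
  induction n; [simpl; now rewrite Rmult_0_l, exp_0|].
  rewrite <- tech_pow_Rmult, IHn, <- exp_plus, S_INR. f_equal. ring.
Qed.

(** With x = t/n: the lower bound is 1 - x <= e^(-x). For the upper one, Bernoulli's inequality
    gives 1 - n x^2 <= (1 - x^2)^n, while 1 - x^2 <= (1 - x) e^x, and n x^2 = t^2 / n. *)
Lemma exp_pow_bounds (n : nat) (t : R) : (1 <= n)%nat -> 0 <= t <= INR n ->
  0 <= exp (- t) - (1 - t / INR n) ^ n <= t ^ 2 * exp (- t) / INR n.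
Proof.
  intros Hn Ht. assert (Hn0 : 0 < INR n) by (apply lt_0_INR; lia).
  set (x := t / INR n).
  assert (Ex : t = INR n * x) by (unfold x; field; lra).
  assert (Hx : 0 <= x <= 1).
  { unfold x. split.
    - apply Rmult_le_pos; [lra | left; now apply Rinv_0_lt_compat].
    - apply Rmult_le_reg_r with (INR n); [exact Hn0|]. unfold Rdiv.
      rewrite Rmult_assoc, Rinv_l by lra. lra. }
  assert (E1 : exp (- t) = exp (- x) ^ n) by (rewrite exp_pow; f_equal; rewrite Ex; ring).
  assert (E2 : exp t = exp x ^ n) by (rewrite exp_pow; f_equal; rewrite Ex; ring).
  split.
  - rewrite E1. assert (1 - x <= exp (- x)) by (generalize (exp_ineq1_le (- x)); lra).
    assert ((1 - x) ^ n <= exp (- x) ^ n) by (apply pow_incr; lra). lra.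
  - assert (B : 1 - INR n * x ^ 2 <= (1 - x ^ 2) ^ n).
    { clear -Hx. clearbody x. induction n; [simpl; lra|].
      rewrite S_INR, <- (tech_pow_Rmult (1 - x ^ 2)). assert (0 <= x ^ 2 <= 1) by nra.
      pose proof (pos_INR n).
      apply Rle_trans with ((1 - x ^ 2) * (1 - INR n * x ^ 2)); [|apply Rmult_le_compat_l; lra].
      assert (0 <= INR n * x ^ 2 * x ^ 2) by (apply Rmult_le_pos; [nra|lra]). lra. }
    assert (D : (1 - x ^ 2) ^ n <= (1 - x) ^ n * exp t).
    { rewrite E2, <- Rpow_mult_distr. apply pow_incr. split; [nra|].
      generalize (exp_ineq1_le x). nra. }
    assert (F : exp (- t) * (1 - INR n * x ^ 2) <= (1 - x) ^ n).
    { replace ((1 - x) ^ n) with (exp (- t) * ((1 - x) ^ n * exp t)).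
      - apply Rmult_le_compat_l; [left; apply exp_pos | lra].
      - replace (exp (- t) * ((1 - x) ^ n * exp t)) with ((1 - x) ^ n * (exp (- t) * exp t)) by ring.
        rewrite <- exp_plus, Rplus_opp_l, exp_0. ring. }
    replace (t ^ 2 * exp (- t) / INR n) with (exp (- t) * (INR n * x ^ 2)).
    + lra.
    + rewrite Ex at 2. field. lra.
Qed.

(** ln y <= y - 1 at y = t / (2c): half of the exponential decay absorbs the power of t. *)
Lemma power_exp_bound (c t : R) : 0 < c -> 0 < t ->
  exp (c * ln t) * exp (- t) <= exp (c * (ln (2 * c) - 1)) * exp (- t / 2).
Proof.
  intros Hc Ht. rewrite <- !exp_plus. apply exp_le.
  assert (H : ln t <= t / (2 * c) + ln (2 * c) - 1).
  { replace t with (t / (2 * c) * (2 * c)) at 1 by (field; lra).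
    assert (0 < t / (2 * c)) by (apply Rdiv_lt_0_compat; lra).
    rewrite ln_mult by lra.
    assert (L : ln (t / (2 * c)) <= t / (2 * c) - 1).
    { rewrite <- (ln_exp (t / (2 * c) - 1)). apply ln_le; [assumption|].
      generalize (exp_ineq1_le (t / (2 * c) - 1)). lra. }
    lra. }
  assert (H2 : c * ln t <= c * (t / (2 * c) + ln (2 * c) - 1)) by (apply Rmult_le_compat_l; lra).
  replace (c * (t / (2 * c) + ln (2 * c) - 1)) with (t / 2 + c * (ln (2 * c) - 1)) in H2 by (field; lra).
  lra.
Qed.

Definition gamma_integrand (z : C) (t : R) : C := (Rcpow t (z - 1) * RtoC (exp (- t)))%C.

Lemma gamma_integrand_continuous (z : C) (t : R) : 0 < t ->
  continuous (U := C_UniformSpace) (gamma_integrand z) t.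
Proof.
  intros Ht. eapply CD_continuous. apply CD_mult; [now apply CD_Rcpow|].
  apply CD_RtoC. auto_derive; [trivial | reflexivity].
Qed.

Definition gamma_approx (z : C) (n : nat) (t : R) : C :=
  (Rcpow t (z - 1) * RtoC ((1 - t / INR n) ^ n))%C.

Lemma gamma_approx_integral (z : C) (n : nat) (a : R) :
  0 < Re z -> (1 <= n)%nat -> 0 < a <= INR n ->
  is_CInt (gamma_approx z n) a (INR n)
    (Cexp (gamma_partial z n) - Rcpow (INR n) z * beta_prim n z (a / INR n))%C.
Proof.
  intros Hz Hn Ha. assert (Hn0 : 0 < INR n) by (apply lt_0_INR; lia).
  replace (Cexp (gamma_partial z n)) with (Rcpow (INR n) z * beta_prim n z (INR n / INR n))%C.
  2:{ replace (INR n / INR n) with 1 by (field; lra). rewrite beta_prim_1 by exact Hz.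
      unfold Rcpow. rewrite <- Cexp_plus. f_equal. unfold gamma_partial. ring. }
  apply (is_CInt_derive (fun t => Rcpow (INR n) z * beta_prim n z (t / INR n))%C); [lra| |].
  - intros t Ht. eapply CD_eq.
    2:{ apply CD_mult; [apply CD_const|].
        apply (CD_comp (beta_prim n z) (fun s => s / INR n) t (/ INR n)).
        - apply beta_prim_CD; [exact Hz | apply Rdiv_lt_0_compat; lra].
        - auto_derive; [trivial | ring]. }
    cbn beta. unfold gamma_approx.
    replace (Rcpow (t / INR n) (z - 1)) with (Rcpow t (z - 1) * RtoC (INR n) / Rcpow (INR n) z)%C.
    + rewrite RtoC_inv by lra. field. split; [apply Cexp_neq_0 | apply RtoC_neq_0; lra].
    + rewrite <- (Rcpow_1 (INR n)) by exact Hn0. unfold Rcpow.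
      rewrite <- Cexp_plus, <- Cexp_minus. f_equal.
      unfold Rdiv. rewrite ln_mult, ln_Rinv by (try apply Rinv_0_lt_compat; lra).
      rtoc. ring.
  - intros t Ht. eapply CD_continuous. apply CD_mult; [apply CD_Rcpow; lra|].
    apply CD_RtoC. auto_derive; [trivial | reflexivity].
Qed.

Lemma is_CInt_minus (f g : R -> C) (a b : R) (l m : C) :
  is_CInt f a b l -> is_CInt g a b m -> is_CInt (fun t => f t - g t)%C a b (l - m)%C.
Proof. apply (is_RInt_minus (V := C_R_NormedModule)). Qed.

Lemma is_CInt_Chasles_inv (f : R -> C) (a b c : R) (l : C) :
  a <= b <= c -> (forall t, a <= t <= c -> continuous (U := C_UniformSpace) f t) ->
  is_CInt f a c l ->
  exists l1 l2, is_CInt f a b l1 /\ is_CInt f b c l2 /\ l = (l1 + l2)%C.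
Proof.
  intros H Hc Hl.
  exists (CInt f a b), (CInt f b c).
  assert (H1 : is_CInt f a b (CInt f a b)).
  { apply CInt_correct; [lra|]. intros t Ht. apply Hc. lra. }
  assert (H2 : is_CInt f b c (CInt f b c)).
  { apply CInt_correct; [lra|]. intros t Ht. apply Hc. lra. }
  repeat split; try assumption.
  pose proof (is_RInt_Chasles (V := C_R_NormedModule) _ _ _ _ _ _ H1 H2) as H3.
  rewrite <- (CInt_unique _ _ _ _ Hl). exact (CInt_unique _ _ _ _ H3).
Qed.

(** The integral is cut at n. Below n, e^(-t) is replaced by (1 - t/n)^n, for which the integral is
    known exactly up to the primitive at a/n; above n only the tail of e^(-t) remains. *)
Lemma gamma_integral_bound (z : C) : 0 < Re z -> exists K, 0 < K /\
  forall n a b y, (1 <= n)%nat -> 0 < a <= INR n -> INR n <= b ->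
  is_CInt (gamma_integrand z) a b y ->
  Cmod (y - Cexp (gamma_partial z n))%C
    <= K / INR n + Cmod (Rcpow (INR n) z * beta_prim n z (a / INR n))%C.
Proof.
  (* The exponent comes from t^(Re z - 1) times the t^2 of [exp_pow_bounds]. The same bound serves
     above n, where t >= 1. *)
  intros Hz. set (c := Re z + 1). assert (Hc : 0 < c) by (unfold c; lra).
  set (K := exp (c * (ln (2 * c) - 1))). assert (HK : 0 < K) by apply exp_pos.
  exists (6 * K). split; [lra|]. intros n a b y Hn Ha Hb Hy.
  assert (Hn0 : 0 < INR n) by (apply lt_0_INR; lia).
  assert (Hn1 : 1 <= INR n) by (replace 1 with (INR 1) by reflexivity; now apply le_INR).
  assert (Hin : 0 < / INR n) by now apply Rinv_0_lt_compat.
  destruct (is_CInt_Chasles_inv (gamma_integrand z) a (INR n) b y) as (y1 & y2 & H1 & H2 & ->).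
  { lra. } { intros t Ht. apply gamma_integrand_continuous. lra. } { exact Hy. }
  pose proof (is_CInt_minus _ _ _ _ _ _ H1 (gamma_approx_integral z n a Hz Hn Ha)) as H3.
  set (P := Cexp (gamma_partial z n)) in *. set (Q := (Rcpow (INR n) z * _)%C) in *.
  assert (B1 : Cmod (y1 - (P - Q))%C <= 2 * K * / INR n).
  { apply Rle_trans with (2 * (K * / INR n) * (exp (- a / 2) - exp (- INR n / 2))).
    - eapply (Cmod_CInt_le _ (fun t => (K * / INR n) * exp (- t / 2))); [| |exact H3|].
      + lra.
      + intros t Ht. cbn beta. unfold gamma_integrand, gamma_approx.
        replace (Rcpow t (z - 1) * RtoC (exp (- t)) - Rcpow t (z - 1) * RtoC ((1 - t / INR n) ^ n))%C
          with (Rcpow t (z - 1) * RtoC (exp (- t) - (1 - t / INR n) ^ n))%C by (rewrite RtoC_minus; ring).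
        rewrite Cmod_mult, Cmod_Rcpow, Cmod_R.
        destruct (exp_pow_bounds n t Hn ltac:(lra)) as [G1 G2].
        rewrite Rabs_pos_eq by exact G1.
        rewrite Re_minus. change (Re (RtoC 1)) with 1.
        apply Rle_trans with (exp ((Re z - 1) * ln t) * (t ^ 2 * exp (- t) / INR n)).
        { apply Rmult_le_compat_l; [left; apply exp_pos | exact G2]. }
        replace (t ^ 2) with (exp (2 * ln t)).
        2:{ replace (2 * ln t) with (ln t + ln t) by ring. rewrite exp_plus, exp_ln by lra. ring. }
        pose proof (power_exp_bound c t Hc ltac:(lra)) as G3. fold K in G3.
        replace (exp ((Re z - 1) * ln t) * (exp (2 * ln t) * exp (- t) / INR n))
          with ((exp (c * ln t) * exp (- t)) * / INR n).
        * replace (K * / INR n * exp (- t / 2)) with (K * exp (- t / 2) * / INR n) by ring.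
          apply Rmult_le_compat_r; [lra | exact G3].
        * unfold c. replace ((Re z + 1) * ln t) with ((Re z - 1) * ln t + 2 * ln t) by ring.
          rewrite exp_plus. unfold Rdiv. ring.
      + apply is_RInt_exp_half. lra.
    - pose proof (exp_pos (- INR n / 2)).
      assert (exp (- a / 2) <= 1) by (rewrite <- exp_0; apply exp_le; lra).
      assert (0 < K * / INR n) by nra. nra. }
  assert (B2 : Cmod y2 <= 4 * K * / INR n).
  { apply Rle_trans with (2 * K * (exp (- INR n / 2) - exp (- b / 2))).
    - eapply (Cmod_CInt_le _ (fun t => K * exp (- t / 2))); [| |exact H2|].
      + lra.
      + intros t Ht. unfold gamma_integrand. rewrite Cmod_mult, Cmod_Rcpow, Cmod_R.
        rewrite Rabs_pos_eq by (left; apply exp_pos).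
        rewrite Re_minus. change (Re (RtoC 1)) with 1.
        eapply Rle_trans; [|apply (power_exp_bound c t Hc); lra].
        apply Rmult_le_compat_r; [left; apply exp_pos|]. apply exp_le.
        assert (0 <= ln t) by (rewrite <- ln_1; apply ln_le; lra). unfold c. nra.
      + apply is_RInt_exp_half. lra.
    - pose proof (exp_pos (- b / 2)).
      assert (E : exp (- INR n / 2) <= 2 * / INR n).
      { replace (- INR n / 2) with (- (INR n / 2)) by field. rewrite exp_Ropp.
        replace (2 * / INR n) with (/ (INR n / 2)) by (field; lra).
        apply Rinv_le_contravar; [lra|]. generalize (exp_ineq1_le (INR n / 2)). lra. }
      nra. }
  replace (y1 + y2 - P)%C with ((y1 - (P - Q)) + (y2 - Q))%C by ring.
  eapply Rle_trans; [apply Cmod_triangle|].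
  pose proof (Cmod_triangle_sub y2 Q). unfold Rdiv. lra.
Qed.

Lemma gamma_integral (z : C) : 0 < Re z -> is_CInt_gen (gamma_integrand z) (Cexp (LGamma z)).
Proof.
  intros Hz. apply is_CInt_gen_continuous.
  { intros t Ht. now apply gamma_integrand_continuous. }
  intros eps He.
  destruct (gamma_integral_bound z Hz) as (K & HK & HB).
  pose proof (Clim_Cexp _ _ (gamma_partial_lim z Hz)) as HL. rewrite Clim_eps in HL.
  destruct (HL (eps / 3) ltac:(lra)) as [N1 HN1].
  destruct (INR_unbounded (3 * K / eps)) as [N2 HN2].
  set (n := S (N1 + N2)).
  assert (Hn : (1 <= n)%nat) by (unfold n; lia).
  assert (Hn0 : 0 < INR n) by (apply lt_0_INR; lia).
  assert (HKn : K / INR n < eps / 3).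
  { assert (INR N2 <= INR n) by (apply le_INR; unfold n; lia).
    apply Rmult_lt_reg_r with (INR n * 3 / eps).
    - apply Rdiv_lt_0_compat; lra.
    - replace (K / INR n * (INR n * 3 / eps)) with (3 * K / eps) by (field; lra).
      replace (eps / 3 * (INR n * 3 / eps)) with (INR n) by (field; lra). lra. }
  (* The constant depends on n, so n is fixed before the lower limit a is made small; d is chosen
     with d^(Re z) = eps / (3 (K2 + 1)). *)
  destruct (beta_prim_small n z Hz) as (K2 & HK2 & HB2).
  set (d := exp (ln (eps / 3 / (K2 + 1)) / Re z)).
  assert (Hq : 0 < eps / 3 / (K2 + 1)) by (apply Rdiv_lt_0_compat; lra).
  exists (Rmin d (INR n)), (INR n). split.
  { apply Rmin_pos; [apply exp_pos | exact Hn0]. }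
  intros a b y Ha Hb Hab Hy.
  pose proof (Rmin_l d (INR n)). pose proof (Rmin_r d (INR n)).
  pose proof (HB n a b y Hn ltac:(lra) ltac:(lra) Hy) as H1.
  assert (H2 : Cmod (Rcpow (INR n) z * beta_prim n z (a / INR n))%C < eps / 3).
  { rewrite Cmod_mult, Cmod_Rcpow.
    assert (Hs : 0 < a / INR n <= 1).
    { split; [apply Rdiv_lt_0_compat; lra|].
      apply Rmult_le_reg_r with (INR n); [exact Hn0|].
      unfold Rdiv. rewrite Rmult_assoc, Rinv_l by lra. lra. }
    pose proof (HB2 _ Hs) as H3.
    apply Rle_lt_trans with (K2 * exp (Re z * ln a)).
    - replace (exp (Re z * ln a)) with (exp (Re z * ln (INR n)) * exp (Re z * ln (a / INR n))).
      + pose proof (exp_pos (Re z * ln (INR n))). nra.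
      + rewrite <- exp_plus. f_equal. unfold Rdiv.
        rewrite ln_mult, ln_Rinv by (try apply Rinv_0_lt_compat; lra). ring.
    - assert (H4 : exp (Re z * ln a) < eps / 3 / (K2 + 1)).
      { rewrite <- (exp_ln (eps / 3 / (K2 + 1))) by exact Hq. apply exp_increasing.
        assert (L : ln a < ln d) by (apply ln_increasing; lra).
        unfold d in L. rewrite ln_exp in L.
        apply Rmult_lt_compat_l with (r := Re z) in L; [|exact Hz].
        replace (Re z * (ln (eps / 3 / (K2 + 1)) / Re z)) with (ln (eps / 3 / (K2 + 1))) in L
          by (field; lra). exact L. }
      pose proof (exp_pos (Re z * ln a)).
      replace (eps / 3) with ((K2 + 1) * (eps / 3 / (K2 + 1))) by (field; lra).
      nra. }
  specialize (HN1 n ltac:(unfold n; lia)).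
  replace (y - Cexp (LGamma z))%C
    with ((y - Cexp (gamma_partial z n)) + (Cexp (gamma_partial z n) - Cexp (LGamma z)))%C by ring.
  eapply Rle_lt_trans; [apply Cmod_triangle|]. lra.
Qed.

Lemma is_CInt_gen_unique (f : R -> C) (l : C) :
  is_CInt_gen f l ->
  RInt_gen (V := C_R_CompleteNormedModule) f (at_right 0) (Rbar_locally p_infty) = l.
Proof. intros H. now apply (is_RInt_gen_unique (V := C_R_CompleteNormedModule)). Qed.

Lemma LGamma_branch : is_log_branch Gamma LGamma.
Proof.
  split; [|split].
  - exact LGamma_continuous.
  - intros z Hz. symmetry. unfold Gamma. apply is_CInt_gen_unique. now apply gamma_integral.
  - exact LGamma_real.
Qed.

(** * The Binet kernel *)

Definition binet_kernel (x : R) : R := 1 / (1 - exp (- x)) - 1 / x - 1 / 2 - x / 12.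

Definition step_kernel (x : R) : R :=
  (1 + exp (- x)) / 2 - (1 - exp (- x)) / x - x * (1 - exp (- x)) / 12.

Lemma one_minus_exp_pos (x : R) : 0 < x -> 0 < 1 - exp (- x).
Proof.
  intros Hx. assert (exp (- x) < exp 0) by (apply exp_increasing; lra).
  rewrite exp_0 in H. lra.
Qed.

Lemma binet_kernel_step (x : R) : 0 < x -> (1 - exp (- x)) * binet_kernel x = step_kernel x.
Proof.
  intros Hx. pose proof (one_minus_exp_pos x Hx).
  unfold binet_kernel, step_kernel. field. lra.
Qed.

Lemma em_kernel_laplace (x : R) : 0 < x ->
  is_RInt (fun u => em_kernel u * exp (- (u * x))) 0 1 (step_kernel x / x ^ 4).
Proof.
  intros Hx.
  (* The primitive of a polynomial times e^(-ux): successive derivatives of the kernel over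
     successive powers of x, the last derivative being -1. *)
  set (F := fun u => - (exp (- (u * x)) * (- (u ^ 2 * (1 - u) ^ 2 / 24) / x
    + - (2 * u - 6 * u ^ 2 + 4 * u ^ 3) / 24 / x ^ 2
    + - (1 - 6 * u + 6 * u ^ 2) / 12 / x ^ 3 + (1 - 2 * u) / 2 / x ^ 4 - / x ^ 5))).
  replace (step_kernel x / x ^ 4) with (F 1 - F 0).
  2:{ unfold F, step_kernel. rewrite Rmult_0_l, Ropp_0, exp_0, Rmult_1_l. field. lra. }
  apply (is_RInt_derive (V := R_CompleteNormedModule) F).
  - intros u _. unfold F, em_kernel. auto_derive; [trivial|].
    field. lra.
  - intros u _. apply (ex_derive_continuous (V := R_NormedModule)). unfold em_kernel.
    auto_derive. trivial.
Qed.

(** The cancellation up to order x^4 at 0 is read off the integral representation, where the kernel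
    is at most 1/24. *)
Lemma step_kernel_bound (x : R) : 0 < x -> Rabs (step_kernel x) <= x ^ 4 / 24.
Proof.
  intros Hx.
  assert (H : Rabs (step_kernel x / x ^ 4) <= (1 - 0) * / 24).
  { eapply (norm_RInt_le_const (V := R_NormedModule)); [lra| |now apply em_kernel_laplace].
    intros u Hu. change (Rabs (em_kernel u * exp (- (u * x))) <= / 24).
    rewrite Rabs_mult, (Rabs_pos_eq (exp _)) by (left; apply exp_pos).
    pose proof (em_kernel_bound u Hu). pose proof (exp_pos (- (u * x))).
    assert (exp (- (u * x)) <= 1) by (rewrite <- exp_0; apply exp_le; nra).
    pose proof (Rabs_pos (em_kernel u)). nra. }
  assert (H4 : 0 < x ^ 4) by now apply pow_lt.
  unfold Rdiv in H. rewrite Rabs_mult, (Rabs_pos_eq (/ x ^ 4)) in H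
    by (left; now apply Rinv_0_lt_compat).
  apply Rmult_le_compat_r with (r := x ^ 4) in H; [|lra].
  rewrite Rmult_assoc, Rinv_l in H by lra. lra.
Qed.

(** Divide the previous bound by 1 - e^(-x) >= x / (1 + x). *)
Lemma binet_kernel_bound (x : R) : 0 < x -> Rabs (binet_kernel x / x ^ 2) <= x * (1 + x) / 24.
Proof.
  intros Hx. pose proof (one_minus_exp_pos x Hx) as Hp.
  pose proof (step_kernel_bound x Hx) as H. rewrite <- binet_kernel_step in H by exact Hx.
  rewrite Rabs_mult, (Rabs_pos_eq (1 - _)) in H by lra.
  assert (E : x / (1 + x) <= 1 - exp (- x)).
  { rewrite exp_Ropp. assert (1 + x <= exp x) by apply exp_ineq1_le.
    assert (/ exp x <= / (1 + x)) by (apply Rinv_le_contravar; lra).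
    replace (x / (1 + x)) with (1 - / (1 + x)) by (field; lra). lra. }
  unfold Rdiv at 1. rewrite Rabs_mult, (Rabs_pos_eq (/ x ^ 2)).
  2:{ left. apply Rinv_0_lt_compat. nra. }
  pose proof (Rabs_pos (binet_kernel x)) as HK.
  assert (H2 : x / (1 + x) * Rabs (binet_kernel x) <= x ^ 4 / 24) by nra.
  apply Rmult_le_compat_r with (r := (1 + x) / x ^ 3) in H2.
  2:{ left. apply Rdiv_lt_0_compat; [lra|now apply pow_lt]. }
  replace (x / (1 + x) * Rabs (binet_kernel x) * ((1 + x) / x ^ 3))
    with (Rabs (binet_kernel x) * / x ^ 2) in H2 by (field; lra).
  replace (x ^ 4 / 24 * ((1 + x) / x ^ 3)) with (x * (1 + x) / 24) in H2 by (field; lra).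
  exact H2.
Qed.

(** * One step of the Binet integral *)

(* [incgamma v X] is the integral of x^2 e^(-vx) over [0, X]. *)
Definition incgamma (v : C) (X : R) : C :=
  (2 / v ^ 3 - Cexp (- (v * RtoC X)) * (RtoC (X ^ 2) / v + 2 * RtoC X / v ^ 2 + 2 / v ^ 3))%C.

Lemma incgamma_CD (v : C) (X : R) : v <> 0%C ->
  CD (incgamma v) X (RtoC (X ^ 2) * Cexp (- (v * RtoC X)))%C.
Proof.
  intros Hv. unfold incgamma. eapply CD_eq; [|cd_rules].
  cbn beta. simpl INR. rtoc. simpl pred. field. exact Hv.
Qed.

Lemma incgamma_CD_shift (w : C) (u X : R) : (w + RtoC u)%C <> 0%C ->
  exists l, CD (fun t => incgamma (w + RtoC t) X) u l.
Proof.
  intros Hv. eexists. unfold incgamma. cd_rules; try (apply Cpow_nz); exact Hv.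
Qed.

Lemma incgamma_small (v : C) (X : R) : 0 < Re v -> 0 <= X <= 1 -> Cmod (incgamma v X) <= X.
Proof.
  intros Hv HX.
  assert (H : is_CInt (fun x => RtoC (x ^ 2) * Cexp (- (v * RtoC x)))%C 0 X (incgamma v X - incgamma v 0)%C).
  { apply is_CInt_derive; [lra| |]; intros t _.
    - apply incgamma_CD. now apply Re_pos_neq_0.
    - eapply CD_continuous. cd_rules. }
  assert (E : incgamma v 0 = 0%C).
  { unfold incgamma. rewrite Cmult_0_r, Copp_0, Cexp_0.
    replace (0 ^ 2) with 0 by ring. field. now apply Re_pos_neq_0. }
  rewrite E in H. replace (incgamma v X) with (incgamma v X - 0)%C by ring.
  replace X with ((X - 0) * 1) at 2 by ring.
  eapply Cmod_CInt_le_const; [lra| |exact H].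
  intros x Hx. cbn beta. rewrite Cmod_mult, Cmod_R, Cmod_Cexp. reim.
  rewrite Rabs_pos_eq by nra.
  assert (exp (- (Re v * x - Im v * 0)) <= 1) by (rewrite <- exp_0; apply exp_le; nra).
  pose proof (exp_pos (- (Re v * x - Im v * 0))). nra.
Qed.

(** The cube of e^(y/3) >= y/3. The third power outweighs the X^2 in [incgamma]. *)
Lemma exp_neg_le_inv (y : R) : 0 < y -> exp (- y) <= 27 / y ^ 3.
Proof.
  intros Hy. rewrite exp_Ropp.
  replace (27 / y ^ 3) with (/ ((y / 3) ^ 3)) by (field; lra).
  apply Rinv_le_contravar; [apply pow_lt; lra|].
  replace y with (INR 3 * (y / 3)) at 2 by (simpl; field).
  rewrite <- exp_pow. apply pow_incr. generalize (exp_ineq1_le (y / 3)). lra.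
Qed.

(** The constant depends only on a lower bound of Re v, so the estimate holds uniformly along v = w
    + u for u in [0, 1]. *)
Lemma incgamma_large (a : R) : 0 < a ->
  exists K, forall v X, a <= Re v -> 1 <= X -> Cmod (incgamma v X - 2 / v ^ 3)%C <= K / X.
Proof.
  intros Ha. exists (27 / a ^ 3 * (/ a + 2 / a ^ 2 + 2 / a ^ 3)). intros v X Hv HX.
  assert (Hn : v <> 0%C) by (apply Re_pos_neq_0; lra).
  unfold incgamma.
  set (S := (RtoC (X ^ 2) / v + 2 * RtoC X / v ^ 2 + 2 / v ^ 3)%C).
  replace (2 / v ^ 3 - Cexp (- (v * RtoC X)) * S - 2 / v ^ 3)%C
    with (- (Cexp (- (v * RtoC X)) * S))%C by ring.
  rewrite Cmod_opp, Cmod_mult, Cmod_Cexp. reim.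
  assert (Hi : forall n, / Cmod v ^ n <= / a ^ n).
  { intros n. apply Rinv_le_contravar; [now apply pow_lt|].
    apply pow_incr. generalize (Re_le_Cmod v). lra. }
  assert (Hp : forall n, 0 < / a ^ n) by (intros n; apply Rinv_0_lt_compat; now apply pow_lt).
  assert (B : Cmod S <= X ^ 2 * (/ a + 2 / a ^ 2 + 2 / a ^ 3)).
  { unfold S. eapply Rle_trans; [apply Cmod_triangle|].
    pose proof (Cmod_triangle (RtoC (X ^ 2) / v) (2 * RtoC X / v ^ 2)) as T.
    rewrite !Cmod_div, Cmod_mult, !Cmod_pow, !Cmod_R in T by (try apply Cpow_nz; exact Hn).
    rewrite Cmod_div, Cmod_pow, Cmod_R by (apply Cpow_nz; exact Hn).
    rewrite (Rabs_pos_eq X), (Rabs_pos_eq (X ^ 2)), (Rabs_pos_eq 2) in * by nra.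
    pose proof (Hi 1%nat) as H1. pose proof (Hi 2%nat) as H2. pose proof (Hi 3%nat) as H3.
    pose proof (Hp 1%nat) as P1. pose proof (Hp 2%nat) as P2. pose proof (Hp 3%nat) as P3.
    rewrite !pow_1 in *. unfold Rdiv in *.
    assert (X <= X ^ 2) by nra. assert (1 <= X ^ 2) by nra.
    assert (X ^ 2 * / Cmod v <= X ^ 2 * / a) by (apply Rmult_le_compat_l; lra).
    assert (2 * X * / Cmod v ^ 2 <= 2 * X ^ 2 * / a ^ 2).
    { apply Rle_trans with (2 * X * / a ^ 2); [apply Rmult_le_compat_l; lra|].
      apply Rmult_le_compat_r; lra. }
    assert (2 * / Cmod v ^ 3 <= 2 * X ^ 2 * / a ^ 3).
    { apply Rle_trans with (2 * / a ^ 3); [apply Rmult_le_compat_l; lra|].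
      apply Rmult_le_compat_r; lra. }
    lra. }
  assert (Ee : exp (- (Re v * X - Im v * 0)) <= 27 / (a * X) ^ 3).
  { eapply Rle_trans; [|apply exp_neg_le_inv; nra]. apply exp_le. nra. }
  apply Rle_trans with (27 / (a * X) ^ 3 * (X ^ 2 * (/ a + 2 / a ^ 2 + 2 / a ^ 3))).
  - apply Rmult_le_compat; [left; apply exp_pos | apply Cmod_ge_0 | exact Ee | exact B].
  - right. field. lra.
Qed.

Definition step_integrand (w : C) (x : R) : C :=
  (Cexp (- (w * RtoC x)) * RtoC (step_kernel x / x ^ 2))%C.

(** A primitive in X of [step_integrand w] that replaces Fubini's theorem: the x-integration is
    already done inside [incgamma], and the identity is recovered by differentiating under the
    u-integral. *)
Definition step_prim (w : C) (X : R) : C :=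
  CInt (fun u => RtoC (em_kernel u) * incgamma (w + RtoC u) X)%C 0 1.

Lemma is_CInt_scal_RtoC (c : C) (f : R -> R) (a b l : R) :
  is_RInt f a b l -> is_CInt (fun t => c * RtoC (f t))%C a b (c * RtoC l)%C.
Proof.
  intros H. apply is_CInt_pair. rewrite re_scal_r, im_scal_r. split.
  - apply (is_RInt_ext (fun t => scal (Re c) (f t))).
    { intros t _. now rewrite re_scal_r. }
    apply (is_RInt_scal (V := R_NormedModule)); exact H.
  - apply (is_RInt_ext (fun t => scal (Im c) (f t))).
    { intros t _. now rewrite im_scal_r. }
    apply (is_RInt_scal (V := R_NormedModule)); exact H.
Qed.

Lemma CD_em_kernel (u : R) : exists l, CD (fun t => RtoC (em_kernel t)) u l.
Proof.
  eexists. apply CD_RtoC. unfold em_kernel. auto_derive; [trivial | reflexivity].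
Qed.

Lemma step_prim_integrable (w : C) (X : R) : 0 < Re w ->
  is_CInt (fun u => RtoC (em_kernel u) * incgamma (w + RtoC u) X)%C 0 1 (step_prim w X).
Proof.
  intros Hw. apply CInt_correct; [lra|]. intros u Hu.
  destruct (CD_em_kernel u) as [l1 H1].
  destruct (incgamma_CD_shift w u X) as [l2 H2].
  { apply Re_pos_neq_0, Re_plus_R_pos; lra. }
  eapply CD_continuous. apply CD_mult; eassumption.
Qed.

Lemma em_kernel_continuity_2d (w : C) (trig : R -> R) (x t : R) :
  (forall y, continuity_pt trig y) ->
  continuity_2d_pt (fun u v => em_kernel v * (u ^ 2 * (exp (- ((Re w + v) * u)) * trig (- (Im w * u))))) x t.
Proof.
  intros Ht.
  assert (Pu : continuity_2d_pt (fun u v => u ^ 2) x t).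
  { apply (continuity_1d_2d_pt_comp (fun y => y ^ 2) (fun u v => u)); [|apply continuity_2d_pt_id1].
    apply derivable_continuous_pt, derivable_pt_pow. }
  assert (Pv : continuity_2d_pt (fun u v => em_kernel v) x t).
  { apply (continuity_1d_2d_pt_comp em_kernel (fun u v => v)); [|apply continuity_2d_pt_id2].
    apply continuity_pt_filterlim. apply (ex_derive_continuous (V := R_NormedModule)).
    unfold em_kernel. auto_derive. trivial. }
  apply continuity_2d_pt_mult; [exact Pv|]. apply continuity_2d_pt_mult; [exact Pu|].
  apply continuity_2d_pt_mult.
  - apply (continuity_1d_2d_pt_comp exp (fun u v => - ((Re w + v) * u))).
    + apply derivable_continuous_pt, derivable_pt_exp.
    + apply continuity_2d_pt_opp, continuity_2d_pt_mult; [|apply continuity_2d_pt_id1].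
      apply continuity_2d_pt_plus; [apply continuity_2d_pt_const | apply continuity_2d_pt_id2].
  - apply (continuity_1d_2d_pt_comp trig (fun u v => - (Im w * u))); [apply Ht|].
    apply continuity_2d_pt_opp, continuity_2d_pt_mult;
      [apply continuity_2d_pt_const | apply continuity_2d_pt_id1].
Qed.

Lemma Re_Cexp (z : C) : Re (Cexp z) = exp (Re z) * cos (Im z).
Proof. reflexivity. Qed.

Lemma Im_Cexp (z : C) : Im (Cexp z) = exp (Re z) * sin (Im z).
Proof. reflexivity. Qed.

(** Real and imaginary parts are treated together: [pr] stands for [Re] or [Im], and [trig] for the
    matching [cos] or [sin]. *)
Lemma is_derive_RInt_kernel (w : C) (pr : C -> R) (trig : R -> R) (X l : R) :
  0 < Re w -> (forall y, continuity_pt trig y) ->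
  (forall (f : R -> C) a b m, is_CInt f a b m -> is_RInt (fun t => pr (f t)) a b (pr m)) ->
  (forall f t m, CD f t m -> is_derive (fun s => pr (f s)) t (pr m)) ->
  (forall r z, pr (RtoC r * z)%C = r * pr z) ->
  (forall z, pr (Cexp z) = exp (Re z) * trig (Im z)) ->
  is_RInt (fun u => em_kernel u * (X ^ 2 * (exp (- ((Re w + u) * X)) * trig (- (Im w * X))))) 0 1 l ->
  is_derive (fun x => pr (step_prim w x)) X l.
Proof.
  intros Hw Ht HI HD Hs He Hl.
  set (f := fun x u => pr (RtoC (em_kernel u) * incgamma (w + RtoC u) x)%C).
  assert (Df : forall x u, - Re w < u ->
    is_derive (fun s => f s u) x
      (em_kernel u * (x ^ 2 * (exp (- ((Re w + u) * x)) * trig (- (Im w * x)))))).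
  { intros x u Hu. unfold f.
    replace (em_kernel u * (x ^ 2 * (exp (- ((Re w + u) * x)) * trig (- (Im w * x)))))
      with (pr (0 * incgamma (w + RtoC u) x +
        RtoC (em_kernel u) * (RtoC (x ^ 2) * Cexp (- ((w + RtoC u) * RtoC x))))%C).
    - apply (HD (fun s => RtoC (em_kernel u) * incgamma (w + RtoC u) s)%C).
      apply (CD_mult (fun _ => RtoC (em_kernel u)) (incgamma (w + RtoC u)));
        [apply CD_const|]. apply incgamma_CD.
      apply Re_pos_neq_0. reim. lra.
    - rewrite Cmult_0_l, Cplus_0_l, !Hs, He. reim. reim.
      replace (- ((Re w + u) * x - (Im w + 0) * 0)) with (- ((Re w + u) * x)) by ring.
      replace (- ((Re w + u) * 0 + (Im w + 0) * x)) with (- (Im w * x)) by ring. reflexivity. }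
  apply is_derive_ext with (fun x => RInt (fun u => f x u) 0 1).
  { intros x. apply (is_RInt_unique (V := R_CompleteNormedModule)).
    apply HI. now apply step_prim_integrable. }
  replace l with (RInt (fun u => Derive (fun s => f s u) X) 0 1).
  2:{ apply (is_RInt_unique (V := R_CompleteNormedModule)).
      eapply is_RInt_ext; [|exact Hl]. rewrite Rmin_left, Rmax_right by lra.
      intros u Hu. symmetry. apply is_derive_unique, Df. lra. }
  apply is_derive_RInt_param.
  - apply filter_forall. intros x u. rewrite Rmin_left, Rmax_right by lra. intros Hu.
    eexists. apply Df. lra.
  - intros u. rewrite Rmin_left, Rmax_right by lra. intros Hu.
    eapply continuity_2d_pt_ext_loc; [|apply (em_kernel_continuity_2d w trig); exact Ht].
    (* A neighbourhood of u in [0, 1] may leave that interval; within distance Re w the real part of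
       w + v is still positive. *)
    exists (mkposreal _ Hw). simpl. intros x v _ Hv. symmetry. apply is_derive_unique, Df.
    apply Rabs_lt_between in Hv. lra.
  - apply filter_forall. intros x. eexists. apply HI. now apply step_prim_integrable.
Qed.

Lemma step_prim_CD (w : C) (X : R) : 0 < Re w -> 0 < X ->
  CD (step_prim w) X (step_integrand w X).
Proof.
  intros Hw HX.
  assert (H : is_CInt (fun u => RtoC (X ^ 2) * Cexp (- (w * RtoC X)) * RtoC (em_kernel u * exp (- (u * X))))%C
    0 1 (RtoC (X ^ 2) * Cexp (- (w * RtoC X)) * RtoC (step_kernel X / X ^ 4))%C).
  { apply is_CInt_scal_RtoC. now apply em_kernel_laplace. }
  replace (RtoC (X ^ 2) * Cexp (- (w * RtoC X)) * RtoC (step_kernel X / X ^ 4))%C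
    with (step_integrand w X) in H.
  2:{ unfold step_integrand. rewrite !RtoC_div by (apply pow_nonzero; lra).
      rewrite !RtoC_pow. field. apply RtoC_neq_0; lra. }
  apply is_CInt_pair in H. destruct H as [H1 H2]. split.
  - apply (is_derive_RInt_kernel w Re cos); trivial.
    + apply continuity_cos.
    + intros f a b m Hm. exact (proj1 (proj1 (is_CInt_pair f a b m) Hm)).
    + intros f t m Hm. apply Hm.
    + intros r z. apply re_scal_l.
    + eapply is_RInt_ext; [|exact H1]. intros u _. cbn beta.
      rewrite re_scal_r, re_scal_l, Re_Cexp. reim.
      replace (- (Re w * X - Im w * 0)) with (- (Re w * X)) by ring.
      replace (- (Re w * 0 + Im w * X)) with (- (Im w * X)) by ring.
      replace (- ((Re w + u) * X)) with (- (Re w * X) + - (u * X)) by ring.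
      rewrite exp_plus. lazymatch goal with |- @eq _ ?a ?b => change (@eq R a b) end. ring.
  - apply (is_derive_RInt_kernel w Im sin); trivial.
    + apply continuity_sin.
    + intros f a b m Hm. exact (proj2 (proj1 (is_CInt_pair f a b m) Hm)).
    + intros f t m Hm. apply Hm.
    + intros r z. apply im_scal_l.
    + eapply is_RInt_ext; [|exact H2]. intros u _. cbn beta.
      rewrite im_scal_r, im_scal_l, Im_Cexp. reim.
      replace (- (Re w * X - Im w * 0)) with (- (Re w * X)) by ring.
      replace (- (Re w * 0 + Im w * X)) with (- (Im w * X)) by ring.
      replace (- ((Re w + u) * X)) with (- (Re w * X) + - (u * X)) by ring.
      rewrite exp_plus. lazymatch goal with |- @eq _ ?a ?b => change (@eq R a b) end. ring.
Qed.

Lemma step_kernel_ex_derive (x : R) : 0 < x -> ex_derive (fun t => step_kernel t / t ^ 2) x.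
Proof. intros Hx. unfold step_kernel. auto_derive. repeat split; try lra; nra. Qed.

Lemma step_integrand_continuous (w : C) (x : R) : 0 < x ->
  continuous (U := C_UniformSpace) (step_integrand w) x.
Proof.
  intros Hx. destruct (step_kernel_ex_derive x Hx) as [l Hl].
  eapply CD_continuous. unfold step_integrand. apply CD_mult.
  - cd_rules.
  - apply CD_RtoC. exact Hl.
Qed.

(** [step_prim w] tends to 0 at 0, as [incgamma] does. At infinity [incgamma v] tends to 2/v^3,
    which turns [step_prim w] into the integral for [bstep w]. *)
Lemma step_integral (w : C) : 0 < Re w -> is_CInt_gen (step_integrand w) (bstep w).
Proof.
  intros Hw. apply is_CInt_gen_eps. intros eps He.
  destruct (incgamma_large (Re w) Hw) as [K HK].
  exists (Rmin 1 eps), (Rmax 1 (Rabs K / eps)). split; [apply Rmin_pos; lra|].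
  intros a b Ha Hb.
  pose proof (Rmin_l 1 eps). pose proof (Rmin_r 1 eps).
  pose proof (Rmax_l 1 (Rabs K / eps)). pose proof (Rmax_r 1 (Rabs K / eps)).
  exists (step_prim w b - step_prim w a)%C. split.
  - apply is_CInt_derive; [lra| |]; intros t Ht.
    + apply step_prim_CD; lra.
    + apply step_integrand_continuous. lra.
  - assert (E1 : Cmod (step_prim w a) <= (1 - 0) * (/ 24 * a)).
    { eapply Cmod_CInt_le_const; [lra| |now apply step_prim_integrable].
      intros u Hu. cbn beta. rewrite Cmod_mult, Cmod_R.
      apply Rmult_le_compat; [apply Rabs_pos | apply Cmod_ge_0 | now apply em_kernel_bound|].
      apply incgamma_small; [apply Re_plus_R_pos; lra | lra]. }
    assert (E2 : Cmod (step_prim w b - bstep w)%C <= (1 - 0) * (/ 24 * (Rabs K / b))).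
    { eapply Cmod_CInt_le_const; [lra| |
        apply is_CInt_minus; [now apply step_prim_integrable | now apply bstep_integral]].
      intros u Hu. cbn beta.
      replace (RtoC (em_kernel u) * incgamma (w + RtoC u) b - RtoC (2 * em_kernel u) / (w + RtoC u) ^ 3)%C
        with (RtoC (em_kernel u) * (incgamma (w + RtoC u) b - 2 / (w + RtoC u) ^ 3))%C.
      2:{ rewrite RtoC_mult. field. apply Re_pos_neq_0, Re_plus_R_pos; lra. }
      rewrite Cmod_mult, Cmod_R.
      apply Rmult_le_compat; [apply Rabs_pos | apply Cmod_ge_0 | now apply em_kernel_bound|].
      eapply Rle_trans; [apply HK; [reim; lra | lra]|].
      apply Rmult_le_compat_r; [left; apply Rinv_0_lt_compat; lra | apply Rle_abs]. }
    assert (E3 : Rabs K / b <= eps).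
    { apply Rmult_le_reg_r with (b / eps); [apply Rdiv_lt_0_compat; lra|].
      replace (Rabs K / b * (b / eps)) with (Rabs K / eps) by (field; lra).
      replace (eps * (b / eps)) with b by (field; lra). lra. }
    replace (step_prim w b - step_prim w a - bstep w)%C
      with ((step_prim w b - bstep w) - step_prim w a)%C by ring.
    eapply Rle_lt_trans; [apply Cmod_triangle_sub|]. lra.
Qed.

(** * Summation of the steps *)

Lemma binet_integrand_eq (z : C) (x : R) : 0 < x ->
  binet_integrand z x = (Cexp (- (z * RtoC x)) * RtoC (binet_kernel x / x ^ 2))%C.
Proof.
  intros Hx. unfold binet_integrand. fold (binet_kernel x).
  rewrite RtoC_div by (apply pow_nonzero; lra). field.
  apply RtoC_neq_0, pow_nonzero. lra.
Qed.

Lemma binet_integrand_continuous (z : C) (x : R) : 0 < x ->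
  continuous (U := C_UniformSpace) (binet_integrand z) x.
Proof.
  intros Hx. pose proof (one_minus_exp_pos x Hx).
  assert (D : ex_derive (fun t => 1 / (1 - exp (- t)) - 1 / t - 1 / 2 - t / 12) x).
  { auto_derive. repeat split; lra. }
  destruct D as [l Hl].
  eapply CD_continuous. unfold binet_integrand. apply CD_mult.
  - apply CD_mult; [cd_rules|]. apply CD_Cinv; [apply RtoC_neq_0, pow_nonzero; lra | cd_rules].
  - apply CD_RtoC. exact Hl.
Qed.

Lemma binet_integrand_step (z : C) (x : R) : 0 < x ->
  binet_integrand z x = (step_integrand z x + binet_integrand (z + 1) x)%C.
Proof.
  intros Hx. rewrite !binet_integrand_eq by exact Hx. unfold step_integrand.
  rewrite <- binet_kernel_step by exact Hx.
  replace (- ((z + 1) * RtoC x))%C with (- (z * RtoC x) + - RtoC x)%C by ring.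
  rewrite Cexp_plus, <- RtoC_opp, Cexp_RtoC.
  replace ((1 - exp (- x)) * binet_kernel x / x ^ 2)
    with ((1 - exp (- x)) * (binet_kernel x / x ^ 2)) by (unfold Rdiv; ring).
  rewrite RtoC_mult, RtoC_minus. ring.
Qed.

Lemma binet_integrand_sum (z : C) (n : nat) (x : R) : 0 < x ->
  binet_integrand z x =
  (Cpsum (fun k => step_integrand (z + RtoC (INR k)) x) n
   + binet_integrand (z + RtoC (INR n)) x)%C.
Proof.
  intros Hx. induction n.
  - simpl. rewrite Cplus_0_l, Cplus_0_r. reflexivity.
  - rewrite IHn. cbn [Cpsum]. rewrite (binet_integrand_step (z + RtoC (INR n))) by exact Hx.
    rewrite S_INR, RtoC_plus, !Cplus_assoc. reflexivity.
Qed.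

Lemma step_integral_sum (z : C) (n : nat) : 0 < Re z ->
  is_CInt_gen (fun x => Cpsum (fun k => step_integrand (z + RtoC (INR k)) x) n)
    (Cpsum (fun k => bstep (z + RtoC (INR k))%C) n).
Proof.
  intros Hz. induction n.
  - apply is_CInt_gen_eps. intros eps He. exists 1, 1. split; [lra|]. intros a b _ _.
    exists (RtoC 0). split.
    + apply is_CInt_pair. cbn [Cpsum]. change (Re (RtoC 0)) with 0. change (Im (RtoC 0)) with 0.
      assert (H : is_RInt (V := R_NormedModule) (fun _ => 0) a b 0).
      { pose proof (is_RInt_const (V := R_NormedModule) a b 0) as H.
        change (is_RInt (V := R_NormedModule) (fun _ => 0) a b ((b - a) * 0)) in H.
        now rewrite Rmult_0_r in H. }
      now split.
    + cbn [Cpsum]. replace (0 - 0)%C with (RtoC 0) by ring. rewrite Cmod_0. exact He.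
  - cbn [Cpsum]. apply (is_RInt_gen_plus (V := C_R_NormedModule)); [exact IHn|].
    apply step_integral. apply Re_plus_R_pos; [exact Hz | apply pos_INR].
Qed.

Lemma is_CInt_gen_eps_inv (f : R -> C) (l : C) : is_CInt_gen f l ->
  forall eps, 0 < eps -> exists d M, 0 < d /\ forall a b, 0 < a < d -> M < b ->
     exists y, is_CInt f a b y /\ Cmod (y - l)%C < eps.
Proof.
  intros H eps He.
  assert (He2 : 0 < eps / 2) by lra.
  destruct (H _ (locally_ball (T := C_UniformSpace) l (mkposreal _ He2))) as [P Q [d Hd] [M HM] HPQ].
  exists d, M. split; [apply cond_pos|]. intros a b Ha Hb.
  destruct (HPQ a b) as (y & Hy & B1 & B2).
  - apply Hd; [|lra]. unfold ball; simpl; unfold AbsRing_ball, abs, minus, plus, opp; simpl.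
    apply Rabs_lt_between. lra.
  - now apply HM.
  - exists y. split; [exact Hy|].
    eapply Rle_lt_trans; [apply Cmod_le_abs|]. reim.
    unfold ball in B1, B2; simpl in B1, B2; unfold AbsRing_ball, abs, minus, plus, opp in B1, B2;
      simpl in B1, B2. unfold Re, Im, Rminus. lra.
Qed.

(** The bound is independent of the interval [s, t], so the remainder after n steps is small before
    the improper limits are taken. *)
Lemma binet_tail (a : R) : 0 < a -> exists K, 0 < K /\ forall z n s t y,
  a <= Re z -> 0 < s <= t -> is_CInt (binet_integrand (z + RtoC (INR n))) s t y ->
  Cmod y <= K / (INR n + a / 2).
Proof.
  (* The factors x and 1 + x of the kernel bound are each absorbed by e^(ax/4), which leaves the
     decay rate n + a/2. *)
  intros Ha. set (c := a / 4). assert (Hc : 0 < c) by (unfold c; lra).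
  set (K := / c * (1 + / c) / 24).
  assert (Hic : 0 < / c) by now apply Rinv_0_lt_compat.
  assert (HK : 0 < K) by (unfold K; apply Rdiv_lt_0_compat; [nra | lra]).
  exists K. split; [exact HK|]. intros z n s t y Hz Hst Hy.
  pose proof (pos_INR n) as Hn. set (m := INR n + a / 2). assert (Hm : 0 < m) by (unfold m; lra).
  assert (HI : is_RInt (fun x => K * exp (- (m * x))) s t (K / m * (exp (- (m * s)) - exp (- (m * t))))).
  { replace (K / m * (exp (- (m * s)) - exp (- (m * t))))
      with (- (K / m) * exp (- (m * t)) - - (K / m) * exp (- (m * s))) by ring.
    apply (is_RInt_derive (V := R_CompleteNormedModule) (fun x => - (K / m) * exp (- (m * x)))).
    - intros x _. auto_derive; [trivial|]. field. lra.
    - intros x _. apply (ex_derive_continuous (V := R_NormedModule)). auto_derive. trivial. }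
  eapply Rle_trans.
  - eapply Cmod_CInt_le; [| |exact Hy|exact HI]; [lra|].
    intros x Hx. rewrite binet_integrand_eq by lra.
    rewrite Cmod_mult, Cmod_Cexp, Cmod_R. reim.
    pose proof (binet_kernel_bound x ltac:(lra)) as HB.
    assert (E1 : x <= / c * exp (c * x)).
    { apply Rmult_le_reg_l with c; [exact Hc|]. rewrite <- Rmult_assoc, Rinv_r by lra.
      generalize (exp_ineq1_le (c * x)). lra. }
    assert (E2 : 1 + x <= (1 + / c) * exp (c * x)).
    { assert (1 <= exp (c * x)) by (rewrite <- exp_0; apply exp_le; nra). lra. }
    assert (E3 : x * (1 + x) / 24 <= K * exp (a / 2 * x)).
    { replace (a / 2 * x) with (c * x + c * x) by (unfold c; field).
      rewrite exp_plus. unfold K.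
      assert (x * (1 + x) <= (/ c * exp (c * x)) * ((1 + / c) * exp (c * x)))
        by (apply Rmult_le_compat; lra). lra. }
    replace (- (m * x)) with (a / 2 * x + - ((a + INR n) * x)) by (unfold m; field).
    rewrite exp_plus.
    assert (E4 : exp (- ((Re z + INR n) * x - (Im z + 0) * 0)) <= exp (- ((a + INR n) * x))).
    { apply exp_le. assert (a * x <= Re z * x) by (apply Rmult_le_compat_r; lra). lra. }
    rewrite <- Rmult_assoc, (Rmult_comm (exp (- ((Re z + INR n) * x - (Im z + 0) * 0)))).
    apply Rmult_le_compat; [apply Rabs_pos | left; apply exp_pos | lra | exact E4].
  - assert (exp (- (m * s)) <= 1) by (rewrite <- exp_0; apply exp_le; nra).
    pose proof (exp_pos (- (m * t))).
    assert (0 < K / m) by (apply Rdiv_lt_0_compat; lra). nra.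
Qed.

(** First n is fixed, by the uniform tail bound and the convergence of [Bsum z]; only then are the
    end points chosen, for a finite sum of step integrals. Sum and integral are thus exchanged
    without a dominated convergence theorem. *)
Lemma binet_integral (z : C) : 0 < Re z -> is_CInt_gen (binet_integrand z) (Bsum z).
Proof.
  intros Hz. apply is_CInt_gen_continuous.
  { intros x Hx. now apply binet_integrand_continuous. }
  intros eps He.
  destruct (binet_tail (Re z) Hz) as (K & HK & HT).
  pose proof (Bsum_lim z Hz) as HL. rewrite Clim_eps in HL.
  destruct (HL (eps / 3) ltac:(lra)) as [N1 HN1].
  destruct (INR_unbounded (3 * K / eps)) as [N2 HN2].
  set (n := (N1 + N2)%nat).
  destruct (is_CInt_gen_eps_inv _ _ (step_integral_sum z n Hz) (eps / 3) ltac:(lra))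
    as (d & M & Hd & HS).
  exists d, M. split; [exact Hd|]. intros a b y Ha Hb Hab Hy.
  destruct (HS a b Ha Hb) as (y1 & Hy1 & Hl).
  assert (HR : is_CInt (binet_integrand (z + RtoC (INR n))) a b (y - y1)%C).
  { eapply is_RInt_ext; [|apply (is_CInt_minus _ _ _ _ _ _ Hy Hy1)].
    rewrite Rmin_left, Rmax_right by lra. intros x Hx. cbn beta.
    rewrite (binet_integrand_sum z n x) by lra.
    set (A := Cpsum _ _). set (B := binet_integrand _ _).
    change ((A + B - A)%C = B). ring. }
  pose proof (HT z n a b _ (Rle_refl _) ltac:(lra) HR) as H1.
  specialize (HN1 n ltac:(unfold n; lia)).
  assert (H2 : K / (INR n + Re z / 2) < eps / 3).
  { assert (INR N2 <= INR n) by (apply le_INR; unfold n; lia).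
    pose proof (pos_INR n).
    apply Rmult_lt_reg_r with ((INR n + Re z / 2) * 3 / eps).
    - apply Rdiv_lt_0_compat; lra.
    - replace (K / (INR n + Re z / 2) * ((INR n + Re z / 2) * 3 / eps)) with (3 * K / eps) by (field; lra).
      replace (eps / 3 * ((INR n + Re z / 2) * 3 / eps)) with (INR n + Re z / 2) by (field; lra). lra. }
  set (P := Cpsum (fun k => bstep (z + RtoC (INR k))%C) n) in *.
  replace (y - Bsum z)%C with ((y - y1) + ((y1 - P) + (P - Bsum z)))%C by ring.
  eapply Rle_lt_trans; [apply Cmod_triangle|].
  generalize (Cmod_triangle (y1 - P)%C (P - Bsum z)%C). lra.
Qed.

(** * Euler-Maclaurin continuation of the zeta function *)

Definition zeta_kernel (n : nat) (s : C) (u : R) : C :=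
  (RtoC (em_kernel u) * Rcpow (INR n + 1 + u) (- s - 4))%C.

Definition zeta_step (n : nat) (s : C) : C := CInt (zeta_kernel n s) 0 1.

Definition zeta_rem (s : C) : C := Csum (fun n => zeta_step n s).

Definition rising4 (s : C) : C := (s * (s + 1) * (s + 2) * (s + 3))%C.

Lemma node_ge_1 (n : nat) (u : R) : 0 <= u -> 1 <= INR n + 1 + u.
Proof. generalize (pos_INR n). lra. Qed.

Lemma CD_Rcpow_shift (y : R) (s : C) (u : R) : 0 < y + u ->
  CD (fun t => Rcpow (y + t) s) u (s * Rcpow (y + u) (s - 1))%C.
Proof.
  intros H. eapply CD_eq; [|apply (CD_comp (fun v => Rcpow v s) (fun t => y + t) u 1)].
  - apply Cmult_1_l.
  - now apply CD_Rcpow.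
  - auto_derive; [trivial | ring].
Qed.

Lemma zeta_kernel_continuous (n : nat) (s : C) (u : R) : 0 <= u ->
  continuous (U := C_UniformSpace) (zeta_kernel n s) u.
Proof.
  intros Hu. destruct (CD_em_kernel u) as [l Hl]. pose proof (node_ge_1 n u Hu).
  eapply CD_continuous. unfold zeta_kernel. apply CD_mult; [exact Hl|].
  apply CD_Rcpow_shift. lra.
Qed.

Lemma zeta_step_correct (n : nat) (s : C) : is_CInt (zeta_kernel n s) 0 1 (zeta_step n s).
Proof.
  apply CInt_correct; [lra|]. intros u Hu. apply zeta_kernel_continuous. lra.
Qed.

Lemma is_CInt_mult_l (c : C) (f : R -> C) (a b : R) (l : C) :
  is_CInt f a b l -> is_CInt (fun t => c * f t)%C a b (c * l)%C.
Proof.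
  rewrite !is_CInt_pair. intros [H1 H2]. split.
  - apply (is_RInt_ext (fun t => minus (scal (Re c) (Re (f t))) (scal (Im c) (Im (f t))))).
    { reflexivity. }
    apply (is_RInt_minus (V := R_NormedModule));
      apply (is_RInt_scal (V := R_NormedModule)); assumption.
  - apply (is_RInt_ext (fun t => plus (scal (Re c) (Im (f t))) (scal (Im c) (Re (f t))))).
    { reflexivity. }
    apply (is_RInt_plus (V := R_NormedModule));
      apply (is_RInt_scal (V := R_NormedModule)); assumption.
Qed.

(* Four integrations by parts: the fourth derivative of the kernel is -1. *)
Lemma zeta_step_eq (n : nat) (s : C) : (1 - s)%C <> 0%C ->
  (rising4 s * zeta_step n s =
   s / 12 * (Rcpow (INR (S n) + 1) (- s - 1) - Rcpow (INR n + 1) (- s - 1))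
   + (Rcpow (INR n + 1) (- s) + Rcpow (INR (S n) + 1) (- s)) / 2
   - (Rcpow (INR (S n) + 1) (1 - s) - Rcpow (INR n + 1) (1 - s)) / (1 - s))%C.
Proof.
  intros Hs.
  set (P := fun (k : C) (u : R) => Rcpow (INR n + 1 + u) (k - s)%C).
  set (G := fun u : R =>
    (RtoC (- (u ^ 2 * (1 - u) ^ 2 / 24)) * (- (s * (s + 1) * (s + 2)) * P (-3) u)
     - RtoC (- (2 * u - 6 * u ^ 2 + 4 * u ^ 3) / 24) * (s * (s + 1) * P (-2) u)
     + RtoC (- (1 - 6 * u + 6 * u ^ 2) / 12) * (- s * P (-1) u)
     - RtoC ((1 - 2 * u) / 2) * P 0 u - P 1 u / (1 - s))%C).
  assert (DP : forall k u, 0 <= u -> CD (P k) u ((k - s) * P (k - 1) u)%C).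
  { intros k u Hu. pose proof (node_ge_1 n u Hu). unfold P.
    eapply CD_eq; [|apply CD_Rcpow_shift; lra]. do 2 f_equal. ring. }
  assert (H : is_CInt (fun u => rising4 s * zeta_kernel n s u)%C 0 1 (G 1 - G 0)%C).
  { apply is_CInt_derive; [lra| |].
    - intros u [Hu _]. unfold G. eapply CD_eq.
      2:{ cd_rules; apply DP; exact Hu. }
      cbn beta. unfold zeta_kernel, rising4, em_kernel.
      replace (- s - 4)%C with (-4 - s)%C by ring. fold (P (-4) u).
      replace (-3 - 1)%C with (RtoC (-4)) by (rewrite <- RtoC_minus; f_equal; ring).
      replace (-2 - 1)%C with (RtoC (-3)) by (rewrite <- RtoC_minus; f_equal; ring).
      replace (-1 - 1)%C with (RtoC (-2)) by (rewrite <- RtoC_minus; f_equal; ring).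
      replace (0 - 1)%C with (RtoC (-1)) by (rewrite <- RtoC_minus; f_equal; ring).
      replace (1 - 1)%C with (RtoC 0) by ring.
      rtoc. field. exact Hs.
    - intros u [Hu _]. pose proof (node_ge_1 n u Hu). destruct (CD_em_kernel u) as [l Hl].
      eapply CD_continuous. apply CD_mult; [apply CD_const|]. unfold zeta_kernel.
      apply CD_mult; [exact Hl | apply CD_Rcpow_shift; lra]. }
  pose proof (is_CInt_mult_l (rising4 s) _ _ _ _ (zeta_step_correct n s)) as H2.
  rewrite <- (CInt_unique _ _ _ _ H2), (CInt_unique _ _ _ _ H).
  unfold G, P. rewrite Rplus_0_r, S_INR.
  replace (-1 - s)%C with (- s - 1)%C by ring. replace (0 - s)%C with (- s)%C by ring.
  rtoc. field. exact Hs.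
Qed.

(** Telescoping: 1/(s - 1) + 1/2 + s/12 comes from the boundary terms at the node 1, and the powers
    of N + 1 from those at the last node. *)
Lemma Cpsum_zeta (N : nat) (s : C) : (1 - s)%C <> 0%C ->
  Cpsum (fun n => Rcpow (INR (S n)) (- s)) (S N) =
  (rising4 s * Cpsum (fun n => zeta_step n s) N + 1 / (s - 1) + 1 / 2 + s / 12
   - s / 12 * Rcpow (INR (S N)) (- s - 1) + Rcpow (INR (S N)) (- s) / 2
   + Rcpow (INR (S N)) (1 - s) / (1 - s))%C.
Proof.
  intros Hs.
  assert (Hs' : (s - 1)%C <> 0%C).
  { intros E. apply Hs. replace (1 - s)%C with (- (s - 1))%C by ring. rewrite E. ring. }
  induction N.
  - assert (E : forall k, Rcpow (INR 1) k = 1%C).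
    { intros k. unfold Rcpow. simpl. now rewrite ln_1, Cmult_0_r, Cexp_0. }
    cbn [Cpsum]. rewrite !E. field. now split.
  - change (Cpsum (fun n => Rcpow (INR (S n)) (- s)) (S (S N)))
      with (Cpsum (fun n => Rcpow (INR (S n)) (- s)) (S N) + Rcpow (INR (S (S N))) (- s))%C.
    rewrite IHN. cbn [Cpsum].
    rewrite Cmult_plus_distr_l, zeta_step_eq by exact Hs.
    rewrite <- !S_INR. field. now split.
Qed.

(** The remainder converges already for Re s >= -2. This margin allows discs of radius 1/2 about
    points with Re s >= -1. *)
Lemma Rcpow_decay (s : C) (v : R) : -2 <= Re s -> 1 <= v ->
  Cmod (Rcpow v (- s - 4)) <= / v ^ 2.
Proof.
  intros Hs Hv. rewrite Cmod_Rcpow.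
  replace (/ v ^ 2) with (exp (- 2 * ln v)).
  - apply exp_le. assert (0 <= ln v) by (rewrite <- ln_1; apply ln_le; lra).
    rewrite Re_minus, Re_opp. change (Re (RtoC 4)) with 4. nra.
  - replace (- 2 * ln v) with (- (ln v + ln v)) by ring.
    rewrite exp_Ropp, exp_plus, exp_ln by lra. f_equal. ring.
Qed.

Lemma inv_node_sqr (n : nat) (u : R) : 0 <= u -> / (INR n + 1 + u) ^ 2 <= / (INR n + 1) ^ 2.
Proof.
  intros Hu. pose proof (pos_INR n). apply Rinv_le_contravar; [apply pow_lt; lra|].
  apply pow_incr. lra.
Qed.

Lemma zeta_step_bound (n : nat) (s : C) : -2 <= Re s ->
  Cmod (zeta_step n s) <= 1 / (INR n + 1) ^ 2.
Proof.
  intros Hs. replace (1 / (INR n + 1) ^ 2) with ((1 - 0) * / (INR n + 1) ^ 2) by (unfold Rdiv; ring).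
  eapply Cmod_CInt_le_const; [lra| |apply zeta_step_correct].
  intros u Hu. unfold zeta_kernel. rewrite Cmod_mult, Cmod_R.
  pose proof (em_kernel_bound u Hu). pose proof (Rabs_pos (em_kernel u)).
  pose proof (Rcpow_decay s _ Hs (node_ge_1 n u (proj1 Hu))).
  pose proof (inv_node_sqr n u (proj1 Hu)).
  pose proof (Cmod_ge_0 (Rcpow (INR n + 1 + u) (- s - 4))). nra.
Qed.

Lemma zeta_rem_lim (s : C) : -2 <= Re s ->
  Clim (Cpsum (fun n => zeta_step n s)) (zeta_rem s).
Proof. intros Hs. apply Csum_inv_sqr with 1. intros n. now apply zeta_step_bound. Qed.

Lemma Rcpow_lim_0 (s : C) : Re s < 0 -> Clim (fun n => Rcpow (INR (S n)) s) 0%C.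
Proof.
  intros Hs. apply Clim_Cmod.
  apply is_lim_seq_ext with (fun n => exp (Re s * ln (INR (S n)))).
  { intros n. rewrite <- Cmod_Rcpow. f_equal. ring. }
  apply (is_lim_seq_incr_1 (fun n => exp (Re s * ln (INR n)))).
  apply (filterlim_comp _ _ _ (fun n => Re s * ln (INR n)) exp _ (Rbar_locally m_infty)).
  - apply (is_lim_seq_ext (fun n => Re s * ln (INR n)) _ m_infty); [reflexivity|].
    replace m_infty with (Rbar_mult (Re s) p_infty).
    + apply is_lim_seq_scal_l.
      apply (filterlim_comp _ _ _ INR ln _ (Rbar_locally p_infty)).
      * apply is_lim_seq_INR.
      * apply is_lim_ln_p.
    + revert Hs. generalize (Re s). intros r Hr. simpl. destruct (Rle_dec 0 r); [exfalso; lra|reflexivity].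
  - apply is_lim_exp_m.
Qed.

Lemma zeta_formula (zeta : C -> C) (s : C) : is_riemann_zeta zeta -> 1 < Re s ->
  zeta s = (1 / (s - 1) + 1 / 2 + s / 12 + rising4 s * zeta_rem s)%C.
Proof.
  intros [Hz _] Hs. specialize (Hz s Hs).
  assert (Hn : (1 - s)%C <> 0%C).
  { intros E. apply (f_equal Re) in E. rewrite Re_minus in E. simpl in E. lra. }
  assert (L1 : Clim (fun N => Cpsum (fun n => Rcpow (INR (S n)) (- s)) (S N)) (zeta s)).
  { apply Clim_locally. unfold is_series in Hz.
    eapply filterlim_ext; [|exact Hz]. intros N. cbv beta.
    induction N.
    - rewrite sum_O. cbn [Cpsum]. now rewrite Cplus_0_l.
    - rewrite sum_Sn, IHN. reflexivity. }
  eapply Clim_unique; [exact L1|].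
  eapply Clim_ext. { intros N. symmetry. apply Cpsum_zeta. exact Hn. }
  replace (1 / (s - 1) + 1 / 2 + s / 12 + rising4 s * zeta_rem s)%C
    with (rising4 s * zeta_rem s + 1 / (s - 1) + 1 / 2 + s / 12 - s / 12 * 0 + 0 * / 2
          + 0 * / (1 - s))%C by ring.
  apply Clim_plus; [apply Clim_plus; [apply Clim_minus|]|].
  - do 3 (apply Clim_plus; [|apply Clim_const]).
    apply Clim_mult; [apply Clim_const|]. apply zeta_rem_lim. lra.
  - apply Clim_mult; [apply Clim_const|]. apply Rcpow_lim_0.
    rewrite Re_minus, Re_opp. simpl. lra.
  - apply Clim_mult; [|apply Clim_const]. apply Rcpow_lim_0. rewrite Re_opp. lra.
  - apply Clim_mult; [|apply Clim_const]. apply Rcpow_lim_0. rewrite Re_minus. simpl. lra.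
Qed.

(** * Power series expansion of the remainder *)

Lemma is_RInt_pow (n : nat) : is_RInt (fun t => t ^ n) 0 1 (/ INR (S n)).
Proof.
  assert (Hn : INR (S n) <> 0) by (apply not_0_INR; lia).
  replace (/ INR (S n)) with (1 ^ S n / INR (S n) - 0 ^ S n / INR (S n))
    by (rewrite pow1, pow_i by lia; field; exact Hn).
  apply (is_RInt_derive (V := R_CompleteNormedModule) (fun t => t ^ S n / INR (S n))).
  - intros t _. auto_derive; [trivial|].
    change (match n with 0%nat => 1 | S _ => INR n + 1 end) with (INR (S n)).
    simpl pred. field. exact Hn.
  - intros t _. apply (ex_derive_continuous (V := R_NormedModule)). auto_derive. trivial.
Qed.

Definition exp_rem (n : nat) (z : C) : C :=
  (Cexp z - Cpsum (fun k => z ^ k / RtoC (INR (fact k)))%C n)%C.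

Lemma exp_rem_S_CD (n : nat) (z : C) (t : R) :
  CD (fun s => exp_rem (S n) (RtoC s * z)%C) t (z * exp_rem n (RtoC t * z))%C.
Proof.
  induction n.
  - unfold exp_rem. cbn [Cpsum]. eapply CD_eq.
    2:{ apply CD_minus; [apply CD_Cexp; cd_rules|]. apply CD_plus; [apply CD_const|].
        apply CD_ext with (fun _ => (1 / RtoC (INR (fact 0)))%C); [reflexivity | apply CD_const]. }
    cbn beta. ring.
  - apply CD_ext with (fun s => exp_rem (S n) (RtoC s * z)
        - / RtoC (INR (fact (S n))) * (RtoC s * z) ^ S n)%C.
    { intros s. unfold exp_rem.
      change (Cpsum (fun k => (RtoC s * z) ^ k / RtoC (INR (fact k)))%C (S (S n)))
        with (Cpsum (fun k => (RtoC s * z) ^ k / RtoC (INR (fact k)))%C (S n)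
              + (RtoC s * z) ^ S n / RtoC (INR (fact (S n))))%C.
      unfold Cdiv. ring. }
    eapply CD_eq.
    2:{ apply CD_minus; [exact IHn|]. apply CD_mult; [apply CD_const|]. apply CD_pow. cd_rules. }
    cbn beta. simpl pred. unfold exp_rem. cbn [Cpsum].
    rewrite fact_simpl, mult_INR, RtoC_mult.
    assert (H1 : RtoC (INR (S n)) <> 0%C) by (apply RtoC_neq_0, not_0_INR; lia).
    assert (H2 : RtoC (INR (fact n)) <> 0%C) by (apply RtoC_neq_0, INR_fact_neq_0).
    field. now split.
Qed.

(** The remainder of order n + 1 vanishes at 0 and is the integral of the one of order n along the
    segment from 0 to z. *)
Lemma exp_rem_bound (n : nat) (z : C) :
  Cmod (exp_rem n z) <= Cmod z ^ n / INR (fact n) * exp (Cmod z).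
Proof.
  revert z. induction n; intros z.
  - unfold exp_rem. cbn [Cpsum]. replace (Cexp z - 0)%C with (Cexp z) by ring.
    rewrite Cmod_Cexp. simpl. unfold Rdiv. rewrite Rinv_1, !Rmult_1_l.
    apply exp_le, Re_le_Cmod.
  - assert (H : is_CInt (fun t => z * exp_rem n (RtoC t * z))%C 0 1
                  (exp_rem (S n) (RtoC 1 * z) - exp_rem (S n) (RtoC 0 * z))%C).
    { apply (is_CInt_derive (fun s => exp_rem (S n) (RtoC s * z)%C)); [lra| |].
      - intros t _. apply exp_rem_S_CD.
      (* The remainder of order 0 is [Cexp] itself, which [exp_rem_S_CD] does not cover. *)
      - intros t _. destruct n.
        + apply (CD_continuous _ t (z * (z * Cexp (RtoC t * z)))).
          unfold exp_rem. cbn [Cpsum]. eapply CD_eq.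
          2:{ apply CD_mult; [apply CD_const|]. apply CD_minus; [|apply CD_const].
              apply CD_Cexp. cd_rules. }
          cbn beta. ring.
        + eapply CD_continuous. apply CD_mult; [apply CD_const | apply exp_rem_S_CD]. }
    assert (E0 : exp_rem (S n) (RtoC 0 * z) = 0%C).
    { unfold exp_rem. rewrite Cmult_0_l, Cpsum_shift, Cexp_0.
      rewrite (Cpsum_ext _ (fun _ => RtoC 0)).
      - replace (Cpsum (fun _ => RtoC 0) n) with (RtoC 0).
        + simpl. field.
        + clear. induction n; simpl; [reflexivity | rewrite <- IHn; ring].
      - intros k. simpl. unfold Cdiv. ring. }
    rewrite E0, Cmult_1_l in H.
    replace (exp_rem (S n) z) with (exp_rem (S n) z - 0)%C by ring.
    set (K := Cmod z ^ S n / INR (fact n) * exp (Cmod z)).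
    assert (HK : is_RInt (fun t => K * t ^ n) 0 1 (K * / INR (S n))).
    { apply (is_RInt_scal (V := R_NormedModule)). apply is_RInt_pow. }
    pose proof (INR_fact_lt_0 n) as Hf. pose proof (Cmod_ge_0 z) as Hz.
    eapply Rle_trans.
    + eapply Cmod_CInt_le; [| |exact H|exact HK]; [lra|].
      intros t Ht. cbn beta. rewrite Cmod_mult.
      eapply Rle_trans; [apply Rmult_le_compat_l; [exact Hz | apply IHn]|].
      rewrite Cmod_mult, Cmod_R, Rabs_pos_eq, Rpow_mult_distr by lra.
      unfold K. rewrite <- tech_pow_Rmult.
      assert (exp (t * Cmod z) <= exp (Cmod z)) by (apply exp_le; nra).
      assert (0 <= t ^ n) by (apply pow_le; lra).
      assert (0 <= Cmod z ^ n) by (now apply pow_le).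
      assert (0 < / INR (fact n)) by (now apply Rinv_0_lt_compat).
      unfold Rdiv.
      replace (Cmod z * (t ^ n * Cmod z ^ n * / INR (fact n) * exp (t * Cmod z)))
        with ((Cmod z * Cmod z ^ n * / INR (fact n) * t ^ n) * exp (t * Cmod z)) by ring.
      replace (Cmod z * Cmod z ^ n * / INR (fact n) * exp (Cmod z) * t ^ n)
        with ((Cmod z * Cmod z ^ n * / INR (fact n) * t ^ n) * exp (Cmod z)) by ring.
      apply Rmult_le_compat_l; [|assumption].
      repeat apply Rmult_le_pos; lra.
    + unfold K. rewrite fact_simpl, mult_INR. right. field.
      split; [lra | apply not_0_INR; lia].
Qed.

Lemma pow_div_fact_le_exp (n : nat) (y : R) : 0 <= y -> y ^ n / INR (fact n) <= exp y.
Proof.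
  revert y. induction n; intros y Hy.
  - simpl. unfold Rdiv. rewrite Rinv_1, Rmult_1_l, <- exp_0. now apply exp_le.
  - pose proof (INR_fact_lt_0 n) as Hf.
    assert (Hn : INR (S n) <> 0) by (apply not_0_INR; lia).
    assert (H1 : is_RInt (fun t => t ^ n / INR (fact n)) 0 y
      (y ^ S n / INR (fact (S n)) - 0 ^ S n / INR (fact (S n)))).
    { rewrite fact_simpl, mult_INR. revert Hf. generalize (INR (fact n)). intros c Hc.
      apply (is_RInt_derive (V := R_CompleteNormedModule) (fun t => t ^ S n / (INR (S n) * c))).
      - intros t _. auto_derive; [trivial|].
        change (match n with 0%nat => 1 | S _ => INR n + 1 end) with (INR (S n)).
        simpl pred. field. lra.
      - intros t _. apply (ex_derive_continuous (V := R_NormedModule)). auto_derive. trivial. }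
    assert (H2 : is_RInt exp 0 y (exp y - exp 0)).
    { apply (is_RInt_derive (V := R_CompleteNormedModule) exp).
      - intros t _. auto_derive; [trivial|]. ring.
      - intros t _. apply (ex_derive_continuous (V := R_NormedModule)). auto_derive. trivial. }
    rewrite pow_i in H1 by lia. rewrite exp_0 in H2.
    pose proof (is_RInt_le _ _ _ _ _ _ Hy H1 H2) as H. unfold Rdiv in *.
    rewrite Rmult_0_l in H.
    enough (y ^ S n * / INR (fact (S n)) - 0 <= exp y - 1) by lra.
    apply H. intros t Ht. apply IHn. lra.
Qed.

(** The coefficient of h^k when the kernel at s + h is expanded through v^(-h) = e^(-h ln v), v
    being the node n + 1 + u. *)
Definition zeta_coef_kernel (k n : nat) (s : C) (u : R) : C :=
  (zeta_kernel n s u * RtoC ((- ln (INR n + 1 + u)) ^ k / INR (fact k)))%C.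

Definition zeta_coef_step (k n : nat) (s : C) : C := CInt (zeta_coef_kernel k n s) 0 1.

Definition zeta_coef (s : C) (k : nat) : C := Csum (fun n => zeta_coef_step k n s).

Lemma zeta_coef_step_correct (k n : nat) (s : C) :
  is_CInt (zeta_coef_kernel k n s) 0 1 (zeta_coef_step k n s).
Proof.
  apply CInt_correct; [lra|]. intros u Hu.
  destruct (CD_em_kernel u) as [l Hl]. pose proof (node_ge_1 n u (proj1 Hu)).
  eapply CD_continuous. unfold zeta_coef_kernel, zeta_kernel. apply CD_mult.
  - apply CD_mult; [exact Hl | apply CD_Rcpow_shift; lra].
  - apply CD_RtoC. auto_derive; [lra | reflexivity].
Qed.

(* With [c = 1/2], [(c ln v)^k / k! <= v^c] trades a logarithm power for half a power of v. *)
Lemma ln_pow_bound (k : nat) (v : R) : 1 <= v ->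
  ln v ^ k / INR (fact k) <= 2 ^ k * exp (ln v / 2).
Proof.
  intros Hv. assert (0 <= ln v) by (rewrite <- ln_1; apply ln_le; lra).
  pose proof (pow_div_fact_le_exp k (ln v / 2) ltac:(lra)) as H1.
  replace (ln v) with (2 * (ln v / 2)) at 1 by field.
  rewrite Rpow_mult_distr. unfold Rdiv at 1. rewrite Rmult_assoc.
  apply Rmult_le_compat_l; [apply pow_le; lra | exact H1].
Qed.

(** For Re s >= -1 one power of v can be spared. In the remainder estimate half of it pays for the
    powers of ln v, the other half for v^|h| with |h| <= 1/2. *)
Lemma zeta_kernel_decay (n : nat) (s : C) (u : R) : -1 <= Re s -> 0 <= u <= 1 ->
  Cmod (zeta_kernel n s u) * exp (ln (INR n + 1 + u)) <= / (INR n + 1) ^ 2.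
Proof.
  intros Hs Hu. pose proof (node_ge_1 n u (proj1 Hu)) as Hv. set (v := INR n + 1 + u) in *.
  unfold zeta_kernel. fold v. rewrite Cmod_mult, Cmod_R.
  pose proof (em_kernel_bound u Hu). pose proof (Rabs_pos (em_kernel u)).
  assert (E : Cmod (Rcpow v (- s - 4)) * exp (ln v) <= / v ^ 2).
  { replace (Cmod (Rcpow v (- s - 4)) * exp (ln v)) with (Cmod (Rcpow v (- (s - 1) - 4))).
    - apply Rcpow_decay; [|exact Hv]. rewrite Re_minus. simpl. lra.
    - rewrite !Cmod_Rcpow, <- exp_plus. f_equal. reim. reim. ring. }
  pose proof (inv_node_sqr n u (proj1 Hu)) as H2. fold v in H2.
  pose proof (Cmod_ge_0 (Rcpow v (- s - 4))). pose proof (exp_pos (ln v)).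
  assert (0 <= Cmod (Rcpow v (- s - 4)) * exp (ln v)) by nra.
  rewrite Rmult_assoc. nra.
Qed.

Lemma zeta_coef_step_bound (k n : nat) (s : C) : -1 <= Re s ->
  Cmod (zeta_coef_step k n s) <= 2 ^ k / (INR n + 1) ^ 2.
Proof.
  intros Hs.
  replace (2 ^ k / (INR n + 1) ^ 2) with ((1 - 0) * (2 ^ k * / (INR n + 1) ^ 2)) by (unfold Rdiv; ring).
  eapply Cmod_CInt_le_const; [lra| |apply zeta_coef_step_correct].
  intros u Hu. unfold zeta_coef_kernel. rewrite Cmod_mult, Cmod_R.
  pose proof (zeta_kernel_decay n s u Hs Hu) as HD.
  pose proof (node_ge_1 n u (proj1 Hu)) as Hv. set (v := INR n + 1 + u) in *.
  assert (Hl : 0 <= ln v) by (rewrite <- ln_1; apply ln_le; lra).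
  assert (E : Rabs ((- ln v) ^ k / INR (fact k)) <= 2 ^ k * exp (ln v)).
  { unfold Rdiv. rewrite Rabs_mult, <- RPow_abs, Rabs_Ropp, (Rabs_pos_eq (ln v)) by exact Hl.
    rewrite Rabs_pos_eq by (left; apply Rinv_0_lt_compat, INR_fact_lt_0).
    eapply Rle_trans; [apply (ln_pow_bound k v Hv)|].
    apply Rmult_le_compat_l; [apply pow_le; lra|]. apply exp_le. lra. }
  pose proof (Cmod_ge_0 (zeta_kernel n s u)).
  apply Rle_trans with (Cmod (zeta_kernel n s u) * (2 ^ k * exp (ln v))).
  - now apply Rmult_le_compat_l.
  - replace (Cmod (zeta_kernel n s u) * (2 ^ k * exp (ln v)))
      with (2 ^ k * (Cmod (zeta_kernel n s u) * exp (ln v))) by ring.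
    apply Rmult_le_compat_l; [apply pow_le; lra | exact HD].
Qed.

Lemma is_CInt_Cpsum (f : nat -> R -> C) (l : nat -> C) (a b : R) (n : nat) :
  (forall k, is_CInt (f k) a b (l k)) ->
  is_CInt (fun t => Cpsum (fun k => f k t) n) a b (Cpsum l n).
Proof.
  intros H. induction n.
  - cbn [Cpsum]. replace (RtoC 0) with (0 * l 0%nat)%C by ring.
    eapply (is_RInt_ext (V := C_R_NormedModule)); [|apply is_CInt_mult_l, (H 0%nat)].
    intros t _. cbn beta. now rewrite !Cmult_0_l.
  - cbn [Cpsum]. apply (is_RInt_plus (V := C_R_NormedModule)); [exact IHn | apply H].
Qed.

(** The remainder of the exponential series at -h ln v, integrated against the kernel. The ratio
    2|h| comes from [ln_pow_bound]. *)
Lemma zeta_step_rem_bound (K n : nat) (s h : C) : -1 <= Re s -> Cmod h <= / 2 ->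
  Cmod (zeta_step n (s + h) - Cpsum (fun k => h ^ k * zeta_coef_step k n s)%C K)%C
    <= (2 * Cmod h) ^ K / (INR n + 1) ^ 2.
Proof.
  intros Hs Hh.
  replace ((2 * Cmod h) ^ K / (INR n + 1) ^ 2)
    with ((1 - 0) * ((2 * Cmod h) ^ K * / (INR n + 1) ^ 2)) by (unfold Rdiv; ring).
  eapply Cmod_CInt_le_const; [lra| |
    apply is_CInt_minus; [apply zeta_step_correct|
      apply (is_CInt_Cpsum (fun k u => h ^ k * zeta_coef_kernel k n s u)%C); intros k;
      apply is_CInt_mult_l, zeta_coef_step_correct]].
  intros u Hu. cbn beta.
  pose proof (zeta_kernel_decay n s u Hs Hu) as HD.
  pose proof (node_ge_1 n u (proj1 Hu)) as Hv. set (v := INR n + 1 + u) in *.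
  assert (Hl : 0 <= ln v) by (rewrite <- ln_1; apply ln_le; lra).
  set (w := (- (h * RtoC (ln v)))%C).
  replace (zeta_kernel n (s + h) u - Cpsum (fun k => h ^ k * zeta_coef_kernel k n s u)%C K)%C
    with (zeta_kernel n s u * exp_rem K w)%C.
  2:{ unfold exp_rem.
      replace (zeta_kernel n (s + h) u) with (zeta_kernel n s u * Cexp w)%C.
      - rewrite (Cpsum_ext (fun k => h ^ k * zeta_coef_kernel k n s u)%C
          (fun k => zeta_kernel n s u * (w ^ k / RtoC (INR (fact k))))%C).
        + rewrite Cpsum_mult_l. ring.
        + intros k. unfold zeta_coef_kernel. fold v. unfold w.
          rewrite RtoC_div by apply INR_fact_neq_0. rewrite RtoC_pow, RtoC_opp.
          replace (- (h * RtoC (ln v)))%C with (h * - RtoC (ln v))%C by ring.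
          rewrite Cpow_mult_l. unfold Cdiv. ring.
      - unfold zeta_kernel. fold v. unfold Rcpow, w. rewrite <- Cmult_assoc, <- Cexp_plus.
        do 2 f_equal. ring. }
  assert (Ew : Cmod w = Cmod h * ln v).
  { unfold w. rewrite Cmod_opp, Cmod_mult, Cmod_R, Rabs_pos_eq by exact Hl. reflexivity. }
  rewrite Cmod_mult.
  pose proof (exp_rem_bound K w) as HB. rewrite Ew in HB.
  pose proof (Cmod_ge_0 h) as Hh0. pose proof (Cmod_ge_0 (zeta_kernel n s u)) as Hk0.
  assert (E : Cmod (exp_rem K w) <= (2 * Cmod h) ^ K * exp (ln v)).
  { eapply Rle_trans; [exact HB|].
    rewrite Rpow_mult_distr. unfold Rdiv. rewrite (Rmult_assoc (Cmod h ^ K)).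
    pose proof (ln_pow_bound K v Hv) as H1. unfold Rdiv in H1.
    assert (exp (Cmod h * ln v) <= exp (ln v * / 2)) by (apply exp_le; nra).
    replace (exp (ln v)) with (exp (ln v * / 2) * exp (ln v * / 2)) by (rewrite <- exp_plus; f_equal; field).
    rewrite Rpow_mult_distr.
    replace (2 ^ K * Cmod h ^ K * (exp (ln v * / 2) * exp (ln v * / 2)))
      with ((Cmod h ^ K * (2 ^ K * exp (ln v * / 2))) * exp (ln v * / 2)) by ring.
    apply Rmult_le_compat; [|left; apply exp_pos| |assumption].
    - apply Rmult_le_pos; [now apply pow_le|]. apply Rmult_le_pos; [now apply pow_le|].
      left. apply Rinv_0_lt_compat, INR_fact_lt_0.
    - apply Rmult_le_compat_l; [now apply pow_le | exact H1]. }
  apply Rle_trans with (Cmod (zeta_kernel n s u) * ((2 * Cmod h) ^ K * exp (ln v))).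
  - now apply Rmult_le_compat_l.
  - replace (Cmod (zeta_kernel n s u) * ((2 * Cmod h) ^ K * exp (ln v)))
      with ((2 * Cmod h) ^ K * (Cmod (zeta_kernel n s u) * exp (ln v))) by ring.
    apply Rmult_le_compat_l; [apply pow_le; lra | exact HD].
Qed.

Lemma Clim_Cpsum (u : nat -> nat -> C) (l : nat -> C) (K : nat) :
  (forall k, Clim (u k) (l k)) -> Clim (fun N => Cpsum (fun k => u k N) K) (Cpsum l K).
Proof.
  intros H. induction K; cbn [Cpsum]; [apply Clim_const | now apply Clim_plus].
Qed.

Lemma Cpsum_swap (f : nat -> nat -> C) (N K : nat) :
  Cpsum (fun n => Cpsum (fun k => f k n) K) N = Cpsum (fun k => Cpsum (f k) N) K.
Proof.
  induction N.
  - cbn [Cpsum]. induction K; cbn [Cpsum]; [reflexivity | rewrite <- IHK; ring].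
  - cbn [Cpsum]. rewrite IHN, <- Cpsum_plus. reflexivity.
Qed.

(** Only finite sums over k are exchanged with the limit over nodes. The final factor 2 is the tail
    bound of [Csum_inv_sqr] at n = 0, where the tail is the whole sum. *)
Lemma zeta_rem_expansion (K : nat) (s h : C) : -1 <= Re s -> Cmod h <= / 2 ->
  Cmod (zeta_rem (s + h) - Cpsum (fun k => h ^ k * zeta_coef s k)%C K)%C <= 2 * (2 * Cmod h) ^ K.
Proof.
  intros Hs Hh.
  destruct (Csum_inv_sqr _ _ (fun n => zeta_step_rem_bound K n s h Hs Hh)) as [L B].
  specialize (B 0%nat). cbn [Cpsum] in B. simpl INR in B.
  set (l := Csum _) in *.
  replace (zeta_rem (s + h) - Cpsum (fun k => h ^ k * zeta_coef s k)%C K)%C with l.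
  - replace l with (l - 0)%C by ring. eapply Rle_trans; [exact B|]. right. field.
  - eapply Clim_unique; [exact L|].
    apply Clim_ext with (fun N => Cpsum (fun n => zeta_step n (s + h)) N
      - Cpsum (fun k => h ^ k * Cpsum (fun n => zeta_coef_step k n s) N) K)%C.
    + intros N. unfold Cminus. rewrite Cpsum_plus. f_equal.
      rewrite (Cpsum_ext (fun k => - Cpsum _ K)%C
        (fun n => -1 * Cpsum (fun k => h ^ k * zeta_coef_step k n s)%C K)%C) by (intros; ring).
      rewrite Cpsum_mult_l, (Cpsum_swap (fun k n => h ^ k * zeta_coef_step k n s)%C).
      rewrite (Cpsum_ext (fun k => h ^ k * Cpsum (fun n => zeta_coef_step k n s) N)%C
        (fun k => Cpsum (fun n => h ^ k * zeta_coef_step k n s)%C N)).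
      * ring.
      * intros k. symmetry. apply Cpsum_mult_l.
    + apply Clim_minus.
      * apply zeta_rem_lim. rewrite Re_plus. generalize (re_le_Cmod h). intros H.
        apply Rabs_le_between in H. lra.
      * apply (Clim_Cpsum (fun k N => h ^ k * Cpsum (fun n => zeta_coef_step k n s) N)%C).
        intros k. apply Clim_mult; [apply Clim_const|].
        apply Csum_inv_sqr with (2 ^ k). intros n. now apply zeta_coef_step_bound.
Qed.

(** * The identity theorem along a segment *)

Definition has_expansion (f : C -> C) (s0 : C) (a : nat -> C) (r : R) : Prop :=
  forall h, Cmod h < r -> Clim (Cpsum (fun k => h ^ k * a k)%C) (f (s0 + h)%C).

Definition expandable (f : C -> C) (s0 : C) : Prop :=
  exists a r, 0 < r /\ has_expansion f s0 a r.

Lemma pow_n_Cpow (h : C) (k : nat) : pow_n (K := C_Ring) h k = (h ^ k)%C.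
Proof. induction k; simpl; [reflexivity | now rewrite IHk]. Qed.

Lemma analytic_expandable (f : C -> C) (s0 : C) : analytic_at f s0 -> expandable f s0.
Proof.
  intros (a & r & Hr & H). exists a, r. split; [exact Hr|]. intros h Hh.
  specialize (H (s0 + h)%C). replace (s0 + h - s0)%C with h in H by ring. specialize (H Hh).
  apply Clim_incr_1, Clim_locally. unfold is_pseries, is_series in H.
  eapply filterlim_ext; [|exact H]. intros N. cbv beta.
  assert (E : forall k, scal (K := C_AbsRing) (V := C_NormedModule) (pow_n (K := C_AbsRing) h k) (a k)
    = (h ^ k * a k)%C) by (intros k; now rewrite <- pow_n_Cpow).
  induction N.
  - rewrite sum_O, E. cbn [Cpsum]. now rewrite Cplus_0_l.
  - rewrite sum_Sn, IHN, E. reflexivity.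
Qed.

Lemma expandable_ext (f g : C -> C) (s0 : C) :
  (forall s, f s = g s) -> expandable f s0 -> expandable g s0.
Proof.
  intros E (a & r & Hr & H). exists a, r. split; [exact Hr|]. intros h Hh.
  rewrite <- E. now apply H.
Qed.

Lemma expandable_const (c s0 : C) : expandable (fun _ => c) s0.
Proof.
  exists (fun k => match k with O => c | _ => RtoC 0 end), 1. split; [lra|]. intros h _.
  apply Clim_incr_1. apply Clim_ext with (fun _ => c); [|apply Clim_const].
  intros n. induction n.
  - simpl. ring.
  - change (Cpsum ?f (S (S n))) with (Cpsum f (S n) + f (S n))%C. rewrite <- IHn. ring.
Qed.

Lemma expandable_minus (f g : C -> C) (s0 : C) :
  expandable f s0 -> expandable g s0 -> expandable (fun s => f s - g s)%C s0.
Proof.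
  intros (a & r & Hr & H) (b & r' & Hr' & H').
  exists (fun k => a k - b k)%C, (Rmin r r'). split; [now apply Rmin_pos|]. intros h Hh.
  pose proof (Rmin_l r r'). pose proof (Rmin_r r r').
  apply Clim_ext with (fun n => Cpsum (fun k => h ^ k * a k)%C n - Cpsum (fun k => h ^ k * b k)%C n)%C.
  - intros n. induction n; cbn [Cpsum]; [ring|]. rewrite <- IHn. ring.
  - apply Clim_minus; [apply H | apply H']; lra.
Qed.

(** Writing s0 + h - c as (s0 - c) + h merely shifts coefficients, so no Cauchy product arises. *)
Lemma expandable_mult_linear (f : C -> C) (c s0 : C) :
  expandable f s0 -> expandable (fun s => (s - c) * f s)%C s0.
Proof.
  intros (a & r & Hr & H).
  exists (fun k => (s0 - c) * a k + match k with O => RtoC 0 | S j => a j end)%C, r.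
  split; [exact Hr|]. intros h Hh. apply Clim_incr_1.
  apply Clim_ext with (fun n => (s0 - c) * Cpsum (fun k => h ^ k * a k)%C (S n)
     + h * Cpsum (fun k => h ^ k * a k)%C n)%C.
  - intros n. induction n.
    + simpl. ring.
    + change (Cpsum ?g (S (S n))) with (Cpsum g (S n) + g (S n))%C. rewrite <- IHn.
      cbn [Cpsum]. simpl. ring.
  - replace ((s0 + h - c) * f (s0 + h))%C with ((s0 - c) * f (s0 + h) + h * f (s0 + h))%C by ring.
    apply Clim_plus; (apply Clim_mult; [apply Clim_const|]).
    + apply Clim_incr_1. now apply H.
    + now apply H.
Qed.

Lemma Clim_bounded (u : nat -> C) (l : C) : Clim u l -> exists B, forall n, Cmod (u n) <= B.
Proof.
  intros H. apply Clim_locally in H.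
  destruct (filterlim_bounded (V := C_R_NormedModule) u (ex_intro _ l H)) as [B HB].
  exists B. intros n. rewrite <- norm_C_R. apply HB.
Qed.

(** With |a_k| r^k <= M and |h| <= r/2 the terms after the first possibly nonzero one are dominated
    by a geometric series of ratio 1/2; 2 - 2 (1/2)^j is its partial sum. *)
Lemma expansion_tail (a : nat -> C) (r : R) (M : R) (h : C) (m : nat) :
  0 < r -> (forall k, Cmod (a k) * r ^ k <= M) -> Cmod h <= r / 2 ->
  (forall k, (k < m)%nat -> a k = 0%C) ->
  forall j, Cmod (Cpsum (fun k => h ^ k * a k)%C (S m + j) - h ^ m * a m)%C
    <= M * (Cmod h / r) ^ S m * (2 - 2 * (/ 2) ^ j).
Proof.
  intros Hr HM Hh H0 j. set (x := Cmod h / r).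
  assert (Hx : 0 <= x <= / 2).
  { unfold x. pose proof (Cmod_ge_0 h). split.
    - apply Rmult_le_pos; [lra | left; now apply Rinv_0_lt_compat].
    - apply Rmult_le_reg_r with r; [exact Hr|]. unfold Rdiv.
      rewrite Rmult_assoc, Rinv_l by lra. lra. }
  assert (HM0 : 0 <= M).
  { eapply Rle_trans; [|apply (HM 0%nat)]. simpl. rewrite Rmult_1_r. apply Cmod_ge_0. }
  induction j.
  - rewrite Nat.add_0_r. cbn [Cpsum].
    assert (E : Cpsum (fun k => h ^ k * a k)%C m = 0%C).
    { clear HM. assert (G : forall n, (n <= m)%nat -> Cpsum (fun k => h ^ k * a k)%C n = 0%C).
      { induction n; intros Hn; [reflexivity|]. cbn [Cpsum].
        rewrite IHn, H0 by lia. ring. }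
      now apply G. }
    rewrite E. replace (0 + h ^ m * a m - h ^ m * a m)%C with (RtoC 0) by ring.
    rewrite Cmod_0. simpl. lra.
  - rewrite Nat.add_succ_r. cbn [Cpsum].
    match goal with |- Cmod (?A + ?B - ?D)%C <= _ =>
      replace (A + B - D)%C with ((A - D) + B)%C by ring end.
    eapply Rle_trans; [apply Cmod_triangle|].
    assert (T : Cmod (h ^ (S m + j) * a (S m + j)%nat)%C <= M * x ^ S m * (/ 2) ^ j).
    { rewrite Cmod_mult, Cmod_pow. replace (Cmod h) with (x * r) by (unfold x; field; lra).
      rewrite Rpow_mult_distr.
      replace (x ^ (S m + j) * r ^ (S m + j) * Cmod (a (S m + j)%nat))
        with ((Cmod (a (S m + j)%nat) * r ^ (S m + j)) * (x ^ S m * x ^ j))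
        by (rewrite <- pow_add; ring).
      rewrite (Rmult_assoc M). apply Rmult_le_compat.
      - apply Rmult_le_pos; [apply Cmod_ge_0 | apply pow_le; lra].
      - apply Rmult_le_pos; apply pow_le; lra.
      - apply HM.
      - apply Rmult_le_compat_l; [apply pow_le; lra|]. apply pow_incr. lra. }
    rewrite <- (tech_pow_Rmult (/ 2) j). lra.
Qed.

(** Strong induction on the coefficients: once those below m vanish, zeros at arbitrarily small h
    make |a_m| no larger than the tail over |h|^m, which is O(|h|). *)
Lemma expansion_zero (f : C -> C) (s0 : C) (a : nat -> C) (r : R) :
  0 < r -> has_expansion f s0 a r ->
  (forall d, 0 < d -> exists h, 0 < Cmod h < d /\ f (s0 + h)%C = 0%C) ->
  forall h, Cmod h < r -> f (s0 + h)%C = 0%C.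
Proof.
  intros Hr H Hacc.
  set (rho := r / 2). assert (Hrho : 0 < rho < r) by (unfold rho; lra).
  (* Convergence at radius r/2 bounds the partial sums by B, hence each term, a difference of two of
     them, by 2B. *)
  destruct (Clim_bounded _ _ (H (RtoC rho) ltac:(rewrite Cmod_R, Rabs_pos_eq; lra))) as [B HB].
  assert (HM : forall k, Cmod (a k) * rho ^ k <= 2 * B).
  { intros k. replace (Cmod (a k) * rho ^ k) with (Cmod (RtoC rho ^ k * a k)%C).
    - pose proof (HB k) as B1. pose proof (HB (S k)) as B2. cbn [Cpsum] in B2.
      set (P := Cpsum _ k) in *.
      replace (RtoC rho ^ k * a k)%C with ((P + RtoC rho ^ k * a k) - P)%C by ring.
      eapply Rle_trans; [apply Cmod_triangle_sub|]. lra.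
    - rewrite Cmod_mult, Cmod_pow, Cmod_R, Rabs_pos_eq by lra. ring. }
  assert (Ha : forall m, a m = 0%C).
  { intros m. induction m as [m IH] using (well_founded_induction lt_wf).
    apply Cmod_eq_0. apply Rle_antisym; [|apply Cmod_ge_0].
    apply le_epsilon. intros eps He. rewrite Rplus_0_l.
    assert (HB0 : 0 <= B) by (eapply Rle_trans; [apply Cmod_ge_0 | apply (HB 0%nat)]).
    assert (Hp : 0 < rho ^ m) by (apply pow_lt; lra).
    (* A zero with |h| < d gives rho^m |a_m| <= 4 B |h| / rho <= eps rho^m; the added 1 keeps the
       denominator positive when B = 0. *)
    set (d := Rmin (rho / 2) (rho * (eps * rho ^ m / (4 * B + 1)))).
    assert (Hd : 0 < d).
    { apply Rmin_pos; [lra|]. apply Rmult_lt_0_compat; [lra|].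
      apply Rdiv_lt_0_compat; [now apply Rmult_lt_0_compat | lra]. }
    destruct (Hacc d Hd) as (h & [Hh1 Hh2] & Hf).
    pose proof (Rmin_l (rho / 2) (rho * (eps * rho ^ m / (4 * B + 1)))) as D1.
    pose proof (Rmin_r (rho / 2) (rho * (eps * rho ^ m / (4 * B + 1)))) as D2. fold d in D1, D2.
    set (x := Cmod h / rho).
    assert (Hx : 0 < x) by (apply Rdiv_lt_0_compat; lra).
    assert (T : Cmod (0 - h ^ m * a m)%C <= 2 * B * x ^ S m * 2).
    { apply Clim_Cmod_le with
        (u := fun j => (Cpsum (fun k => h ^ k * a k)%C (S m + j) - h ^ m * a m)%C).
      - apply Clim_minus; [|apply Clim_const]. rewrite <- Hf.
        pose proof (H h ltac:(lra)) as [L1 L2]. split.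
        + apply is_lim_seq_ext with (fun j => Re (Cpsum (fun k => h ^ k * a k)%C (j + S m))).
          { intros j. now rewrite Nat.add_comm. }
          apply (is_lim_seq_incr_n (fun j => Re (Cpsum (fun k => h ^ k * a k)%C j))). exact L1.
        + apply is_lim_seq_ext with (fun j => Im (Cpsum (fun k => h ^ k * a k)%C (j + S m))).
          { intros j. now rewrite Nat.add_comm. }
          apply (is_lim_seq_incr_n (fun j => Im (Cpsum (fun k => h ^ k * a k)%C j))). exact L2.
      - intros j. eapply Rle_trans.
        + apply (expansion_tail a rho (2 * B) h m); [lra | exact HM | lra |].
          intros k Hk. now apply IH.
        + fold x. apply Rmult_le_compat_l.
          * apply Rmult_le_pos; [lra | apply pow_le; lra].
          * assert (0 <= (/ 2) ^ j) by (apply pow_le; lra). lra. }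
    replace (0 - h ^ m * a m)%C with (- (h ^ m * a m))%C in T by ring.
    rewrite Cmod_opp, Cmod_mult, Cmod_pow in T.
    replace (Cmod h) with (x * rho) in T by (unfold x; field; lra).
    rewrite Rpow_mult_distr, <- tech_pow_Rmult in T.
    assert (Hxm : 0 < x ^ m) by now apply pow_lt.
    assert (T2 : rho ^ m * Cmod (a m) <= 4 * B * x).
    { apply Rmult_le_reg_l with (x ^ m); [exact Hxm|]. lra. }
    assert (Ex : x <= eps * rho ^ m / (4 * B + 1)).
    { unfold x. apply Rmult_le_reg_r with rho; [lra|]. unfold Rdiv at 1.
      rewrite Rmult_assoc, Rinv_l by lra. lra. }
    apply Rmult_le_reg_l with (rho ^ m); [exact Hp|].
    eapply Rle_trans; [exact T2|].
    apply Rle_trans with (4 * B * (eps * rho ^ m / (4 * B + 1))).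
    - apply Rmult_le_compat_l; lra.
    - assert (He2 : 0 < eps * rho ^ m) by (now apply Rmult_lt_0_compat).
      apply Rmult_le_reg_r with (4 * B + 1); [lra|].
      replace (4 * B * (eps * rho ^ m / (4 * B + 1)) * (4 * B + 1))
        with (4 * B * (eps * rho ^ m)) by (field; lra). nra. }
  intros h Hh. eapply Clim_unique; [apply H, Hh|].
  apply Clim_ext with (fun _ => RtoC 0); [|apply Clim_const].
  intros n. induction n; cbn [Cpsum]; [reflexivity|]. rewrite <- IHn, Ha. ring.
Qed.

(** Let T be the supremum of the parameters up to which f vanishes. Zeros just below T accumulate at
    T, so f vanishes on a whole disc there; if T < 1, this would carry the zeros beyond T. *)
Lemma segment_identity (f : C -> C) (p v : C) (t1 : R) :
  v <> 0%C -> 0 < t1 ->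
  (forall t, 0 <= t <= 1 -> expandable f (p + RtoC t * v)%C) ->
  (forall t, 0 <= t <= t1 -> f (p + RtoC t * v)%C = 0%C) ->
  exists r, 0 < r /\ forall h, Cmod h < r -> f (p + v + h)%C = 0%C.
Proof.
  intros Hv Ht1 Hexp H0.
  apply Cmod_gt_0 in Hv.
  set (E := fun t => 0 <= t <= 1 /\ forall s, 0 <= s <= t -> f (p + RtoC s * v)%C = 0%C).
  assert (HE1 : E (Rmin t1 1)).
  { pose proof (Rmin_l t1 1). pose proof (Rmin_r t1 1).
    assert (0 < Rmin t1 1) by (apply Rmin_pos; lra).
    split; [lra|]. intros s Hs. apply H0. lra. }
  destruct (completeness E) as [T [HT1 HT2]].
  { exists 1. intros t [Ht _]. lra. }
  { now exists (Rmin t1 1). }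
  assert (HTp : 0 < T).
  { apply Rlt_le_trans with (Rmin t1 1); [apply Rmin_pos; lra | now apply HT1]. }
  assert (HTl : T <= 1) by (apply HT2; intros t [Ht _]; lra).
  assert (Hbelow : forall s, 0 <= s < T -> f (p + RtoC s * v)%C = 0%C).
  { intros s Hs. destruct (classic (exists t, E t /\ s < t)) as [(t & [_ Ht] & Hst)|Hn].
    - apply Ht. lra.
    - exfalso. assert (T <= s); [|lra]. apply HT2. intros t Ht. apply Rnot_lt_le. intros Hlt.
      apply Hn. now exists t. }
  destruct (Hexp T ltac:(lra)) as (a & r & Hr & Ha).
  assert (Hball : forall h, Cmod h < r -> f (p + RtoC T * v + h)%C = 0%C).
  { apply (expansion_zero _ _ a r Hr Ha). intros d Hd.
    set (e := Rmin (T / 2) (d / (2 * Cmod v))).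
    assert (He : 0 < e).
    { apply Rmin_pos; [lra | apply Rdiv_lt_0_compat; lra]. }
    pose proof (Rmin_l (T / 2) (d / (2 * Cmod v))) as E1.
    pose proof (Rmin_r (T / 2) (d / (2 * Cmod v))) as E2. fold e in E1, E2.
    exists (RtoC (- e) * v)%C. split.
    - rewrite Cmod_mult, Cmod_R, Rabs_Ropp, Rabs_pos_eq by lra. split; [nra|].
      apply Rle_lt_trans with (d / (2 * Cmod v) * Cmod v).
      + apply Rmult_le_compat_r; lra.
      + replace (d / (2 * Cmod v) * Cmod v) with (d / 2) by (field; lra). lra.
    - replace (p + RtoC T * v + RtoC (- e) * v)%C with (p + RtoC (T - e) * v)%C.
      + apply Hbelow. lra.
      + rewrite RtoC_minus, RtoC_opp. ring. }
  destruct (Req_dec T 1) as [->|HT].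
  - exists r. split; [exact Hr|]. intros h Hh.
    replace (p + v + h)%C with (p + 1 * v + h)%C by ring. now apply Hball.
  - exfalso.
    set (e := Rmin (1 - T) (r / (2 * Cmod v))).
    assert (He : 0 < e).
    { apply Rmin_pos; [lra | apply Rdiv_lt_0_compat; lra]. }
    pose proof (Rmin_l (1 - T) (r / (2 * Cmod v))) as E1.
    pose proof (Rmin_r (1 - T) (r / (2 * Cmod v))) as E2. fold e in E1, E2.
    assert (T + e <= T); [|lra]. apply HT1. split; [lra|]. intros s Hs.
    destruct (Rlt_le_dec s T) as [Hs'|Hs']; [apply Hbelow; lra|].
    replace (p + RtoC s * v)%C with (p + RtoC T * v + RtoC (s - T) * v)%C
      by (rewrite RtoC_minus; ring).
    apply Hball. rewrite Cmod_mult, Cmod_R, Rabs_pos_eq by lra.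
    apply Rle_lt_trans with (r / (2 * Cmod v) * Cmod v).
    + apply Rmult_le_compat_r; lra.
    + replace (r / (2 * Cmod v) * Cmod v) with (r / 2) by (field; lra). lra.
Qed.

(** * The Glaisher-Kinkelin constant *)

Lemma zeta_rem_expandable (s : C) : -1 <= Re s -> expandable zeta_rem s.
Proof.
  intros Hs. exists (zeta_coef s), (/ 2). split; [lra|]. intros h Hh.
  apply Clim_Cmod.
  apply (is_lim_seq_le_le (fun _ => 0) _ (fun K => 2 * (2 * Cmod h) ^ K)).
  - intros K. split; [apply Cmod_ge_0|]. rewrite Cmod_sub_sym.
    apply zeta_rem_expansion; lra.
  - apply is_lim_seq_const.
  - replace (Finite 0) with (Finite (2 * 0)) by (f_equal; ring).
    apply is_lim_seq_mult'; [apply is_lim_seq_const|]. apply is_lim_seq_geom.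
    pose proof (Cmod_ge_0 h). rewrite Rabs_pos_eq; lra.
Qed.

Lemma zeta_near_minus_1 (zeta : C -> C) : is_riemann_zeta zeta ->
  exists r, 0 < r /\ forall h, Cmod h < r ->
    let s := (-1 + h)%C in
    ((s - 1) * (zeta s - 1 / 2 - s / 12 - rising4 s * zeta_rem s) = 1)%C.
Proof.
  intros Hz.
  (* Multiplication by s - 1 removes the pole, so all factors to be expanded besides zeta and the
     remainder are linear. *)
  set (f := fun s => ((s - 1) * (zeta s - 1 / 2 - s / 12 - rising4 s * zeta_rem s) - 1)%C).
  set (p := (2, 3) : C). set (v := (-3, -3) : C).
  (* Up to t = 1/4 the real part 2 - 3t is at least 5/4, where the Dirichlet series applies. *)
  destruct (segment_identity f p v (/ 4)) as (r & Hr & H).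
  - intros E. injection E. lra.
  - lra.
  - intros t Ht. set (s0 := (p + RtoC t * v)%C).
    assert (ER : Re s0 = 2 - 3 * t) by (unfold s0, p, v; simpl; ring).
    assert (EI : Im s0 = 3 - 3 * t) by (unfold s0, p, v; simpl; ring).
    apply (expandable_ext (fun s => (s - 1) * (zeta s - 1 / 2 - (s - 0) * (1 / 12)
      - (s - 0) * ((s - -1) * ((s - -2) * ((s - -3) * zeta_rem s)))) - 1)%C).
    { intros s. unfold f, rising4. field. }
    apply expandable_minus; [|apply expandable_const].
    apply expandable_mult_linear. apply expandable_minus.
    + apply expandable_minus; [apply expandable_minus; [|apply expandable_const]|].
      (* Real part 1 occurs at t = 1/3, where the imaginary part is 2. *)
      * apply analytic_expandable. apply Hz. intros E. rewrite E in ER, EI.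
        simpl in ER, EI. lra.
      * apply expandable_mult_linear, expandable_const.
    + do 4 apply expandable_mult_linear. apply zeta_rem_expandable. lra.
  - intros t Ht. set (s0 := (p + RtoC t * v)%C).
    assert (ER : Re s0 = 2 - 3 * t) by (unfold s0, p, v; simpl; ring).
    unfold f. rewrite (zeta_formula zeta s0 Hz) by lra.
    field. intros E. apply (f_equal Re) in E. rewrite Re_minus, ER in E. simpl in E. lra.
  - exists r. split; [exact Hr|]. intros h Hh. cbv zeta.
    specialize (H h Hh). replace (p + v + h)%C with (-1 + h)%C in H.
    + unfold f in H. set (A := (_ * _)%C) in *. replace A with (A - 1 + 1)%C by ring.
      rewrite H. ring.
    + f_equal. unfold p, v. apply C_eq; simpl; ring.
Qed.

(** At s = -1 the power v^(-s-4) is v^(-3), so the integrals agree termwise with half of those for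
    [bstep] at 1 + k. *)
Lemma zeta_rem_minus_1 : zeta_rem (-1) = (Bsum 1 / 2)%C.
Proof.
  eapply Clim_unique; [apply zeta_rem_lim; simpl; lra|].
  apply Clim_ext with (fun n => Cpsum (fun k => bstep (1 + RtoC (INR k))%C) n * / 2)%C.
  - intros n. rewrite Cmult_comm, <- Cpsum_mult_l. apply Cpsum_ext. intros k.
    assert (Hk : 0 < Re (1 + RtoC (INR k))%C) by (apply Re_plus_R_pos; [simpl; lra | apply pos_INR]).
    pose proof (is_CInt_mult_l (/ 2) _ _ _ _ (bstep_integral _ Hk)) as H1.
    rewrite <- (CInt_unique _ _ _ _ H1).
    apply (RInt_ext (V := C_R_CompleteNormedModule)).
    rewrite Rmin_left, Rmax_right by lra. intros u Hu. unfold zeta_kernel.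
    pose proof (node_ge_1 k u ltac:(lra)) as Hv.
    assert (E : Rcpow (INR k + 1 + u) (- -1 - 4) = (/ (1 + RtoC (INR k) + RtoC u) ^ 3)%C).
    { replace (- -1 - 4)%C with (- (1 + 1 + 1))%C by ring.
      assert (Eo : forall s, Rcpow (INR k + 1 + u) (- s) = (/ Rcpow (INR k + 1 + u) s)%C).
      { intros s. unfold Rcpow. rewrite <- Cexp_opp. f_equal. ring. }
      rewrite Eo, !Rcpow_plus, Rcpow_1 by lra. f_equal.
      rewrite !RtoC_plus. simpl. ring. }
    rewrite E, RtoC_mult. lazymatch goal with |- @eq _ ?a ?b => change (@eq C a b) end. field.
    apply Re_pos_neq_0. apply Re_plus_R_pos; [exact Hk | lra].
  - apply Clim_mult; [|apply Clim_const]. apply Bsum_lim. simpl. lra.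
Qed.

(** [rising4] contains the factor s + 1, so the difference quotient at -1 requires only continuity
    of [zeta_rem] there. *)
Lemma zeta_derive_minus_1 (zeta : C -> C) : is_riemann_zeta zeta ->
  Re (C_derive zeta (RtoC (-1))) = 1 / 12 - 1 / 4 - Re (Bsum 1).
Proof.
  intros Hz. destruct (zeta_near_minus_1 zeta Hz) as (r & Hr & H).
  (* The difference quotient with x + 1 cancelled; at -1 it is -1/4 + 1/12 - 2 W(-1). *)
  set (g := fun x : R => / (2 * (x - 1)) + 1 / 12 + x * (x + 2) * (x + 3) * Re (zeta_rem (RtoC x))).
  assert (Hw : continuity_pt (fun x => Re (zeta_rem (RtoC x))) (-1)).
  { intros eps He. exists (Rmin (/ 4) (eps / 8)). split; [apply Rmin_pos; lra|].
    intros x [_ Hx]. change (Rabs (x - -1) < Rmin (/ 4) (eps / 8)) in Hx.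
    change (Rabs (Re (zeta_rem (RtoC x)) - Re (zeta_rem (RtoC (-1)))) < eps).
    pose proof (Rmin_l (/ 4) (eps / 8)). pose proof (Rmin_r (/ 4) (eps / 8)).
    set (h := x - -1) in *.
    assert (Em : Cmod (RtoC h) = Rabs h) by apply Cmod_R.
    (* The expansion cut after its constant term gives the bound 4|h| on the increment. *)
    pose proof (zeta_rem_expansion 1 (-1) (RtoC h) ltac:(simpl; lra) ltac:(lra)) as A1.
    pose proof (zeta_rem_expansion 1 (-1) (RtoC 0) ltac:(simpl; lra)
      ltac:(rewrite Cmod_0; lra)) as A2.
    rewrite Cmod_0, Em in *. simpl Cpsum in A1, A2.
    rewrite !pow_1, Rmult_0_r in *.
    replace (-1 + 0)%C with (RtoC (-1)) in A2 by ring.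
    replace (-1 + RtoC h)%C with (RtoC x) in A1.
    2:{ unfold h. rewrite RtoC_minus. ring. }
    set (c := (0 + 1 * zeta_coef (-1) 0)%C) in *.
    rewrite <- Re_minus. eapply Rle_lt_trans; [apply re_le_Cmod|].
    replace (zeta_rem (RtoC x) - zeta_rem (RtoC (-1)))%C
      with ((zeta_rem (RtoC x) - c) - (zeta_rem (RtoC (-1)) - c))%C by ring.
    eapply Rle_lt_trans; [apply Cmod_triangle_sub|]. lra. }
  assert (Hg : is_lim g (-1) (g (-1))).
  { apply is_lim_continuity. unfold g.
    apply (continuity_pt_plus (fun x => / (2 * (x - 1)) + 1 / 12)
      (fun x => x * (x + 2) * (x + 3) * Re (zeta_rem (RtoC x)))).
    - apply continuity_pt_filterlim.
      apply (ex_derive_continuous (V := R_NormedModule) (fun x => / (2 * (x - 1)) + 1 / 12)).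
      auto_derive. lra.
    - apply (continuity_pt_mult (fun x => x * (x + 2) * (x + 3))); [|exact Hw].
      apply continuity_pt_filterlim.
      apply (ex_derive_continuous (V := R_NormedModule) (fun x => x * (x + 2) * (x + 3))).
      auto_derive. trivial. }
  (* The radius r may exceed 2, so x = 1 is left open until the neighbourhood is shrunk. *)
  assert (Ezeta : forall x, Rabs (x - -1) < r ->
    (zeta (RtoC x) = 1 / (RtoC x - 1) + 1 / 2 + RtoC x / 12 + rising4 (RtoC x) * zeta_rem (RtoC x))%C
    \/ RtoC x = 1%C).
  { intros x Hx. specialize (H (RtoC (x - -1))). cbv zeta in H.
    replace (-1 + RtoC (x - -1))%C with (RtoC x) in H by (rewrite RtoC_minus; ring).
    specialize (H ltac:(now rewrite Cmod_R)).
    destruct (classic (RtoC x = 1%C)) as [E|E]; [now right | left].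
    assert (Hn : (RtoC x - 1)%C <> 0%C).
    { intros E'. apply E. replace (RtoC x) with (RtoC x - 1 + 1)%C by ring. rewrite E'. ring. }
    rewrite <- H at 1. field. exact Hn. }
  (* [C_lim] takes the limit along the horizontal line through the point, here the real axis. *)
  unfold C_derive, C_lim. unfold Re at 1. cbn [fst snd].
  change (fst (RtoC (-1))) with (-1). change (snd (RtoC (-1))) with 0.
  rewrite (is_lim_unique _ _ (g (-1))).
  - unfold g. rewrite zeta_rem_minus_1.
    replace (Re (Bsum 1 / 2)%C) with (Re (Bsum 1) / 2).
    + generalize (Re (Bsum 1)). intros b. simpl. field.
    + unfold Cdiv. rewrite <- RtoC_inv by lra. rewrite re_scal_r. reflexivity.
  - apply is_lim_ext_loc with g; [|exact Hg].
    set (d := Rmin r 1). assert (Hd : 0 < d) by (apply Rmin_pos; lra).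
    exists (mkposreal d Hd). intros x Hx Hx1.
    unfold ball in Hx; simpl in Hx; unfold AbsRing_ball, abs, minus, plus, opp in Hx; simpl in Hx.
    change (x + - -1) with (x - -1) in Hx.
    pose proof (Rmin_l r 1). pose proof (Rmin_r r 1). fold d in H0, H1.
    assert (Hxn : x < 0) by (apply Rabs_lt_between in Hx; lra).
    change (x, 0) with (RtoC x).
    destruct (Ezeta x) as [E|E]; [lra| |exfalso; injection E; lra].
    destruct (Ezeta (-1)) as [E1|E1]; [rewrite Rminus_diag, Rabs_R0; lra| |exfalso; injection E1; lra].
    rewrite E, E1. unfold g.
    replace (rising4 (RtoC (-1))) with (RtoC 0) by (unfold rising4; ring).
    assert (Hn1 : (RtoC x - 1)%C <> 0%C).
    { rewrite <- RtoC_minus. apply RtoC_neq_0. lra. }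
    assert (Hn2 : (RtoC x - -1)%C <> 0%C).
    { rewrite <- RtoC_minus. apply RtoC_neq_0. lra. }
    transitivity (Re (RtoC (/ (2 * (x - 1)) + 1 / 12)
      + RtoC (x * (x + 2) * (x + 3)) * zeta_rem (RtoC x))%C).
    { rewrite Re_plus, re_scal_l, Re_RtoC. reflexivity. }
    unfold Re. f_equal. unfold rising4.
    rewrite !RtoC_plus, RtoC_inv, !RtoC_mult, RtoC_div, RtoC_minus, !RtoC_plus by lra.
    field. repeat split; assumption.
Qed.

Lemma Bsum_1_real : Im (Bsum 1) = 0.
Proof.
  eapply Clim_Im_0; [apply Bsum_lim; simpl; lra|].
  intros n. rewrite Cpsum_bstep_1. unfold bpot, bernoulli2. im0. lra.
Qed.

Lemma ln_glaisher (zeta : C -> C) : is_riemann_zeta zeta ->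
  RtoC (ln (glaisher zeta)) = (1 / 4 + Bsum 1)%C.
Proof.
  intros Hz. unfold glaisher. rewrite ln_exp, zeta_derive_minus_1 by exact Hz.
  apply C_eq.
  - rewrite Re_plus, Re_RtoC. unfold Cdiv. rewrite <- RtoC_inv, <- RtoC_mult, Re_RtoC by lra. field.
  - rewrite Im_plus, Bsum_1_real. unfold Cdiv. rewrite <- RtoC_inv, <- RtoC_mult, !Im_RtoC by lra. ring.
Qed.

Theorem proposition4p1 (zeta : C -> C) (hzeta : is_riemann_zeta zeta)
  (z : C) (hz : 0 < Re z) :
  ex_RInt_gen (V := C_R_NormedModule) (binet_integrand z)
    (at_right 0) (Rbar_locally p_infty) /\
  log_branch (fun w : C => BarnesG (w + 1)) z =
    (z * log_branch Gamma z + z ^ 2 / 4 - Clog z / 2 * bernoulli2 z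
     - RtoC (ln (glaisher zeta))
     + RInt_gen (V := C_R_CompleteNormedModule) (binet_integrand z)
         (at_right 0) (Rbar_locally p_infty))%C.
Proof.
  pose proof (binet_integral z hz) as HI. split.
  - now exists (Bsum z).
  - rewrite (log_branch_eq _ _ z LBarnes_branch hz), (log_branch_eq _ _ z LGamma_branch hz).
    rewrite (is_CInt_gen_unique _ _ HI), (ln_glaisher zeta hzeta). reflexivity.
Qed.
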